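(* Let $x_{ij}$, $0\le i\le j<\infty$, be real i.i.d. random variables of zero mean and variance $s^2$ (with $s\ge0$), put $x_{ji}=x_{ij}$ for $i<j$, and let $$X_N=\frac{1}{\sqrt N}\,H_N\,[x_{ij}]_{i,j=0}^N,\qquad H_N=\begin{bmatrix}-1&0\\0&I_N\end{bmatrix}.$$ Let $\beta_N$ be the eigenvalue of nonpositive type of $X_N$, and let $\lambda_1^N\le\cdots\le\lambda_N^N$ be the eigenvalues of $C_N=\frac{1}{\sqrt N}[x_{ij}]_{i,j=1}^N$. Then: (i) $\beta_N$ converges in probability, as $N\to\infty$, to $\beta_0=\frac{\sqrt2}{2}\,s\,\mathrm{i}$. (ii) If, additionally, the random variables $x_{ij}$ $(0\le i<j<\infty)$ are continuous, then the probability of the event that there are precisely $N-1$ real eigenvalues $\zeta_2^N<\cdots<\zeta_N^N$ of $X_N$ and that the inequalities $$\lambda_1^N<\zeta_2^N<\lambda_2^N<\cdots<\lambda_{N-1}^N<\zeta_N^N<\lambda_N^N$$ are satisfied converges to $1$ as $N\to\infty$.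
   Context: A matrix $X$ is $H$-selfadjoint if $X^*H=HX$; $X_N$ is $H_N$-selfadjoint. Write $[x,y]_H=y^*Hx$. By a theorem of Pontryagin, there is exactly one $\beta_N$ in the union of the open upper half-plane and the real line which is an eigenvalue of $X_N$ possessing an eigenvector $x\neq0$ with $[x,x]_{H_N}\le0$; it is called the eigenvalue of nonpositive type of $X_N$. A real random variable is called continuous if its law is absolutely continuous with respect to Lebesgue measure. *)

(* Defs.v *)
From HB Require Import structures.
From mathcomp Require Import all_boot all_order all_algebra.
From mathcomp Require Import all_classical all_reals all_analysis.
From mathcomp Require Import complex.

Set Implicit Arguments.
Unset Strict Implicit.
Unset Printing Implicit Defensive.

Import Order.TTheory GRing.Theory Num.Theory.
Import numFieldNormedType.Exports.

Local Open Scope classical_set_scope.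
Local Open Scope ring_scope.
Local Open Scope complex_scope.
Local Open Scope sesquilinear_scope.

(* Mutual independence of the subfamily of X indexed by D. *)
Definition mutually_independent (d : measure_display) (T : measurableType d)
    (R : realType) (P : probability T R) (I : eqType) (D : set I)
    (X : I -> {RV P >-> R}) : Prop :=
  forall (J : seq I) (B : I -> set R),
    uniq J -> [set` J] `<=` D -> (forall i, measurable (B i)) ->
    P (\bigcap_(i in [set` J]) (X i @^-1` B i)) =
    (\prod_(i <- J) P (X i @^-1` B i))%E.

Definition same_law (d : measure_display) (T : measurableType d)
    (R : realType) (P : probability T R) (X Y : {RV P >-> R}) : Prop :=
  forall B : set R, measurable B -> distribution P X B = distribution P Y B.

Definition continuous_law (d : measure_display) (T : measurableType d)
    (R : realType) (P : probability T R) (X : {RV P >-> R}) : Prop :=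
  distribution P X `<< @lebesgue_measure R.

(* P (A N) only has a meaning when A N is measurable, so measurability is
   asserted together with the limit. *)
Definition probability_cvg (d : measure_display) (T : measurableType d)
    (R : realType) (P : probability T R) (A : nat -> set T) (p : R) : Prop :=
  (forall N, measurable (A N)) /\ (P (A N) @[N --> \oo] --> p%:E)%E.

Definition cvg_in_probability (d : measure_display) (T : measurableType d)
    (R : realType) (P : probability T R) (Z : nat -> T -> R[i]) (z : R[i]) :
    Prop :=
  forall e : R, 0 < e ->
    probability_cvg P
      (fun N => [set w | e < ComplexField.Normc.normc (Z N w - z)]) 0.

Definition indef_form (R : realType) (n : nat) (H : 'M[R[i]]_n)
    (x y : 'cV[R[i]]_n) : R[i] :=
  (y ^t* *m H *m x) 0 0.

(* In the partial order of R[i], z <= 0 says that z is real and nonpositive;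
   the form is real on the diagonal when H is Hermitian. *)
Definition eigenvalue_of_nonpositive_type (R : realType) (n : nat)
    (H X : 'M[R[i]]_n) (b : R[i]) : Prop :=
  0 <= complex.Im b /\
  exists x : 'cV[R[i]]_n,
    [/\ x != 0, X *m x = b *: x & indef_form H x x <= 0].

(* The eigenvalues in nondecreasing order, repeated according to their
   algebraic multiplicity. *)
Definition ordered_spectrum (R : realType) (n : nat) (A : 'M[R]_n)
    (l : seq R) : Prop :=
  sorted <=%R l /\ char_poly A = \prod_(a <- l) ('X - a%:P).

Definition complexify (R : realType) (n : nat) (A : 'M[R]_n) : 'M[R[i]]_n :=
  map_mx (real_complex R) A.

Definition mxH (R : realType) (N : nat) : 'M[R]_N.+1 :=
  (block_mx (-1)%:M 0 0 1%:M : 'M[R]_(1 + N)).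

Definition mxX (R : realType) (a : nat -> nat -> R) (N : nat) : 'M[R]_N.+1 :=
  (Num.sqrt N%:R)^-1 *: (mxH R N *m \matrix_(i < N.+1, j < N.+1) a i j).

(* The indices 1..N of the rows and columns are shifted to 0..N-1. *)
Definition mxC (R : realType) (a : nat -> nat -> R) (N : nat) : 'M[R]_N :=
  (Num.sqrt N%:R)^-1 *: \matrix_(i < N, j < N) a i.+1 j.+1.

(* With 0-based indexing, l`_i and zeta`_i stand for lambda_(i+1) and
   zeta_(i+2).  The real eigenvalues are the distinct real numbers that are
   eigenvalues of the complex matrix X. *)
Definition interlacing_real_spectrum (R : realType) (N : nat)
    (X : 'M[R]_N.+1) (l : seq R) : Prop :=
  exists zeta : seq R,
    [/\ size zeta = N.-1, sorted <%R zeta,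
        forall z : R, eigenvalue (complexify X) z%:C = (z \in zeta) &
        forall i, (i < N.-1)%N -> l`_i < zeta`_i < l`_i.+1].

(* Main.v *)
Require Import Defs.
From HB Require Import structures.
From mathcomp Require Import all_boot all_order all_algebra.
From mathcomp Require Import all_classical all_reals all_analysis.
From mathcomp Require Import complex measurable_realfun.
From mathcomp Require Import ring lra zify.

(** The matrix [X_N] has the blocks [- a0] and [- b^T] in its first row, [b] and
    [C = C_N] below, where [C] is symmetric.

    Convergence of [beta_N].  An eigenvector of nonpositive type has a nonzero
    first coordinate; normalized, it is [(1, v)] with [|v| <= 1], and
    [- a0 - b^T v = beta], [C v = beta v - b] ([nonpositive_typeP]).
    Eliminating [v] gives [beta = - a0 + b^T (C - beta)^-1 b].  As [b] is
    independent of [C], the quadratic form is close to the normalized trace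
    [m(beta) = s^2 / N * tr (C - beta)^-1], and [m] satisfies the semicircle
    equation [m = s^2 / (- z - m)]; thus [z = m(z)] forces [z^2 = - s^2 / 2].

    To make this rigorous without the semicircle law, put [z = i eta] with
    [s^2 = 2 eta^2] from the start.  The Schur complement formula for each
    diagonal entry of the resolvent [G] of [C] at [z] ([schur_diag_col]) shows
    that [m(z)] nearly solves a quadratic equation with roots [z] and [- 2 z],
    and [Im m >= 0] keeps it away from the second one
    ([trace_near_fixed_point]).  Hence [(1, - G b)] is an eigenvector of [X_N]
    for [z] up to a defect in its first coordinate, whose mean tends to 0
    ([pole_defect_mean]).  Self-adjointness determines the inner product of this
    vector with the true eigenvector [(1, v)], and their difference lies in a
    subspace where the form is positive, so [v] is close to [- G b] and [beta]
    to [z] ([nonpositive_pair_close], [nonpositive_pair_dist]).  This is the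
    argument for the uniqueness of [beta] in a quantitative form.

    The random input is the concentration of quadratic forms in independent
    variables having only a second moment ([quadratic_form_concentration]): the
    off-diagonal terms are orthogonal, and the squares on the diagonal obey a
    law of large numbers by truncation.  It is applied to a matrix that does not
    involve the variables of the form, which may then be frozen
    ([integral_decouple], [random_quadratic_form]): the resolvent of [C] for the
    border, that of [C] with coordinate [k] decoupled for column [k].

    Interlacing.  The characteristic polynomial of [X_N] is
    [(t + a0) chi(t) + b^T adj(t - C) b] with [chi] that of [C].  At an eigenvalue
    of [C] it reduces to the second term, which has the sign of the derivative of
    [chi] there, unless some eigenvector of [C] is orthogonal to [b]
    ([border_poly_residue]).  This exception is excluded, together with multiple
    eigenvalues, when [b, C b, ..., C^(N-1) b] are independent.  Then there is a
    real root in each of the [N - 1] gaps between eigenvalues of [C], and if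
    [beta] is not real then [beta] and its conjugate complete the list of roots
    ([interlacing_of_coupled]).  The determinant of these vectors is a nonzero
    polynomial in independent variables with continuous laws, hence almost surely
    nonzero ([polynomial_ae_neq0], [krylov_ae_neq0]).  Finally [beta] is nonreal
    with probability tending to 1, since its limit is not real: [s > 0] because
    continuous laws have no atoms.

    Measurability.  Neither [beta_N] nor the spectrum is given as a measurable
    function.  The events in question are described by the existence of a solution
    of finitely many continuous equations in a compact cube, and such an
    existence statement can be tested on rational points
    ([measurable_exists_zero]). *)

Set Implicit Arguments.
Unset Strict Implicit.
Unset Printing Implicit Defensive.

Import Order.TTheory GRing.Theory Num.Theory.
Import numFieldNormedType.Exports.

Local Open Scope classical_set_scope.
Local Open Scope ring_scope.
Local Open Scope complex_scope.

Local Notation normc := ComplexField.Normc.normc.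
Local Notation Re := complex.Re.
Local Notation Im := complex.Im.

(** * Independence and decoupled integrals *)

Section Independence.
Context (d : measure_display) (T : measurableType d) (R : realType)
  (P : probability T R) (I : choiceType) (D : set I) (X : I -> {RV P >-> R}).

Definition cylinders (J : set I) : set (set T) :=
  [set E | exists s : seq I, exists B : I -> set R,
    [/\ uniq s, [set` s] `<=` J, forall i, measurable (B i) &
        E = \bigcap_(i in [set` s]) (X i @^-1` B i)]].

(** The same underlying type as [T], so that a function on [T] can be said to
    depend only on the variables in [J] without changing the function. *)
Definition generated_space (J : set I) := g_sigma_algebraType (cylinders J).

Lemma cylinders_setI J : setI_closed (cylinders J).
Proof.
move=> _ _ [s [B [us sJ mB ->]]] [s' [B' [us' sJ' mB' ->]]].
exists (undup (s ++ s')); exists (fun i =>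
  (if i \in s then B i else setT) `&` (if i \in s' then B' i else setT)).
split; first exact: undup_uniq.
- by move=> i /=; rewrite mem_undup mem_cat => /orP[/sJ|/sJ'].
- by move=> i; apply: measurableI; case: ifP.
- apply/seteqP; split=> w.
  + by move=> [h h'] i /= _; split; case: ifP => // /[dup] + ii => /=;
      [move=> _; exact: h|move=> _; exact: h'].
  + move=> h; split=> i /= ii.
    * by have := h i; rewrite /= mem_undup mem_cat ii => /(_ isT) [].
    * by have := h i; rewrite /= mem_undup mem_cat ii orbT => /(_ isT) [].
Qed.

Lemma cylinders_measurable J : cylinders J `<=` measurable.
Proof.
move=> _ [s [B [us sJ mB ->]]].
rewrite bigcap_seq; apply: big_rec => [|i E _ mE]; first exact: measurableT.
apply: measurableI => //.
exact: measurable_funPTI.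
Qed.

Lemma generated_measurable J (E : set T) :
  measurable (E : set (generated_space J)) -> measurable E.
Proof.
have := @smallest_sub _ (sigma_algebra setT) (cylinders J) (@measurable d T).
apply; [exact: sigma_algebra_measurable|exact (@cylinders_measurable J)].
Qed.

Lemma generated_forget J d' (S : measurableType d') (f : T -> S) :
  measurable_fun [set: generated_space J] (f : generated_space J -> S) ->
  measurable_fun [set: T] f.
Proof. by move=> mf _ B mB; apply: (@generated_measurable J); exact: mf. Qed.

Lemma measurable_coord J i : J i ->
  measurable_fun [set: generated_space J] (X i : generated_space J -> R).
Proof.
move=> Ji _ B mB; rewrite setTI; apply: sub_sigma_algebra.
exists [:: i]; exists (fun=> B); split => //.
- by move=> j /=; rewrite inE => /eqP ->.
- apply/seteqP; split=> w /=; first by move=> ? j; rewrite /= inE => /eqP ->.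
  by move=> /(_ i); rewrite /= inE eqxx; exact.
Qed.

Lemma indep_setC (S G : set T) : measurable S -> measurable G ->
  P (S `&` G) = (P S * P G)%E -> P (~` S `&` G) = (P (~` S) * P G)%E.
Proof.
move=> mS mG hS.
have -> : ~` S `&` G = G `\` S by rewrite setIC.
have -> : P (G `\` S) = (P G - P (S `&` G))%E.
  rewrite measureD// 1?setIC//.
  by rewrite (le_lt_trans (probability_le1 _ _)) ?ltry.
by rewrite hS probability_setC// muleBl ?mul1e// fin_num_measure.
Qed.

Lemma indep_bigcup (S : (set T)^nat) (G : set T) :
  (forall n, measurable (S n)) -> measurable G -> trivIset setT S ->
  (forall n, P (S n `&` G) = (P (S n) * P G)%E) ->
  P (\bigcup_n S n `&` G) = (P (\bigcup_n S n) * P G)%E.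
Proof.
move=> mS mG tS hS.
rewrite setI_bigcupl measure_bigcup//; last 2 first.
- by move=> n _; exact: measurableI.
- exact/trivIset_setIr.
have GE : P G = (fine (P G))%:E by rewrite fineK// fin_num_measure.
rewrite measure_bigcup//= muleC GE -nneseriesZl//.
by apply: eq_eseriesr => n _; rewrite hS muleC -GE.
Qed.

Hypothesis X_indep : mutually_independent D X.

(** Cylinders depend on finitely many variables, so the product rule of the
    hypothesis applies to the concatenation of the two index lists. *)
Lemma indep_cylinders J J' E F : J `<=` D -> J' `<=` D -> J `&` J' = set0 ->
  cylinders J E -> cylinders J' F -> P (E `&` F) = (P E * P F)%E.
Proof.
move=> JD JD' JJ' [s [B [us sJ mB ->]]] [s' [B' [us' sJ' mB' ->]]].
have dis i : i \in s -> i \in s' -> False.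
  by move=> /sJ ? /sJ' ?; have : (J `&` J') i by []; rewrite JJ'.
have uss : uniq (s ++ s').
  rewrite cat_uniq us us' andbT /=; apply/hasPn => i si'.
  by apply/negP => si; exact: (dis i).
pose B2 i := if i \in s then B i else B' i.
have mB2 i : measurable (B2 i) by rewrite /B2; case: ifP.
have -> : \bigcap_(i in [set` s]) (X i @^-1` B i) `&`
    \bigcap_(i in [set` s']) (X i @^-1` B' i) =
    \bigcap_(i in [set` s ++ s']) (X i @^-1` B2 i).
  apply/seteqP; split=> w.
  - move=> [h h'] i /=; rewrite mem_cat /B2; case: ifPn => [ii _|ni /= ii].
      exact: h.
    exact: h'.
  - move=> h; split=> i /= ii.
      have iss : i \in s ++ s' by rewrite mem_cat ii.
    by move: (h i iss); rewrite /B2 ii.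
    have iss : i \in s ++ s' by rewrite mem_cat ii orbT.
    move: (h i iss); rewrite /B2; case: ifPn => // si.
    by have := dis _ si ii.
have sD i : i \in s -> D i by move=> /sJ /JD.
have sD' i : i \in s' -> D i by move=> /sJ' /JD'.
rewrite (X_indep us sD mB) (X_indep us' sD' mB') (X_indep uss _ mB2); last first.
  by move=> i /=; rewrite mem_cat => /orP[/sD|/sD'].
rewrite big_cat /=; congr (_ * _)%E; rewrite [LHS]big_seq [RHS]big_seq;
  apply: eq_bigr => i ii; rewrite /B2 ?ii//; case: ifPn => // si.
by have := dis _ si ii.
Qed.

Lemma indep_generated J J' (E F : set T) :
  J `<=` D -> J' `<=` D -> J `&` J' = set0 ->
  measurable (E : set (generated_space J)) ->
  measurable (F : set (generated_space J')) ->
  P (E `&` F) = (P E * P F)%E.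
Proof.
move=> JD JD' JJ' mE mF.
(* One side at a time: the sets independent of a given one form a Dynkin class *)
have ext K (G : set T) : measurable G ->
    (forall E', cylinders K E' -> P (E' `&` G) = (P E' * P G)%E) ->
    forall E', measurable (E' : set (generated_space K)) ->
    P (E' `&` G) = (P E' * P G)%E.
  move=> mG h; apply: dynkin_induction => //.
  - exact: cylinders_setI.
  - by rewrite setTI probability_setT mul1e.
  - by move=> S /generated_measurable mS; exact: indep_setC.
  - move=> S mS tS hS.
    exact: (indep_bigcup (fun n => generated_measurable (mS n)) mG tS hS).
have mE' := generated_measurable mE.
have mF' := generated_measurable mF.
apply: (ext J) mE => // {E mE'} E cE.
rewrite setIC muleC; apply: (ext J') => //.
  by apply: cylinders_measurable cE.
by move=> E' cE'; rewrite setIC muleC; exact: (@indep_cylinders J J').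
Qed.

Lemma measurable_forget J : measurable_fun [set: T] (idfun : T -> generated_space J).
Proof. by move=> _ B mB; rewrite setTI; exact: (@generated_measurable J). Qed.

HB.instance Definition _ J := isMeasurableFun.Build _ _ T (generated_space J)
  (idfun : T -> generated_space J) (@measurable_forget J).

Definition restricted_law J : probability (generated_space J) R :=
  distribution P (idfun : {mfun T >-> generated_space J}).

Lemma ge0_integral_restricted J (f : T -> \bar R) :
  measurable_fun [set: generated_space J] (f : generated_space J -> _) -> (forall w, 0 <= f w)%E ->
  (\int[restricted_law J]_w f w = \int[P]_w f w)%E.
Proof.
move=> mf f0.
exact: (ge0_integral_distribution (idfun : {mfun T >-> generated_space J})).
Qed.

(** The law of the diagonal map into the product of the two generated
    sigma-algebras is a product measure, so the integral over the diagonal is an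
    iterated integral: independent randomness may be frozen. *)
Lemma integral_decouple J J' (f : T -> T -> \bar R) :
  J `<=` D -> J' `<=` D -> J `&` J' = set0 ->
  measurable_fun [set: generated_space J * generated_space J']
    (fun z => f z.1 z.2) -> (forall v w, 0 <= f v w)%E ->
  (\int[P]_w f w w = \int[P]_v \int[P]_w f v w)%E.
Proof.
move=> JD JD' JJ' mf f0.
pose diag (w : T) : generated_space J * generated_space J' := (w, w).
have mdiag : measurable_fun [set: T] diag.
  exact: measurable_fun_pair (@measurable_forget J) (@measurable_forget J').
pose diagm : {mfun T >-> _} := HB.pack diag (isMeasurableFun.Build _ _ _ _ _ mdiag).
pose g (z : generated_space J * generated_space J') := f z.1 z.2.
have -> : (\int[P]_w f w w = \int[distribution P diagm]_z g z)%E.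
  by rewrite ge0_integral_distribution//= => z; exact: f0.
have prodE (A : set (generated_space J * generated_space J')) : measurable A ->
    (restricted_law J \x restricted_law J')%E A = distribution P diagm A.
  apply: product_measure_unique => A1 A2 mA1 mA2.
  exact: (indep_generated JD JD' JJ' mA1 mA2).
rewrite -(@eq_measure_integral _ _ _ setT _ _ g (fun A mA _ => prodE A mA)).
rewrite fubini_tonelli1//; last by move=> z; exact: f0.
rewrite -(@ge0_integral_restricted J); last 2 first.
- have := measurable_fun_fubini_tonelli_F (m2 := restricted_law J')
    g mf (fun z => f0 _ _).
  rewrite /fubini_F; apply: eq_measurable_fun => u _ /=.
  apply: ge0_integral_restricted => [|w]; last exact: f0.
  exact: measurableT_comp mf (measurable_pair1 u).
- by move=> v; apply: integral_ge0 => w _; exact: f0.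
apply: eq_integral => v _; apply: ge0_integral_restricted => [|w]; last exact: f0.
exact: measurableT_comp mf (measurable_pair1 v).
Qed.

Lemma indep_integralM0 J J' (W Y : T -> R) :
  J `<=` D -> J' `<=` D -> J `&` J' = set0 ->
  measurable_fun [set: generated_space J] (W : generated_space J -> _) ->
  measurable_fun [set: generated_space J'] (Y : generated_space J' -> _) ->
  P.-integrable setT (EFin \o W) -> P.-integrable setT (EFin \o Y) ->
  (\int[P]_w (Y w)%:E = 0)%E ->
  P.-integrable setT (fun w => (W w * Y w)%:E) /\
  (\int[P]_w (W w * Y w)%:E = 0)%E.
Proof.
move=> JD JD' JJ' mW mY iW iY Y0.
have mWY : measurable_fun [set: generated_space J * generated_space J']
    (fun z => (W z.1 * Y z.2)%:E).
  apply/measurable_EFinP; apply: measurable_funM.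
    exact: measurableT_comp mW measurable_fst.
  exact: measurableT_comp mY measurable_snd.
have mWYT : measurable_fun [set: T] (fun w => (W w * Y w)%:E).
  apply/measurable_EFinP; apply: measurable_funM.
    exact: (generated_forget mW).
  exact: (generated_forget mY).
have iWY : P.-integrable setT (fun w => (W w * Y w)%:E).
  apply/integrableP; split=> //.
  rewrite (@integral_decouple J J' (fun v w => `|(W v * Y w)%:E|%E))//; last first.
    exact: measurableT_comp.
  have -> : (\int[P]_v \int[P]_w `|(W v * Y w)%:E|)%E =
      (\int[P]_v (`|W v|%:E * \int[P]_w `|(Y w)%:E|))%E.
    apply: eq_integral => v _; rewrite -ge0_integralZl//; last first.
      by apply: measurableT_comp => //; exact: measurable_int iY.
    by apply: eq_integral => w _; rewrite EFinM abseM.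
  have /integrableP[mY' Yoo] := iY.
  have Yfin : (\int[P]_w `|(Y w)%:E|)%E \is a fin_num.
    by rewrite ge0_fin_numE// integral_ge0.
  rewrite -(fineK Yfin) ge0_integralZr//; last 2 first.
  + apply/measurable_EFinP; apply: measurableT_comp => //.
    exact: (generated_forget mW).
  + by rewrite lee_fin fine_ge0// integral_ge0.
  have /integrableP[_ Woo] := iW.
  by rewrite lte_mul_pinfty ?ge0_fin_numE ?integral_ge0// ltry.
split=> //.
(* For each fixed value of [W] the positive and negative parts balance *)
have bal v : (\int[P]_w ((fun w => (W v * Y w)%:E)^\+ w) =
              \int[P]_w ((fun w => (W v * Y w)%:E)^\- w))%E.
  have iv : P.-integrable setT (fun w => (W v * Y w)%:E).
    by have := integrableZl measurableT (W v) iY.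
  have iv0 : (\int[P]_w (W v * Y w)%:E = 0)%E.
    under eq_integral do rewrite EFinM.
    by rewrite integralZl// Y0 mule0.
  have fp := integrable_fin_num measurableT (integrable_funepos measurableT iv).
  have fn := integrable_fin_num measurableT (integrable_funeneg measurableT iv).
  move: iv0; rewrite integralE => /eqP.
  by rewrite sube_eq ?add0e ?fin_num_adde_defl// => /eqP.
rewrite integralE.
have -> : (\int[P]_w ((fun w => (W w * Y w)%:E)^\+ w) =
           \int[P]_w ((fun w => (W w * Y w)%:E)^\- w))%E.
  pose fp v w := maxe (W v * Y w)%:E 0%E.
  pose fn v w := maxe (- (W v * Y w)%:E)%E 0%E.
  have mfp : measurable_fun [set: generated_space J * generated_space J']
      (fun z => fp z.1 z.2).
    by move: (measurable_funepos mWY); apply: eq_measurable_fun => z _;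
      rewrite funeposE.
  have mfn : measurable_fun [set: generated_space J * generated_space J']
      (fun z => fn z.1 z.2).
    by move: (measurable_funeneg mWY); apply: eq_measurable_fun => z _;
      rewrite funenegE.
  transitivity (\int[P]_w fp w w)%E.
    by apply: eq_integral => w _; rewrite funeposE.
  rewrite (integral_decouple JD JD' JJ' mfp); last first.
    by move=> v w; rewrite le_max lexx orbT.
  transitivity (\int[P]_w fn w w)%E; last first.
    by apply: eq_integral => w _; rewrite funenegE.
  rewrite (integral_decouple JD JD' JJ' mfn); last first.
    by move=> v w; rewrite le_max lexx orbT.
  apply: eq_integral => v _; have := bal v.
  under eq_integral do rewrite funeposE.
  by under [in X in _ = X -> _]eq_integral do rewrite funenegE.
rewrite subee//; apply: integrable_fin_num => //; exact: integrable_funeneg.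
Qed.
End Independence.

(** * Second moments of sums and quadratic forms *)

Section SecondMoment.
Context (d : measure_display) (T : measurableType d) (R : realType)
  (P : probability T R).

Lemma sqr_integrable (f : T -> R) (c : R) : measurable_fun setT f ->
  (\int[P]_w (f w ^+ 2)%:E <= c%:E)%E ->
  P.-integrable setT (fun w => (f w ^+ 2)%:E).
Proof.
move=> mf fc; apply/integrableP; split.
  by apply/measurable_EFinP; exact: measurable_funX.
apply: le_lt_trans (ltry c); apply: le_trans fc.
rewrite le_eqVlt; apply/orP; left; apply/eqP.
by apply: eq_integral => w _; rewrite gee0_abs// lee_fin sqr_ge0.
Qed.

(** By [2 |f g| <= f^2 + g^2]. *)
Lemma mul_integrable (f g : T -> R) :
  measurable_fun setT f -> measurable_fun setT g ->
  P.-integrable setT (fun w => (f w ^+ 2)%:E) ->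
  P.-integrable setT (fun w => (g w ^+ 2)%:E) ->
  P.-integrable setT (fun w => (f w * g w)%:E).
Proof.
move=> mf mg ifl ig.
apply: le_integrable (integrableD measurableT ifl ig) => //.
  by apply/measurable_EFinP; exact: measurable_funM.
move=> w _ /=; rewrite lee_fin [leRHS]ger0_norm ?addr_ge0 ?sqr_ge0//.
have h1 := sqr_ge0 (f w + g w); have h2 := sqr_ge0 (f w - g w).
rewrite ler_norml; apply/andP; split; nra.
Qed.

Lemma integrable_of_sqr (f : T -> R) : measurable_fun setT f ->
  P.-integrable setT (fun w => (f w ^+ 2)%:E) ->
  P.-integrable setT (EFin \o f).
Proof.
move=> mf ifl.
have i1 : P.-integrable setT (fun w : T => ((1 : R) ^+ 2)%:E).
  by rewrite expr1n; exact: finite_measure_integrable_cst.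
have := mul_integrable mf (measurable_cst _) ifl i1.
by apply: eq_integrable => // w _; rewrite mulr1.
Qed.

(** A Cauchy-Schwarz inequality obtained by integrating
    [|f| <= f^2 / (2 t) + t / 2] and letting [t] tend to [c]. *)
Lemma integral_norm_le (f : T -> R) (c : R) : measurable_fun setT f -> 0 <= c ->
  (\int[P]_w (f w ^+ 2)%:E <= (c ^+ 2)%:E)%E ->
  (\int[P]_w `|f w|%:E <= c%:E)%E.
Proof.
move=> mf c0 fc; apply/lee_addgt0Pr => e e0; rewrite -EFinD.
set t := c + e; have t0 : 0 < t by rewrite /t; lra.
have mf2 : measurable_fun setT (fun w => (f w ^+ 2)%:E).
  by apply/measurable_EFinP; exact: measurable_funX.
(* [t] exceeds [c] slightly so that the division is legitimate when [c = 0]. *)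
have le1 w : `|f w| <= (2 * t)^-1 * f w ^+ 2 + t / 2.
  rewrite -(real_normK (num_real (f w))); set u := `|f w|.
  rewrite -subr_ge0.
  have -> : (2 * t)^-1 * u ^+ 2 + t / 2 - u = (2 * t)^-1 * (u - t) ^+ 2.
    by field; lra.
  by rewrite mulr_ge0 ?sqr_ge0// invr_ge0; lra.
have t2 : 0 <= (2 * t)^-1 by rewrite invr_ge0; lra.
apply: (@le_trans _ _ (\int[P]_w (((2 * t)^-1)%:E * (f w ^+ 2)%:E + (t / 2)%:E))%E).
  apply: ge0_le_integral => //.
  - by apply/measurable_EFinP; exact: measurableT_comp.
  - apply: emeasurable_funD => //.
    by apply: measurable_funeM.
  - by move=> w _; rewrite -EFinM -EFinD lee_fin.
rewrite ge0_integralD//; last 3 first.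
- by move=> w _; rewrite -EFinM lee_fin mulr_ge0 ?sqr_ge0.
- by apply: measurable_funeM.
- by move=> w _; rewrite lee_fin; lra.
rewrite ge0_integralZl//; last by move=> w _; rewrite lee_fin sqr_ge0.
rewrite integral_cst//= probability_setT mule1.
apply: (@le_trans _ _ ((2 * t)^-1 * c ^+ 2 + t / 2)%:E).
  by rewrite EFinD leeD2r// EFinM lee_wpmul2l.
rewrite lee_fin -subr_ge0.
have -> : t - ((2 * t)^-1 * c ^+ 2 + t / 2) = (2 * t)^-1 * (t ^+ 2 - c ^+ 2).
  by field; lra.
by rewrite mulr_ge0// /t; nra.
Qed.

Lemma integral_prob_cst (c : R) : (\int[P]_w c%:E = c%:E)%E.
Proof. by rewrite integral_cst//= probability_setT mule1. Qed.
End SecondMoment.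

Section OrthogonalSum.
Context (d : measure_display) (T : measurableType d) (R : realType)
  (P : probability T R) (I : choiceType) (D : set I) (X : I -> {RV P >-> R}).
Hypothesis X_indep : mutually_independent D X.
Context (n : nat) (p : nat -> I).
Hypothesis pD : forall j, (j < n)%N -> D (p j).
Hypothesis p_inj : forall i j, (i < n)%N -> (j < n)%N -> p i = p j -> i = j.

Notation spc J := (generated_space X J).

Definition past (j : nat) : set I := [set p i | i in [set i | (i < j)%N]].

Lemma generated_mono J J' (f : T -> R) : J `<=` J' ->
  measurable_fun [set: spc J] (f : spc J -> R) ->
  measurable_fun [set: spc J'] (f : spc J' -> R).
Proof.
move=> JJ' mf _ B mB; have := mf measurableT B mB.
apply: (@sub_sigma_algebra2 _ setT) => E [s [C [us sJ mC ->]]].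
by exists s, C; split => //; exact: subset_trans sJ JJ'.
Qed.

Lemma past_disjoint j : (j < n)%N -> past j `&` [set p j] = set0.
Proof.
move=> jn; rewrite -subset0 => _ [[i /= ij <-]] /= /p_inj e.
by have := e (ltn_trans ij jn) jn; move: ij => /[swap] ->; rewrite ltnn.
Qed.

Lemma past_domain j : (j <= n)%N -> past j `<=` D.
Proof. by move=> jn _ [i /= ij <-]; exact/pD/(leq_trans ij). Qed.

Lemma pt_domain j : (j < n)%N -> [set p j] `<=` D.
Proof. by move=> jn _ ->; exact: pD. Qed.

(** Each new term is uncorrelated with the sum of the previous ones, because
    its factor [Y j] is centred and independent of everything before.  The
    induction also carries the measurability of the sum with respect to the
    past, without which independence cannot be used. *)
Lemma orthogonal_sum (Y U : nat -> T -> R) (v : R) (u : nat -> R) :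
  0 <= v -> (forall j, 0 <= u j) ->
  (forall j, (j < n)%N -> measurable_fun [set: spc [set p j]] (Y j : spc [set p j] -> R)) ->
  (forall j, (j < n)%N -> measurable_fun [set: spc (past j)] (U j : spc (past j) -> R)) ->
  (forall j, (j < n)%N -> \int[P]_w (Y j w)%:E = 0)%E ->
  (forall j, (j < n)%N -> \int[P]_w (Y j w ^+ 2)%:E <= v%:E)%E ->
  (forall j, (j < n)%N -> \int[P]_w (U j w ^+ 2)%:E <= (u j)%:E)%E ->
  (\int[P]_w ((\sum_(j < n) U j w * Y j w) ^+ 2)%:E <= (v * \sum_(j < n) u j)%:E)%E.
Proof.
move=> v0 u0 mY mU Y0 Yv Uu.
suff H m : (m <= n)%N ->
    measurable_fun [set: spc (past m)]
      ((fun w => \sum_(j < m) U j w * Y j w) : spc (past m) -> R) /\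
    (\int[P]_w ((\sum_(j < m) U j w * Y j w) ^+ 2)%:E <= (v * \sum_(j < m) u j)%:E)%E.
  by have [] := H n (leqnn n).
elim: m => [_|m IH mn].
  split; first by apply: eq_measurable_fun (measurable_cst (0 : R)) => w _; rewrite big_ord0.
  rewrite big_ord0 mulr0 [leLHS](_ : _ = 0%E)//.
  by apply: integral0_eq => w _; rewrite big_ord0 expr0n.
have [mS Sle] := IH (ltnW mn).
pose S w := \sum_(j < m) U j w * Y j w.
have sub1 : past m `<=` past m.+1 by move=> _ [i /= im <-]; exists i => //=; exact: ltnW.
have sub2 : [set p m] `<=` past m.+1 by move=> _ ->; exists m => /=.
split.
  have := @measurable_funD _ _ R setT _ _ (generated_mono sub1 mS)
    (measurable_funM (generated_mono sub1 (mU _ mn)) (generated_mono sub2 (mY _ mn))).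
  by apply: eq_measurable_fun => w _ /=; rewrite big_ord_recr.
have mS' : measurable_fun [set: T] S := generated_forget mS.
have mU' : measurable_fun [set: T] (U m) := generated_forget (mU _ mn).
have mY' : measurable_fun [set: T] (Y m) := generated_forget (mY _ mn).
have iS := sqr_integrable mS' Sle.
have iU := sqr_integrable mU' (Uu _ mn).
have iY := sqr_integrable mY' (Yv _ mn).
have mSU : measurable_fun [set: spc (past m)] ((fun w => S w * U m w) : spc (past m) -> R).
  exact: measurable_funM mS (mU _ mn).
have [iSUY SUY0] := indep_integralM0 X_indep (past_domain (ltnW mn)) (pt_domain mn)
  (past_disjoint mn) mSU (mY _ mn) (mul_integrable mS' mU' iS iU)
  (integrable_of_sqr mY' iY) (Y0 _ mn).
have UYle : (\int[P]_w ((U m w * Y m w) ^+ 2)%:E <= (v * u m)%:E)%E.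
  have mf : measurable_fun [set: spc (past m) * spc [set p m]]
      (fun z => ((U m z.1 * Y m z.2) ^+ 2)%:E).
    apply/measurable_EFinP/measurable_funX/measurable_funM.
      exact: measurableT_comp (mU _ mn) measurable_fst.
    exact: measurableT_comp (mY _ mn) measurable_snd.
  have -> : (\int[P]_w ((U m w * Y m w) ^+ 2)%:E =
      \int[P]_v \int[P]_w ((U m v * Y m w) ^+ 2)%:E)%E.
    apply: (integral_decouple (f := fun v w => ((U m v * Y m w) ^+ 2)%:E)
      X_indep (past_domain (ltnW mn)) (pt_domain mn) (past_disjoint mn) mf).
    by move=> ? ?; rewrite lee_fin sqr_ge0.
  apply: (@le_trans _ _ (\int[P]_w (v%:E * (U m w ^+ 2)%:E))%E).
    apply: ge0_le_integral => //.
    - by move=> w _; apply: integral_ge0 => ? _; rewrite lee_fin sqr_ge0.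
    - have := measurable_fun_fubini_tonelli_F (m2 := P)
        (fun z : T * T => ((U m z.1 * Y m z.2) ^+ 2)%:E).
      apply=> [|z]; last by rewrite lee_fin sqr_ge0.
      apply/measurable_EFinP/measurable_funX/measurable_funM.
        exact: measurableT_comp mU' measurable_fst.
      exact: measurableT_comp mY' measurable_snd.
    - by apply: measurable_funeM; apply/measurable_EFinP; exact: measurable_funX.
    - move=> w _; under eq_integral do rewrite exprMn EFinM.
      rewrite ge0_integralZl// ?lee_fin ?sqr_ge0//; last 2 first.
      + by apply/measurable_EFinP; exact: measurable_funX.
      + by move=> ? _; rewrite lee_fin sqr_ge0.
      by rewrite muleC; apply: lee_wpmul2r; rewrite ?lee_fin ?sqr_ge0//; exact: Yv.
  rewrite ge0_integralZl//; last 2 first.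
  - by apply/measurable_EFinP; exact: measurable_funX.
  - by move=> ? _; rewrite lee_fin sqr_ge0.
  by rewrite EFinM; apply: lee_wpmul2l; rewrite ?lee_fin//; exact: Uu.
have iUY := sqr_integrable (measurable_funM mU' mY') UYle.
have -> : (\int[P]_w ((\sum_(j < m.+1) U j w * Y j w) ^+ 2)%:E =
  \int[P]_w (S w ^+ 2)%:E + (\int[P]_w (2%:E * (S w * U m w * Y m w)%:E) +
  \int[P]_w ((U m w * Y m w) ^+ 2)%:E))%E.
  rewrite -integralD//; last exact: integrableZl.
  rewrite -integralD//; last by apply: integrableD => //; exact: integrableZl.
  apply: eq_integral => w _; rewrite -EFinM -!EFinD big_ord_recr /= -/(S w).
  by congr (_%:E); ring.
rewrite integralZl// SUY0 mule0 add0e big_ord_recr/= mulrDr EFinD.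
exact: leeD.
Qed.
End OrthogonalSum.

(** The off-diagonal part is arranged by the larger index, which exhibits it as
    a sum of the kind treated in [orthogonal_sum]. *)
Lemma sum_sym_quadratic (R : comNzRingType) (a : nat -> nat -> R) (y : nat -> R) n :
  (forall i j, (i < n)%N -> (j < n)%N -> a i j = a j i) ->
  \sum_(i < n) \sum_(j < n) a i j * y i * y j =
  2 * (\sum_(j < n) (\sum_(i < j) a i j * y i) * y j) + \sum_(j < n) a j j * y j ^+ 2.
Proof.
elim: n => [|n IH] asym; first by rewrite !big_ord0 mulr0 addr0.
rewrite big_ord_recr /=.
under eq_bigr do rewrite big_ord_recr /=.
rewrite big_split /= IH; last by move=> i j ? ?; apply: asym; exact: ltnW.
rewrite [in RHS]big_ord_recr [in X in _ = _ + X]big_ord_recr [in LHS]big_ord_recr /=.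
have -> : \sum_(i < n) a n i * y n * y i = \sum_(i < n) a i n * y i * y n.
  by apply: eq_bigr => i _; rewrite (asym n i)//; [ring|exact: (ltnW (ltn_ord i))].
rewrite -mulr_suml; ring.
Qed.

Section QuadraticForm.
Context (d : measure_display) (T : measurableType d) (R : realType)
  (P : probability T R) (I : choiceType) (D : set I) (X : I -> {RV P >-> R}).
Hypothesis X_indep : mutually_independent D X.
Context (n : nat) (p : nat -> I).
Hypothesis pD : forall j, (j < n)%N -> D (p j).
Hypothesis p_inj : forall i j, (i < n)%N -> (j < n)%N -> p i = p j -> i = j.
Context (s K mu : R).
Hypothesis K0 : 0 <= K.
Hypothesis mean0 : forall j, (j < n)%N -> (\int[P]_w (X (p j) w)%:E = 0)%E.
Hypothesis var : forall j, (j < n)%N -> (\int[P]_w (X (p j) w ^+ 2)%:E = (s ^+ 2)%:E)%E.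
Hypothesis trunc : forall j, (j < n)%N ->
  (\int[P]_w (Num.min (X (p j) w ^+ 2) K)%:E = mu%:E)%E.

Notation spc J := (generated_space X J).

(** Only second moments are available, so the squares on the diagonal obey a
    weak law of large numbers obtained by truncating them at level [K], while
    the off-diagonal part is a sum of orthogonal terms. *)
Lemma quadratic_form_concentration (a : nat -> nat -> R) (B : R) :
  0 <= B -> (forall i j, (i < n)%N -> (j < n)%N -> a i j = a j i) ->
  (forall i, (i < n)%N -> \sum_(j < n) a i j ^+ 2 <= B ^+ 2) ->
  (\int[P]_w `|\sum_(i < n) \sum_(j < n) a i j * X (p i) w * X (p j) w
     - s ^+ 2 * \sum_(i < n) a i i|%:E
   <= (2 * (s ^+ 2 * B * Num.sqrt n%:R) + K * B * Num.sqrt n%:R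
       + 2 * (n%:R * B * (s ^+ 2 - mu)))%:E)%E.
Proof.
move=> B0 asym aB.
have n0 : 0 <= n%:R :> R by rewrite ler0n.
pose y j w := X (p j) w.
have mX i : measurable_fun [set: T] (y i) by exact: (measurable_funP (X (p i))).
have my j : measurable_fun [set: spc [set p j]] (y j : spc [set p j] -> R).
  by have := @measurable_coord _ _ _ P _ X [set p j] (p j) erefl.
have aB1 i j : (i < n)%N -> (j < n)%N -> a i j ^+ 2 <= B ^+ 2.
  move=> ilt jlt; apply: le_trans (aB i ilt).
  rewrite (bigD1 (Ordinal jlt))//= lerDl; apply: sumr_ge0 => ? _.
  exact: sqr_ge0.
have aBd j : (j < n)%N -> `|a j j| <= B.
  by move=> jn; rewrite -ler_sqr ?nnegrE// real_normK ?num_real// aB1.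
pose U j w := \sum_(i < j) a i j * y i w.
pose V w := \sum_(j < n) U j w * y j w.
have mU j : (j < n)%N -> measurable_fun [set: spc (past p j)] (U j : spc (past p j) -> R).
  move=> jn; rewrite /U; apply: measurable_sum => i.
  apply: measurable_funM; first exact: measurable_cst.
  by apply: (generated_mono (J := [set p i])) => // _ ->; exists i => /=.
have mUT (j : 'I_n) : measurable_fun [set: T] (U j) := generated_forget (mU _ (ltn_ord j)).
have mV : measurable_fun setT V.
  by apply: measurable_sum => j; apply: measurable_funM => //; exact: mUT.
have VL1 : (\int[P]_w `|V w|%:E <= (s ^+ 2 * B * Num.sqrt n%:R)%:E)%E.
  apply: integral_norm_le.
  - exact: mV.
  - apply: mulr_ge0; last exact: sqrtr_ge0.
    by apply: mulr_ge0 => //; exact: sqr_ge0.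
  apply: le_trans (@orthogonal_sum _ _ _ _ _ _ _ X_indep n p pD p_inj y U (s ^+ 2)
    (fun j => s ^+ 2 * \sum_(i < j) a i j ^+ 2) _ _ _ _ _ _ _) _ => //.
  - exact: sqr_ge0.
  - by move=> j; rewrite mulr_ge0 ?sqr_ge0// sumr_ge0// => ? _; exact: sqr_ge0.
  - by move=> j jn; rewrite var.
  - move=> j jn.
    apply: (@orthogonal_sum _ _ _ _ _ _ _ X_indep j p _ _ y (fun i => cst (a i j))
      (s ^+ 2) (fun i => a i j ^+ 2)) => //.
    + by move=> i ij; exact/pD/(ltn_trans ij).
    + by move=> i k ij kj; apply: p_inj; [exact: ltn_trans ij jn|exact: ltn_trans kj jn].
    + exact: sqr_ge0.
    + by move=> i; exact: sqr_ge0.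
    + by move=> i ij; exact/mean0/(ltn_trans ij).
    + by move=> i ij; rewrite var// (ltn_trans ij).
    + by move=> i ij; rewrite (integral_prob_cst P (a i j ^+ 2)).
  have -> : (s ^+ 2 * B * Num.sqrt n%:R) ^+ 2 = s ^+ 2 * (s ^+ 2 * (B ^+ 2 * n%:R)).
    by rewrite exprMn sqr_sqrtr//; move: n%:R => m; ring.
  rewrite lee_fin -mulr_sumr ler_wpM2l ?sqr_ge0// ler_wpM2l ?sqr_ge0//.
  apply: (@le_trans _ _ (\sum_(j < n) B ^+ 2)); last first.
    by rewrite sumr_const card_ord mulr_natr.
  apply: ler_sum => j _; apply: le_trans (aB j (ltn_ord j)).
  under eq_bigr => i _ do rewrite asym ?(ltn_trans (ltn_ord i))//.
  rewrite (big_ord_widen_cond n xpredT (fun i => a j i ^+ 2)); last exact: ltnW.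
  by rewrite big_mkcond ler_sum// => i _; case: ifP => // _; exact: sqr_ge0.
pose phi j w := Num.min (y j w ^+ 2) K.
have mphi j : measurable_fun [set: T] (phi j).
  by apply: measurable_minr => //; exact: measurable_funX.
have phi_bd j w : 0 <= phi j w <= K by rewrite /phi ge_min lexx orbT le_min sqr_ge0 K0.
have int_le c (f g : T -> R) : (forall w, 0 <= f w) -> measurable_fun setT f ->
    measurable_fun setT g -> (forall w, f w <= g w) ->
    (\int[P]_w (g w)%:E = c%:E)%E -> (\int[P]_w (f w)%:E <= c%:E)%E.
  move=> f0 mf mg fg <-; apply: ge0_le_integral => //; try exact/measurable_EFinP.
  - by move=> w _; rewrite lee_fin.
  - by move=> w _; rewrite lee_fin.
have mu_bd j : (j < n)%N -> 0 <= mu <= K.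
  move=> jn; rewrite -2!lee_fin -(trunc jn); apply/andP; split.
    by apply: integral_ge0 => w _; rewrite lee_fin; case/andP: (phi_bd j w).
  apply: (@int_le K (phi j) (cst K)) => //.
  - by move=> w; case/andP: (phi_bd j w).
  - by move=> w; case/andP: (phi_bd j w).
  - by rewrite (integral_prob_cst P K).
have iphi j : P.-integrable setT (EFin \o phi j).
  apply: (@le_integrable _ _ _ P _ _ _ (cst K%:E)) => //.
  - exact/measurable_EFinP.
  - move=> w _ /=; rewrite lee_fin; have /andP[? ?] := phi_bd j w.
    by rewrite !ger0_norm.
  - exact: finite_measure_integrable_cst.
pose W w := \sum_(j < n) cst (a j j) w * (phi j w - mu).
have WL1 : (\int[P]_w `|W w|%:E <= (K * B * Num.sqrt n%:R)%:E)%E.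
  apply: integral_norm_le.
  - apply: measurable_sum => j; apply: measurable_funM => //.
    exact: measurable_funB.
  - by apply: mulr_ge0; [exact: mulr_ge0|exact: sqrtr_ge0].
  apply: le_trans (@orthogonal_sum _ _ _ _ _ _ _ X_indep n p pD p_inj
    (fun j w => phi j w - mu) (fun j => cst (a j j)) (K ^+ 2)
    (fun j => a j j ^+ 2) _ _ _ _ _ _ _) _ => //.
  - exact: sqr_ge0.
  - by move=> j; exact: sqr_ge0.
  - move=> j jn; apply: measurable_funB => //; apply: measurable_minr => //.
    exact: measurable_funX.
  - move=> j jn; under eq_integral do rewrite EFinB.
    rewrite integralB//=; [|exact: iphi|exact: finite_measure_integrable_cst].
    by rewrite trunc// integral_prob_cst subee.
  - move=> j jn; apply: (@int_le _ _ (cst (K ^+ 2))) => //.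
    + by move=> w; exact: sqr_ge0.
    + by apply: measurable_funX; exact: measurable_funB.
    + move=> w /=; have /andP[? ?] := phi_bd j w; have /andP[? ?] := mu_bd j jn.
      rewrite -subr_ge0 subr_sqr mulr_ge0//; lra.
    + by rewrite (integral_prob_cst P (K ^+ 2)).
  - by move=> j jn; rewrite (integral_prob_cst P (a j j ^+ 2)).
  have -> : (K * B * Num.sqrt n%:R) ^+ 2 = K ^+ 2 * (B ^+ 2 * n%:R).
    by rewrite exprMn sqr_sqrtr//; move: n%:R => m; ring.
  rewrite lee_fin ler_wpM2l ?sqr_ge0//.
  apply: (@le_trans _ _ (\sum_(j < n) B ^+ 2)); last first.
    by rewrite sumr_const card_ord mulr_natr.
  by apply: ler_sum => j _; exact: aB1.
pose Z w := \sum_(j < n) (y j w ^+ 2 - phi j w).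
have mZj j : measurable_fun setT (fun w => y j w ^+ 2 - phi j w).
  by apply: measurable_funB => //; exact: measurable_funX.
have Zj0 j w : 0 <= y j w ^+ 2 - phi j w by rewrite subr_ge0 ge_min lexx.
have ZL1 : (\int[P]_w (Z w)%:E = (n%:R * (s ^+ 2 - mu))%:E)%E.
  rewrite (_ : (\int[P]_w (Z w)%:E = \int[P]_w (\sum_(j < n) (y j w ^+ 2 - phi j w)%:E))%E); last first.
    by apply: eq_integral => w _; rewrite -sumEFin.
  rewrite ge0_integral_sum//; last 2 first.
  - by move=> j; exact/measurable_EFinP.
  - by move=> j w _; rewrite lee_fin.
  have -> : (\sum_(j < n) \int[P]_w (y j w ^+ 2 - phi j w)%:E = \sum_(j < n) (s ^+ 2 - mu)%:E)%E.
    apply: eq_bigr => j _; under eq_integral do rewrite EFinB.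
    rewrite integralB//=; [by rewrite var// trunc// EFinB| |exact: iphi].
    by apply: (@sqr_integrable _ _ _ _ _ (s ^+ 2)) => //; rewrite var.
  by rewrite sumEFin sumr_const card_ord mulr_natl.
have nmu0 : 0 <= n%:R * (s ^+ 2 - mu).
  rewrite -lee_fin -ZL1; apply: integral_ge0 => w _; rewrite lee_fin.
  by apply: sumr_ge0 => j _.
pose c := B * (n%:R * (s ^+ 2 - mu)).
have pw w : `|\sum_(i < n) \sum_(j < n) a i j * y i w * y j w
     - s ^+ 2 * \sum_(i < n) a i i| <= (`|V w| + (`|V w| + `|W w|)) + (B * Z w + c).
  have -> : \sum_(i < n) \sum_(j < n) a i j * y i w * y j w
     - s ^+ 2 * \sum_(i < n) a i i = (V w + (V w + W w)) +
     (\sum_(j < n) a j j * (y j w ^+ 2 - phi j w) - \sum_(j < n) a j j * (s ^+ 2 - mu)).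
    rewrite (sum_sym_quadratic (y ^~ w) asym) -/(V w).
    have -> : W w = \sum_(j < n) a j j * phi j w - mu * \sum_(j < n) a j j.
      by rewrite /W mulr_sumr -sumrB; apply: eq_bigr => j _ /=; ring.
    have -> : \sum_(j < n) a j j * (y j w ^+ 2 - phi j w) =
      \sum_(j < n) a j j * y j w ^+ 2 - \sum_(j < n) a j j * phi j w.
      by rewrite -sumrB; apply: eq_bigr => j _; ring.
    rewrite -mulr_suml; ring.
  apply: (le_trans (ler_normD _ _)); apply: lerD.
    apply: (le_trans (ler_normD _ _)); rewrite lerD2l; exact: ler_normD.
  apply: (le_trans (ler_normB _ _)); apply: lerD.
    apply: (le_trans (ler_norm_sum _ _ _)); rewrite mulr_sumr; apply: ler_sum => j _.
    by rewrite normrM (ger0_norm (Zj0 j w)) ler_wpM2r// aBd.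
  rewrite -mulr_suml normrM.
  case: (posnP n) => [n00|npos].
    by rewrite /c n00 big_ord0 normr0 mulrA !mul0r mulr0 mul0r.
  have smu : 0 <= s ^+ 2 - mu by move: nmu0; rewrite pmulr_rge0// ltr0n.
  rewrite (ger0_norm smu) /c mulrA ler_wpM2r//.
  apply: (le_trans (ler_norm_sum _ _ _)).
  apply: (@le_trans _ _ (\sum_(j < n) B)).
    by apply: ler_sum => j _; exact: aBd.
  by rewrite sumr_const card_ord mulr_natr.
have mW : measurable_fun setT W.
  by apply: measurable_sum => j; apply: measurable_funM => //; exact: measurable_funB.
have mZ : measurable_fun setT Z by exact: measurable_sum.
have nV : measurable_fun setT (fun w => `|V w|%:E).
  by apply/measurable_EFinP; exact: measurableT_comp.
have nW : measurable_fun setT (fun w => `|W w|%:E).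
  by apply/measurable_EFinP; exact: measurableT_comp.
have Z0 w : 0 <= Z w by apply: sumr_ge0 => j _.
have c0 : 0 <= c by rewrite mulr_ge0.
apply: (@le_trans _ _ (\int[P]_w ((`|V w|%:E + (`|V w|%:E + `|W w|%:E)) + (B%:E * (Z w)%:E + c%:E)))%E).
  apply: ge0_le_integral => //.
  - apply/measurable_EFinP; apply: measurableT_comp => //.
    apply: measurable_funB => //; apply: measurable_sum => i; apply: measurable_sum => j.
    by apply: measurable_funM => //; apply: measurable_funM => //; exact: mX.
  - apply: emeasurable_funD; first by repeat apply: emeasurable_funD => //.
    apply: emeasurable_funD => //; apply: measurable_funeM.
    exact/measurable_EFinP.
  - by move=> w _; rewrite -EFinM -!EFinD lee_fin; exact: pw.
rewrite ge0_integralD//; last 4 first.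
- by move=> w _; rewrite -!EFinD lee_fin !addr_ge0.
- by repeat apply: emeasurable_funD => //.
- by move=> w _; rewrite -EFinM -EFinD lee_fin addr_ge0// mulr_ge0.
- by apply: emeasurable_funD => //; apply: measurable_funeM; exact/measurable_EFinP.
rewrite ge0_integralD//; last 2 first.
- by move=> w _; rewrite -!EFinD lee_fin !addr_ge0.
- by apply: emeasurable_funD => //.
rewrite ge0_integralD//.
rewrite ge0_integralD//; last 2 first.
- by move=> w _; rewrite -EFinM lee_fin mulr_ge0.
- by apply: measurable_funeM; exact/measurable_EFinP.
rewrite ge0_integralZl//; last 2 first.
- exact/measurable_EFinP.
- by move=> w _; rewrite lee_fin.
rewrite ZL1 integral_cst//= probability_setT mule1.
have -> : 2 * (s ^+ 2 * B * Num.sqrt n%:R) + K * B * Num.sqrt n%:R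
       + 2 * (n%:R * B * (s ^+ 2 - mu)) =
  (s ^+ 2 * B * Num.sqrt n%:R + (s ^+ 2 * B * Num.sqrt n%:R + K * B * Num.sqrt n%:R))
  + (B * (n%:R * (s ^+ 2 - mu)) + c) by rewrite /c; ring.
rewrite [in leRHS]EFinD; apply: leeD.
  by rewrite !EFinD !leeD.
by rewrite EFinD EFinM.
Qed.
End QuadraticForm.

(** * Complex moduli and Hermitian products *)

Section ComplexVectors.
Variable R : realType.
Implicit Types z : R[i].

Lemma cReD z z' : Re (z + z') = Re z + Re z'. Proof. by case: z z' => ? ? []. Qed.
Lemma cImD z z' : Im (z + z') = Im z + Im z'. Proof. by case: z z' => ? ? []. Qed.
Lemma cReN z : Re (- z) = - Re z. Proof. by case: z. Qed.
Lemma cImN z : Im (- z) = - Im z. Proof. by case: z. Qed.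
Lemma cReM z z' : Re (z * z') = Re z * Re z' - Im z * Im z'.
Proof. by case: z z' => ? ? []. Qed.
Lemma cImM z z' : Im (z * z') = Re z * Im z' + Im z * Re z'.
Proof. by case: z z' => ? ? []. Qed.
Lemma cReJ z : Re (conjc z) = Re z. Proof. by case: z. Qed.
Lemma cImJ z : Im (conjc z) = - Im z. Proof. by case: z. Qed.

Lemma conjcD z z' : conjc (z + z') = conjc z + conjc z'.
Proof. by case: z z' => a b [c e] /=; congr (_ +i* _); ring. Qed.
Lemma conjcM z z' : conjc (z * z') = conjc z * conjc z'.
Proof. by case: z z' => a b [c e] /=; congr (_ +i* _); ring. Qed.
Lemma conjcKR z : conjc (conjc z) = z.
Proof. by case: z => a b /=; rewrite opprK. Qed.
Lemma conjcR (x : R) : conjc (x%:C) = x%:C.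
Proof. by rewrite /= oppr0. Qed.
Lemma conjc_sum I (r : seq I) (Q : pred I) (F : I -> R[i]) :
  conjc (\sum_(i <- r | Q i) F i) = \sum_(i <- r | Q i) conjc (F i).
Proof. by apply: (big_morph _ conjcD); rewrite conjc0. Qed.

Lemma cIm_sum I (r : seq I) (Q : pred I) (F : I -> R[i]) :
  Im (\sum_(i <- r | Q i) F i) = \sum_(i <- r | Q i) Im (F i).
Proof. exact: (big_morph _ cImD). Qed.
Lemma sumC I (r : seq I) (Q : pred I) (F : I -> R) :
  (\sum_(i <- r | Q i) F i)%:C = \sum_(i <- r | Q i) (F i)%:C.
Proof. exact: rmorph_sum. Qed.

Lemma cnormE z : normc z = Num.sqrt (Re z ^+ 2 + Im z ^+ 2).
Proof. by case: z. Qed.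
Lemma normc_ge0 z : 0 <= normc z. Proof. by rewrite cnormE sqrtr_ge0. Qed.
Lemma sqr_cnorm z : normc z ^+ 2 = Re z ^+ 2 + Im z ^+ 2.
Proof. by rewrite cnormE sqr_sqrtr// addr_ge0 ?sqr_ge0. Qed.
Lemma cnormR (x : R) : normc x%:C = `|x|.
Proof. by rewrite cnormE /= expr0n addr0 sqrtr_sqr. Qed.
Lemma cnormJ z : normc (conjc z) = normc z.
Proof. by rewrite !cnormE cReJ cImJ sqrrN. Qed.
Lemma cnormN z : normc (- z) = normc z.
Proof. by rewrite !cnormE cReN cImN !sqrrN. Qed.
Lemma ler_normcD z z' : normc (z + z') <= normc z + normc z'.
Proof. by rewrite -lecR rmorphD /=; exact: (ler_normD z z'). Qed.
Lemma ler_normcB z z' : normc (z - z') <= normc z + normc z'.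
Proof. by rewrite -(cnormN z'); exact: ler_normcD. Qed.
Lemma cnormM z z' : normc (z * z') = normc z * normc z'.
Proof. exact: ComplexField.Normc.normcM. Qed.
Lemma cnormV z : normc z^-1 = (normc z)^-1.
Proof. exact: ComplexField.Normc.normcV. Qed.
Lemma normc_eq0 z : (normc z == 0) = (z == 0).
Proof.
apply/eqP/eqP => [/ComplexField.Normc.eq0_normc //|->].
exact: ComplexField.Normc.normc0.
Qed.
Lemma normc_gt0 z : (0 < normc z) = (z != 0).
Proof. by rewrite lt_neqAle normc_ge0 andbT eq_sym normc_eq0. Qed.
Lemma ler_normc_sum I (r : seq I) (Q : pred I) (F : I -> R[i]) :
  normc (\sum_(i <- r | Q i) F i) <= \sum_(i <- r | Q i) normc (F i).
Proof.
elim/big_ind2: _ => [|x u y v hx hy|//]; first by rewrite cnormR normr0.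
by apply: (le_trans (ler_normcD _ _)); exact: lerD.
Qed.
Lemma ler_normc_ReIm z : normc z <= `|Re z| + `|Im z|.
Proof.
rewrite -ler_sqr ?nnegrE ?addr_ge0 ?normc_ge0// sqr_cnorm.
rewrite -(real_normK (num_real (Re z))) -(real_normK (num_real (Im z))).
have := normr_ge0 (Re z); have := normr_ge0 (Im z); nra.
Qed.
Lemma ler_Re_normc z : `|Re z| <= normc z.
Proof.
rewrite -ler_sqr ?nnegrE ?normc_ge0// sqr_cnorm real_normK ?num_real//.
by rewrite lerDl sqr_ge0.
Qed.
Lemma ler_Im_normc z : `|Im z| <= normc z.
Proof.
rewrite -ler_sqr ?nnegrE ?normc_ge0// sqr_cnorm real_normK ?num_real//.
by rewrite lerDr sqr_ge0.
Qed.

Definition cdot n (x y : 'cV[R[i]]_n) : R[i] := \sum_i conjc (x i 0) * y i 0.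
Definition sqn n (x : 'cV[R[i]]_n) : R := \sum_i normc (x i 0) ^+ 2.

Lemma sqn_ge0 n (x : 'cV[R[i]]_n) : 0 <= sqn x.
Proof. by apply: sumr_ge0 => i _; exact: sqr_ge0. Qed.

Lemma sqn_eq0 n (x : 'cV[R[i]]_n) : sqn x = 0 -> x = 0.
Proof.
move=> /eqP; rewrite psumr_eq0; last by move=> i _; exact: sqr_ge0.
move=> /allP h; apply/matrixP => i j; rewrite ord1 mxE.
have := h i (mem_index_enum _); rewrite /= sqrf_eq0 => /eqP.
exact: ComplexField.Normc.eq0_normc.
Qed.

Lemma mulJc z : conjc z * z = (normc z ^+ 2)%:C.
Proof.
rewrite sqr_cnorm; case: z => a b; apply/eqP; rewrite eq_complex /=.
by apply/andP; split; apply/eqP; ring.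
Qed.

Lemma cdotxx n (x : 'cV[R[i]]_n) : cdot x x = (sqn x)%:C.
Proof. by rewrite /cdot /sqn sumC; apply: eq_bigr => i _; exact: mulJc. Qed.

Lemma cdotJ n (x y : 'cV[R[i]]_n) : conjc (cdot x y) = cdot y x.
Proof.
rewrite /cdot conjc_sum; apply: eq_bigr => i _.
by rewrite conjcM conjcKR mulrC.
Qed.

Lemma cdotDr n (x y z : 'cV[R[i]]_n) : cdot x (y + z) = cdot x y + cdot x z.
Proof. by rewrite /cdot -big_split; apply: eq_bigr => i _ /=; rewrite mxE mulrDr. Qed.
Lemma cdotNr n (x y : 'cV[R[i]]_n) : cdot x (- y) = - cdot x y.
Proof. by rewrite /cdot -sumrN; apply: eq_bigr => i _ /=; rewrite mxE mulrN. Qed.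
Lemma cdotZr n a (x y : 'cV[R[i]]_n) : cdot x (a *: y) = a * cdot x y.
Proof. by rewrite /cdot mulr_sumr; apply: eq_bigr => i _ /=; rewrite mxE mulrCA. Qed.
Lemma cdotDl n (x y z : 'cV[R[i]]_n) : cdot (x + y) z = cdot x z + cdot y z.
Proof. by rewrite -cdotJ cdotDr conjcD !cdotJ. Qed.
Lemma cdotZl n a (x y : 'cV[R[i]]_n) : cdot (a *: x) y = conjc a * cdot x y.
Proof. by rewrite -cdotJ cdotZr conjcM !cdotJ. Qed.

Lemma sqnD n (x y : 'cV[R[i]]_n) : sqn (x + y) = sqn x + sqn y + 2 * Re (cdot x y).
Proof.
have -> : sqn (x + y) = Re (cdot (x + y) (x + y)) by rewrite cdotxx.
rewrite cdotDl !cdotDr !cdotxx -(cdotJ x y) !cReD cReJ /=.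
by rewrite mulr_natl mulr2n [Re _ + sqn y]addrC addrACA.
Qed.

Lemma cdot_sym n (M : 'M[R]_n) (x y : 'cV[R[i]]_n) : M^T = M ->
  cdot x (complexify M *m y) = cdot (complexify M *m x) y.
Proof.
move=> Ms; rewrite /cdot.
under eq_bigr => i _ do rewrite mxE mulr_sumr.
under [RHS]eq_bigr => i _ do rewrite mxE conjc_sum mulr_suml.
rewrite exchange_big; apply: eq_bigr => j _; apply: eq_bigr => i _ /=.
by rewrite !mxE conjcM conjcR -{1}Ms mxE mulrCA mulrA.
Qed.

(** The quadratic form of a real symmetric matrix is real, so the imaginary
    part of an approximate eigenvalue is controlled by the defect alone. *)
Lemma imaginary_defect n (M : 'M[R]_n) (x e : 'cV[R[i]]_n) z : M^T = M ->
  complexify M *m x = z *: x + e -> Im z * sqn x = - Im (cdot x e).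
Proof.
move=> Ms Mx.
have : Im (cdot x (complexify M *m x)) = 0.
  have := cdotJ x (complexify M *m x); rewrite -cdot_sym//.
  case: (cdot _ _) => a b [] /eqP; rewrite eqNr => /eqP -> //.
rewrite Mx cdotDr cdotZr cdotxx cImD cImM /= mulr0 add0r => h.
by apply/eqP; rewrite -addr_eq0 h.
Qed.
End ComplexVectors.

(** * Resolvents of real symmetric matrices *)

Section Resolvent.
Variable R : realType.

Definition shifted n (M : 'M[R]_n) (z : R[i]) : 'M[R[i]]_n := complexify M - z%:M.
Definition resolvent n (M : 'M[R]_n) (z : R[i]) : 'M[R[i]]_n := invmx (shifted M z).

Lemma complexify_tr n (M : 'M[R]_n) : (complexify M)^T = complexify M^T.
Proof. by rewrite /complexify map_trmx. Qed.

Lemma shifted_tr n (M : 'M[R]_n) z : M^T = M -> (shifted M z)^T = shifted M z.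
Proof. by move=> Ms; rewrite /shifted linearB /= tr_scalar_mx complexify_tr Ms. Qed.

Lemma shifted_mul n (M : 'M[R]_n) z (x e : 'cV[R[i]]_n) :
  shifted M z *m x = e -> complexify M *m x = z *: x + e.
Proof. by move=> <-; rewrite /shifted mulmxBl mul_scalar_mx addrC subrK. Qed.

Lemma shifted_inj n (M : 'M[R]_n) z (x : 'cV[R[i]]_n) : M^T = M -> Im z != 0 ->
  shifted M z *m x = 0 -> x = 0.
Proof.
move=> Ms z0 /shifted_mul /(imaginary_defect Ms).
rewrite /cdot big1 => [|i _]; last by rewrite mxE mulr0.
rewrite oppr0 => /eqP; rewrite mulf_eq0 (negPf z0) /= => /eqP.
exact: sqn_eq0.
Qed.

Lemma shifted_unit n (M : 'M[R]_n) z : M^T = M -> Im z != 0 ->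
  shifted M z \in unitmx.
Proof.
move=> Ms z0; rewrite -row_free_unit; apply: inj_row_free => v v0.
apply: (can_inj (@trmxK _ _ _)); rewrite trmx0.
apply: (@shifted_inj _ M z) => //.
by rewrite -{1}(shifted_tr z Ms) -trmx_mul v0 trmx0.
Qed.

Section Fixed.
Context (n : nat) (M : 'M[R]_n) (eta : R).
Hypotheses (Ms : M^T = M) (eta0 : 0 < eta).
Let z : R[i] := 0 +i* eta.
Let G := resolvent M z.
Let z0 : Im z != 0. Proof. by rewrite /= gt_eqF. Qed.

Lemma resolvent_tr : G^T = G.
Proof. by rewrite /G /resolvent trmx_inv shifted_tr. Qed.

Lemma mulmx_resolvent : shifted M z *m G = 1%:M.
Proof. by rewrite mulmxV// shifted_unit. Qed.

Lemma resolvent_uniq m (x e : 'M[R[i]]_(n, m)) : shifted M z *m x = e -> x = G *m e.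
Proof. by move=> <-; rewrite mulmxA mulVmx ?mul1mx// shifted_unit. Qed.

Lemma resolvent_sym i j : G i j = G j i.
Proof. by rewrite -{1}resolvent_tr mxE. Qed.

(** The [i]-th column [g] solves [(M - z) g = e_i], so this is
    [imaginary_defect] for the defect [e_i]. *)
Lemma ward_identity i : Im (G i i) = eta * \sum_j normc (G i j) ^+ 2.
Proof.
have h : shifted M z *m col i G = delta_mx i 0.
  by rewrite colE mulmxA mulmx_resolvent mul1mx.
have := imaginary_defect Ms (shifted_mul h).
rewrite /cdot (bigD1 i)//= big1 ?addr0 => [|j ji]; last first.
  by rewrite !mxE (negPf ji) mulr0.
rewrite !mxE !eqxx mulr1 cImJ opprK => <-; congr (_ * _).
by apply: eq_bigr => j _; rewrite mxE resolvent_sym.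
Qed.

Lemma resolvent_diag_Im_ge0 i : 0 <= Im (G i i).
Proof. by rewrite ward_identity mulr_ge0 ?(ltW eta0)// sumr_ge0// => j _; exact: sqr_ge0. Qed.

(** By the Ward identity [eta |G i i|^2 <= Im (G i i) <= |G i i|]. *)
Lemma resolvent_diag_le i : normc (G i i) <= eta^-1.
Proof.
have h : eta * normc (G i i) ^+ 2 <= normc (G i i).
  apply: le_trans (ler_Im_normc _); apply: le_trans (ler_norm _).
  rewrite ward_identity ler_wpM2l ?(ltW eta0)// (bigD1 i)//= lerDl.
  by apply: sumr_ge0 => j _; exact: sqr_ge0.
have := normc_ge0 (G i i); rewrite le_eqVlt => /orP[/eqP <-|n0].
  by rewrite invr_ge0 ltW.
rewrite -[leRHS]mul1r ler_pdivlMr//.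
by move: h; rewrite expr2 mulrA -{3}[normc (G i i)]mul1r ler_pM2r// mulrC.
Qed.

Lemma resolvent_row_le i : \sum_j normc (G i j) ^+ 2 <= eta^-1 ^+ 2.
Proof.
rewrite expr2 -[leRHS]mulrC ler_pdivlMl// -ward_identity.
apply: le_trans (resolvent_diag_le i).
exact: le_trans (ler_norm _) (ler_Im_normc _).
Qed.
End Fixed.

(** The [k]-th coordinate is decoupled instead of being deleted, so that the
    resolvents before and after are matrices of the same size. *)
Definition decoupled n (M : 'M[R]_n) (k : 'I_n) : 'M[R]_n :=
  \matrix_(i, j) if (i == k) || (j == k) then 0 else M i j.

Lemma decoupled_tr n (M : 'M[R]_n) k : M^T = M -> (decoupled M k)^T = decoupled M k.
Proof.
by move=> Ms; apply/matrixP => i j; rewrite !mxE orbC -{1}Ms mxE.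
Qed.

Section Schur.
Context (n : nat) (M : 'M[R]_n) (k : 'I_n) (eta : R).
Hypotheses (Ms : M^T = M) (eta0 : 0 < eta).
Let z : R[i] := 0 +i* eta.
Let G := resolvent M z.
Let G' := resolvent (decoupled M k) z.
Let c : 'cV[R[i]]_n := \col_i if i == k then 0 else (M i k)%:C.
Let ek : 'cV[R[i]]_n := delta_mx k 0.
Let h := G' *m c.
Let v := ek - h.
Let a : R[i] := \sum_i \sum_j G' i j * c i 0 * c j 0.
Let D := (M k k)%:C - z - a.
Let S := shifted M z.
Let S' := shifted (decoupled M k) z.

Let z0 : z != 0. Proof. by rewrite eq_complex /= eqxx gt_eqF. Qed.
Let Iz0 : Im z != 0. Proof. by rewrite /= gt_eqF. Qed.
Let S's : (decoupled M k)^T = decoupled M k. Proof. exact: decoupled_tr. Qed.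

Let SE : S = S' + ek *m c^T + c *m ek^T + (M k k)%:C *: (ek *m ek^T).
Proof.
apply/matrixP => i j; rewrite !mxE !big_ord1 !mxE !eqxx !andbT.
case: (altP (i =P k)) => [->|ik]; case: (altP (j =P k)) => [->|jk] /=;
  rewrite ?[(0 : R)%:C](erefl : _ = 0) ?(mulr0, mul0r, mulr1, mul1r, addr0, sub0r) //.
- by rewrite addrC.
- by rewrite -{1}Ms mxE addrC.
- by rewrite addrC.
Qed.

Let SM m (x : 'M[R[i]]_(n, m)) : S *m x = S' *m x + ek *m (c^T *m x) +
  c *m (ek^T *m x) + (M k k)%:C *: (ek *m (ek^T *m x)).
Proof. by rewrite SE 3!mulmxDl -scalemxAl -!mulmxA. Qed.

Let S'ek : S' *m ek = (- z) *: ek.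
Proof.
apply/matrixP => i j; rewrite /S' /shifted mulmxBl mul_scalar_mx.
rewrite !mxE ord1 big1 ?add0r ?mulNr// => l _.
rewrite !mxE; case: (l == k); last by rewrite mulr0.
by rewrite orbT [X in X * _](_ : _ = 0) ?mul0r.
Qed.

Let G'ek : G' *m ek = - z^-1 *: ek.
Proof.
apply/esym/resolvent_uniq => //.
by rewrite -scalemxAr S'ek scalerA mulrNN mulVf// scale1r.
Qed.

Let ckT : c^T *m ek = 0.
Proof.
apply/matrixP => i j; rewrite !mxE big1// => l _.
by rewrite !mxE ord1; case: eqVneq => _; rewrite ?mul0r ?mulr0.
Qed.

Let ekTh : ek^T *m h = 0.
Proof.
have G's : G'^T = G' by exact: resolvent_tr.
rewrite /h mulmxA -{1}G's -trmx_mul G'ek linearZ /= -scalemxAl.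
by rewrite -[ek^T *m c]trmxK trmx_mul trmxK ckT trmx0 scaler0.
Qed.

Let cTh : c^T *m h = a%:M.
Proof.
apply/matrixP => i j; rewrite !ord1 mxE [RHS]mxE eqxx mulr1n /a.
apply: eq_bigr => l _; rewrite [c^T _ _]mxE [h _ _]mxE mulr_sumr.
by apply: eq_bigr => m _; rewrite mulrCA mulrA.
Qed.

Let ekTek : ek^T *m ek = 1%:M.
Proof.
apply/matrixP => i j; rewrite !ord1 mxE (bigD1 k)//= big1 ?addr0 => [|l lk].
  by rewrite !mxE !eqxx mulr1.
by rewrite !mxE (negPf lk) mulr0.
Qed.

Let S'h : S' *m h = c.
Proof. by rewrite /h mulmxA mulmx_resolvent// mul1mx. Qed.

Let Sv : S *m v = D *: ek.
Proof.
rewrite /v mulmxBr !SM S'ek S'h ckT cTh ekTek ekTh.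
rewrite !mulmx1 !mulmx0 !mul_mx_scalar scaler0 /D !scalerBl; apply/matrixP => i j.
by rewrite !mxE; ring.
Qed.

Let vk : v k 0 = 1.
Proof.
have := congr1 (fun A : 'M[R[i]]_1 => A 0 0) ekTh; rewrite mxE (bigD1 k)//= big1 => [|l lk].
  by rewrite !mxE !eqxx mul1r addr0 => ->; rewrite subr0.
by rewrite !mxE (negPf lk) mul0r.
Qed.

Let D0 : D != 0.
Proof.
apply/eqP => De; move: Sv; rewrite De scale0r => /(shifted_inj Ms Iz0) v0.
by move: vk; rewrite v0 mxE => /eqP; rewrite eq_sym oner_eq0.
Qed.

Let Gek : G *m ek = D^-1 *: v.
Proof.
by apply/esym/resolvent_uniq => //; rewrite -scalemxAr Sv scalerA mulVf// scale1r.
Qed.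

(** The vector [v = e_k - G' c] solves [(M - z) v = D e_k] and has [k]-th
    coordinate 1, hence [G k k = 1 / D] for the Schur complement [D]. *)
Lemma schur_diag : G k k * D = 1.
Proof.
have := congr1 (fun A : 'cV[R[i]]_n => A k 0) Gek.
by rewrite -colE mxE [RHS]mxE vk mulr1 => ->; rewrite mulVf.
Qed.

Let q_split : \sum_i \sum_j G' i j * (M i k)%:C * (M j k)%:C =
  a - (M k k)%:C ^+ 2 * z^-1.
Proof.
have G'k i : G' i k = - z^-1 * (i == k)%:R.
  have := congr1 (fun A : 'cV[R[i]]_n => A i 0) G'ek.
  by rewrite -colE !mxE eqxx andbT.
have G's i j : G' i j = G' j i by exact: resolvent_sym.
transitivity (\sum_i \sum_j (G' i j * c i 0 * c j 0 +
    (if (i == k) && (j == k) then - ((M k k)%:C ^+ 2 * z^-1) else 0))).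
  apply: eq_bigr => i _; apply: eq_bigr => j _; rewrite !mxE.
  case: (altP (i =P k)) => [->|ik]; case: (altP (j =P k)) => [->|jk] /=.
  - by rewrite G'k eqxx /= !mulr1 [X in X + _](_ : _ = 0) ?add0r ?mulr0//; ring.
  - by rewrite (G's k j) G'k (negPf jk) mulr0 !mul0r addr0.
  - by rewrite G'k (negPf ik) mulr0 !mul0r addr0.
  - by rewrite addr0.
under eq_bigr do rewrite big_split /=.
rewrite big_split /=; congr (_ + _).
rewrite (bigD1 k)//= [X in _ + X]big1 ?addr0 => [|i ik]; last first.
  by rewrite big1// => j _; rewrite (negPf ik).
by rewrite (bigD1 k)//= big1 ?addr0 ?eqxx// => j jk; rewrite (negPf jk) andbF.
Qed.

(** The sum runs over the full column of [M], including its [k]-th entry, which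
    contributes [- (M k k)^2 / z] because [G' e_k = - e_k / z]. *)
Lemma schur_diag_col : G k k * ((M k k)%:C - z -
  \sum_i \sum_j G' i j * (M i k)%:C * (M j k)%:C - (M k k)%:C ^+ 2 * z^-1) = 1.
Proof. by rewrite q_split -schur_diag; congr (_ * _); rewrite /D; ring. Qed.

Let GE : G = G' + z^-1 *: (ek *m ek^T) + D^-1 *: (v *m v^T).
Proof.
suff e : S *m (G' + z^-1 *: (ek *m ek^T) + D^-1 *: (v *m v^T)) = 1%:M.
  by have := resolvent_uniq Ms eta0 e; rewrite mulmx1 => ->.
have G's : G'^T = G' by exact: resolvent_tr.
have ekG : ek^T *m G' = - z^-1 *: ek^T.
  by rewrite -{1}G's -trmx_mul G'ek linearZ.
have cG : c^T *m G' = h^T by rewrite /h trmx_mul G's.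
have Sek : S *m ek = - z *: ek + c + (M k k)%:C *: ek.
  by rewrite SM S'ek ckT ekTek !mulmx1 mulmx0 addr0.
have SG' : S *m G' = 1%:M + ek *m h^T + c *m (- z^-1 *: ek^T) +
    (M k k)%:C *: (ek *m (- z^-1 *: ek^T)).
  by rewrite SM mulmx_resolvent// cG ekG.
rewrite !mulmxDr SG' -!scalemxAr !mulmxA Sv Sek -!scalemxAl !scalerA mulVf// scale1r.
rewrite !mulmxDl -!scalemxAl /v linearB /= mulmxBr.
apply/matrixP => i j; rewrite !mxE; move: (\sum_(_ < _) _) (\sum_(_ < _) _) (\sum_(_ < _) _).
move=> A B E; by field.
Qed.

(** Decoupling one coordinate is a perturbation of rank two, explicit in [GE];
    the trace of the term [v v^T / D] is at most [sqn v / |D|], and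
    [imaginary_defect] applied to [v] gives [eta * sqn v <= |D|]. *)
Lemma decoupled_trace_le : normc (\tr G - \tr G') <= 2 * eta^-1.
Proof.
have nz : normc z^-1 = eta^-1 by rewrite cnormV cnormE /= expr0n add0r sqrtr_sqr gtr0_norm.
have Dv : eta * sqn v <= normc D.
  have := imaginary_defect Ms (shifted_mul Sv); rewrite /= => ->.
  apply: le_trans (ler_norm _) _; rewrite normrN.
  rewrite cdotZr; have -> : cdot v ek = 1; last by rewrite mulr1 ler_Im_normc.
  rewrite /cdot (bigD1 k)//= big1 => [|l lk]; last by rewrite !mxE (negPf lk) mulr0.
  by rewrite vk !mxE !eqxx mulr1 addr0 /= oppr0.
have trv : normc (\tr (v *m v^T)) <= sqn v.
  apply: le_trans (ler_normc_sum _ _ _) _; apply: ler_sum => i _.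
  by rewrite mxE big_ord1 [v^T _ _]mxE cnormM expr2.
have treke : \tr (ek *m ek^T) = 1.
  by rewrite mxtrace_mulC ekTek mxtrace1.
have -> : \tr G - \tr G' = z^-1 + D^-1 * \tr (v *m v^T).
  by rewrite GE !mxtraceD !mxtraceZ treke; ring.
apply: le_trans (ler_normcD _ _) _; rewrite nz mulr_natl mulr2n lerD2l.
rewrite cnormM cnormV mulrC ler_pdivrMr ?normc_gt0// ler_pdivlMl//.
by apply: le_trans Dv; rewrite ler_wpM2l ?(ltW eta0).
Qed.
End Schur.
End Resolvent.

(** * The normalized trace of the resolvent *)

Section SelfConsistency.
Context (R : realType) (n : nat) (M : 'M[R]_n) (eta s : R).
Hypotheses (Ms : M^T = M) (eta0 : 0 < eta) (n0 : (0 < n)%N).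
Hypothesis s_eta : s ^+ 2 = 2 * eta ^+ 2.
Let z : R[i] := 0 +i* eta.
Let G := resolvent M z.
Let G' k := resolvent (decoupled M k) z.

Definition column_deviation (k : 'I_n) : R[i] :=
  \sum_i \sum_j G' k i j * (M i k)%:C * (M j k)%:C - (s ^+ 2 / n%:R)%:C * \tr (G' k).

Let u : R[i] := (s ^+ 2 / n%:R)%:C * \tr G.

Let defect k : R := `|M k k| + normc (column_deviation k) + M k k ^+ 2 / eta
  + s ^+ 2 / n%:R * (2 / eta).

Let nz : normc z^-1 = eta^-1.
Proof. by rewrite cnormV cnormE /= expr0n add0r sqrtr_sqr gtr0_norm. Qed.

Let s2 : 0 <= s ^+ 2 / n%:R. Proof. by rewrite divr_ge0 ?sqr_ge0. Qed.

(* The Schur complement with the quadratic form replaced by its mean and the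
   trace of the decoupled resolvent by the full one. *)
Let diag_defect k : normc (G k k * (- z - u) - 1) <= eta^-1 * defect k.
Proof.
rewrite -(schur_diag_col k Ms eta0) -mulrBr cnormM.
apply: ler_pM; rewrite ?normc_ge0//; first exact: resolvent_diag_le.
set q := \sum_i _.
have -> : - z - u - ((M k k)%:C - z - q - (M k k)%:C ^+ 2 / z) =
  - (M k k)%:C + column_deviation k + (M k k ^+ 2)%:C * z^-1
  - (s ^+ 2 / n%:R)%:C * (\tr G - \tr (G' k)).
  by rewrite /column_deviation -/q /u rmorphXn /=; ring.
apply: le_trans (ler_normcB _ _) _; apply: lerD; last first.
  rewrite cnormM cnormR (ger0_norm s2) ler_wpM2l//.
  exact: decoupled_trace_le.
apply: le_trans (ler_normcD _ _) _; apply: lerD; last first.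
  by rewrite cnormM nz cnormR ger0_norm ?sqr_ge0.
apply: le_trans (ler_normcD _ _) _; apply: lerD => //.
by rewrite cnormN cnormR.
Qed.

(** Averaging the Schur identities over [k] shows that the normalized trace
    nearly solves the quadratic equation of the semicircle law; at
    [z = i eta] its two roots are [z] and [- 2 z], and the positivity of the
    imaginary part rules out the second one with a margin. *)
Lemma trace_near_fixed_point :
  normc ((s ^+ 2 / n%:R)%:C * \tr (resolvent M (0 +i* eta)) - (0 +i* eta)) <=
  n%:R^-1 * \sum_k defect k.
Proof.
rewrite -/z -/G -/u.
have nR : n%:R != 0 :> R by rewrite pnatr_eq0 -lt0n.
pose A : R[i] := \sum_k (G k k * (- z - u) - 1).
have AE : (eta ^+ 2 * 2 / n%:R)%:C * A = - ((u - z) * (u + 2 * z)).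
  have -> : A = \tr G * (- z - u) - n%:R.
    by rewrite /A sumrB mulr_suml sumr_const card_ord.
  have -> : - ((u - z) * (u + 2 * z)) = u * (- z - u) + 2 * z ^+ 2 by ring.
  rewrite mulrBr mulrA [eta ^+ 2 * 2]mulrC -s_eta -/u; congr (_ + _).
  rewrite -(rmorph_nat (real_complex R)) -rmorphM /= divfK// s_eta.
  by apply/eqP; rewrite eq_complex expr2 /=; apply/andP; split; apply/eqP; ring.
have Iu : 2 * eta <= normc (u + 2 * z).
  apply: le_trans (ler_Im_normc _); apply: le_trans (ler_norm _).
  have -> : Im (u + 2 * z) = Im u + 2 * eta.
    by rewrite cImD; congr (_ + _); rewrite /=; ring.
  rewrite lerDr /u cImM /= mul0r addr0 mulr_ge0// cIm_sum sumr_ge0// => k _.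
  exact: resolvent_diag_Im_ge0.
have nA : normc A <= eta^-1 * \sum_k defect k.
  apply: le_trans (ler_normc_sum _ _ _) _; rewrite mulr_sumr.
  by apply: ler_sum => k _; exact: diag_defect.
have : normc (u - z) * (2 * eta) <= eta ^+ 2 * 2 / n%:R * (eta^-1 * \sum_k defect k).
  apply: (@le_trans _ _ (normc (u - z) * normc (u + 2 * z))).
    by rewrite ler_wpM2l ?normc_ge0.
  rewrite -cnormM -cnormN -AE cnormM cnormR ger0_norm; last first.
    by rewrite divr_ge0// mulr_ge0// sqr_ge0.
  by rewrite ler_wpM2l// divr_ge0// mulr_ge0// sqr_ge0.
have -> : eta ^+ 2 * 2 / n%:R * (eta^-1 * \sum_k defect k) =
  n%:R^-1 * (\sum_k defect k) * (2 * eta) by field; rewrite nR gt_eqF.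
by rewrite ler_pM2r// mulr_gt0.
Qed.
End SelfConsistency.

(** * Eigenvalues of nonpositive type *)

Section NonpositiveType.
Variable R : realType.

Definition cvec n (b : 'cV[R]_n) : 'cV[R[i]]_n := map_mx (real_complex R) b.

(** The normalized eigenvector equation for an eigenvalue of nonpositive type:
    the first coordinate of the eigenvector is 1 and [v] collects the others. *)
Definition nonpositive_pair n (a0 : R) (b : 'cV[R]_n) (C : 'M[R]_n) (beta : R[i])
    (v : 'cV[R[i]]_n) : Prop :=
  [/\ 0 <= Im beta, sqn v <= 1, - a0%:C - \sum_i (b i 0)%:C * v i 0 = beta &
      complexify C *m v = beta *: v - cvec b].

Lemma cdot_cvec n (b : 'cV[R]_n) (v : 'cV[R[i]]_n) :
  cdot (cvec b) v = \sum_i (b i 0)%:C * v i 0.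
Proof. by apply: eq_bigr => i _; rewrite mxE conjcR. Qed.

Lemma conjc_rV n (b : 'cV[R]_n) (v : 'cV[R[i]]_n) :
  cdot v (cvec b) = conjc (\sum_i (b i 0)%:C * v i 0).
Proof. by rewrite -cdot_cvec cdotJ. Qed.

(** The inequality of arithmetic and geometric means, with a weight [t] chosen
    later. *)
Lemma normc_pairing_le n (b : 'cV[R]_n) (v : 'cV[R[i]]_n) (t : R) : 0 < t ->
  normc (\sum_i (b i 0)%:C * v i 0) <= t * \sum_i b i 0 ^+ 2 + (4 * t)^-1 * sqn v.
Proof.
move=> t0; apply: le_trans (ler_normc_sum _ _ _) _.
rewrite /sqn !mulr_sumr -big_split /=; apply: ler_sum => i _; rewrite cnormM cnormR.
rewrite -(real_normK (num_real (b i 0))).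
set p := `|_|; set q := normc _; rewrite -subr_ge0.
have -> : t * p ^+ 2 + (4 * t)^-1 * q ^+ 2 - p * q = (4 * t)^-1 * (2 * t * p - q) ^+ 2.
  by field; rewrite gt_eqF.
by rewrite mulr_ge0 ?sqr_ge0// invr_ge0; lra.
Qed.

Section Fixed.
Context (n : nat) (a0 : R) (b : 'cV[R]_n) (C : 'M[R]_n).
Hypothesis Cs : C^T = C.

(** Two distinct eigenvalues in the closed upper half-plane have
    [H]-orthogonal eigenvectors, and the form has only one negative square. *)
Lemma nonpositive_pair_uniq beta beta' v v' :
  nonpositive_pair a0 b C beta v -> nonpositive_pair a0 b C beta' v' -> beta = beta'.
Proof.
move=> [I1 n1 e1 E1] [I2 n2 e2 E2]; apply/eqP; apply: contrapT => /negP ne.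
pose t := cdot v v'.
have d0 : beta' - conjc beta != 0.
  apply/negP => /eqP h; move/negP: ne; apply; apply/eqP.
  case: beta beta' h I1 I2 {e1 E1 e2 E2} => [p q] [p' q'] /= [h1 h2] q0 q'0.
  by congr (_ +i* _); lra.
have t1 : t = 1.
  have := cdot_sym v v' Cs; rewrite E1 E2 cdotDr cdotNr cdotZr cdotDl cdotZl.
  have -> : cdot (- cvec b) v' = - cdot (cvec b) v'.
    by rewrite -cdotJ cdotNr -[in RHS]cdotJ; case: (cdot _ _) => ? ? /=; congr (_ +i* _).
  rewrite conjc_rV cdot_cvec -/t.
  have -> : \sum_i (b i 0)%:C * v i 0 = - a0%:C - beta by rewrite -e1; ring.
  have -> : \sum_i (b i 0)%:C * v' i 0 = - a0%:C - beta' by rewrite -e2; ring.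
  have -> : conjc (- a0%:C - beta) = - a0%:C - conjc beta.
    by case: (beta) => p q; apply/eqP; rewrite eq_complex /=; apply/andP; split; apply/eqP; ring.
  move=> h; apply/eqP; rewrite -subr_eq0 -(mulrI_eq0 _ (mulfI d0)); apply/eqP.
  have -> : (beta' - conjc beta) * (t - 1) =
    (beta' * t - (- a0%:C - conjc beta)) - (conjc beta * t - (- a0%:C - beta')) by ring.
  by rewrite h subrr.
have nN : sqn (- v') = sqn v'.
  by apply: eq_bigr => i _; rewrite mxE cnormN.
have : sqn (v - v') = 0.
  apply/eqP; rewrite eq_le sqn_ge0 andbT sqnD nN cdotNr -/t t1 /=.
  lra.
move/sqn_eq0/eqP; rewrite subr_eq0 => /eqP vv.
by move: ne; rewrite -e1 -e2 vv eqxx.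
Qed.

Context (eta : R) (h : 'cV[R[i]]_n).
Hypothesis eta0 : 0 < eta.
Let z : R[i] := 0 +i* eta.
Hypothesis h_eq : complexify C *m h = z *: h + cvec b.
Let eps : R[i] := - a0%:C + \sum_i (b i 0)%:C * h i 0 - z.

(** [(1, - h)] is an eigenvector for [z] up to the defect [eps], and its inner
    product with the true eigenvector is forced by self-adjointness; the two
    vectors have the same first coordinate, on the complement of which the
    form is positive, so they are close. *)
Lemma nonpositive_pair_close beta v : nonpositive_pair a0 b C beta v ->
  sqn (v + h) <= 3 * normc eps / eta.
Proof.
move=> [I1 n1 e1 E1].
have sbh : \sum_i (b i 0)%:C * h i 0 = eps + a0%:C + z by rewrite /eps; ring.
have sbv : \sum_i (b i 0)%:C * v i 0 = - a0%:C - beta by rewrite -e1; ring.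
have nh : eta * sqn h = Im eps + eta.
  have := imaginary_defect Cs h_eq; rewrite conjc_rV sbh cImJ opprK => /= ->.
  by rewrite !cImD /= addr0.
pose t := cdot h v.
have d1 : eta <= normc (beta - conjc z).
  apply: le_trans (ler_Im_normc _); apply: le_trans (ler_norm _).
  by rewrite cImD cImN cImJ opprK /= lerDr.
have tE : (beta - conjc z) * (t + 1) = conjc eps.
  have := cdot_sym h v Cs; rewrite E1 h_eq cdotDr cdotNr cdotZr cdotDl cdotZl.
  rewrite conjc_rV cdot_cvec sbh sbv -/t => hh.
  have -> : (beta - conjc z) * (t + 1) =
    (beta * t - conjc (eps + a0%:C + z)) - (conjc z * t + (- a0%:C - beta))
     + (conjc (eps + a0%:C + z) - a0%:C - conjc z) by ring.
  rewrite hh subrr add0r; case: (eps) => p q; apply/eqP.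
  by rewrite eq_complex /=; apply/andP; split; apply/eqP; ring.
have t1 : Re t + 1 <= normc eps / eta.
  have -> : Re t + 1 = Re (t + 1) by rewrite cReD.
  apply: le_trans (ler_norm _) _; apply: le_trans (ler_Re_normc _) _.
  rewrite ler_pdivlMr// -(cnormJ eps) -tE cnormM mulrC ler_wpM2r// normc_ge0 //.
rewrite sqnD.
have -> : Re (cdot v h) = Re t by rewrite -cdotJ cReJ.
have h1 : sqn h <= 1 + normc eps / eta.
  have -> : 1 + normc eps / eta = eta^-1 * (normc eps + eta) by field; rewrite gt_eqF.
  rewrite ler_pdivlMl// nh lerD2r.
  exact: le_trans (ler_norm _) (ler_Im_normc _).
have -> : 3 * normc eps / eta = 3 * (normc eps / eta) by ring.
lra.
Qed.

(** The first coordinates of the two eigenvector equations give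
    [beta - z = eps - b^T (v + h)]. *)
Lemma nonpositive_pair_dist beta v (t : R) : 0 < t -> nonpositive_pair a0 b C beta v ->
  normc (beta - z) <=
  normc eps * (1 + 3 / (4 * t * eta)) + t * \sum_i b i 0 ^+ 2.
Proof.
move=> t0 nv; have cl := nonpositive_pair_close nv.
have [I1 n1 e1 E1] := nv.
have -> : beta - z = eps - \sum_i (b i 0)%:C * (v + h) i 0.
  under eq_bigr do rewrite mxE mulrDr.
  by rewrite big_split /= -e1 /eps; ring.
apply: le_trans (ler_normcB _ _) _.
rewrite mulrDr mulr1 -addrA lerD2l addrC.
apply: le_trans (normc_pairing_le b (v + h) t0) _; rewrite lerD2l.
have -> : normc eps * (3 / (4 * t * eta)) = (4 * t)^-1 * (3 * normc eps / eta).
  by field; rewrite !gt_eqF.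
by rewrite ler_wpM2l// invr_ge0; lra.
Qed.
End Fixed.

(** An a priori bound, which settles the degenerate case of zero variance. *)
Lemma nonpositive_pair_norm n a0 b C beta (v : 'cV[R[i]]_n) (t : R) : 0 < t ->
  nonpositive_pair a0 b C beta v ->
  normc beta <= `|a0| + t * \sum_i b i 0 ^+ 2 + (4 * t)^-1.
Proof.
move=> t0 [I1 n1 <- _].
apply: le_trans (ler_normcB _ _) _; rewrite cnormN cnormR -addrA lerD2l.
apply: le_trans (normc_pairing_le b v t0) _; rewrite lerD2l -[leRHS]mulr1.
by rewrite ler_wpM2l// invr_ge0; lra.
Qed.
End NonpositiveType.

Section EigenvectorEquation.
Variable R : realType.

Lemma mxH_entry N (i j : 'I_N.+1) :
  mxH R N i j = (if i == 0 then -1 else 1) *+ (i == j).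
Proof.
rewrite /mxH mxE.
case: splitP => i' ii; rewrite mxE; case: splitP => j' jj; rewrite !mxE.
- have -> : i = 0 by apply: val_inj; rewrite /= ii ord1.
  have -> : j = 0 by apply: val_inj; rewrite /= jj ord1.
  by rewrite !ord1 !eqxx.
- have -> : (i == j) = false by rewrite -val_eqE /= ii jj ord1.
  by [].
- have -> : (i == j) = false by rewrite -val_eqE /= ii jj [j']ord1.
  by [].
- have -> : (i == 0) = false by rewrite -val_eqE /= ii.
  have -> : (i == j) = (i' == j') by rewrite -!val_eqE /= ii jj.
  by [].
Qed.

Lemma complexifyE n (A : 'M[R]_n) i j : complexify A i j = (A i j)%:C.
Proof. exact: mxE. Qed.

Lemma mxX_entry (a : nat -> nat -> R) N (i j : 'I_N.+1) :
  mxX a N i j = (Num.sqrt N%:R)^-1 * ((if i == 0 then -1 else 1) * a i j).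
Proof.
rewrite /mxX mxE mxE (bigD1 i)//= big1 ?addr0 => [|k ki].
  by rewrite mxH_entry eqxx mulr1n mxE.
by rewrite mxH_entry [i == k]eq_sym (negPf ki) mulr0n mul0r.
Qed.

Lemma indef_formE N (x : 'cV[R[i]]_N.+1) :
  indef_form (complexify (mxH R N)) x x =
  (- normc (x 0 0) ^+ 2 + \sum_(i < N) normc (x (lift 0 i) 0) ^+ 2)%:C.
Proof.
rewrite /indef_form -mulmxA mxE big_ord_recl rmorphD rmorphN /= rmorph_sum /=.
have E j : (complexify (mxH R N) *m x) j 0 = (if j == 0 then -1 else 1) * x j 0.
  rewrite mxE (bigD1 j)//= big1 ?addr0 => [|k kj].
    by rewrite mxE mxH_entry eqxx mulr1n; case: ifP => _; rewrite ?rmorphN ?rmorph1.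
  by rewrite mxE mxH_entry [j == k]eq_sym (negPf kj) mulr0n rmorph0 mul0r.
have X j : ((x ^t*)%sesqui 0 j) = conjc (x j 0) by rewrite !mxE.
rewrite E X eqxx mulN1r mulrN mulJc; congr (_ + _).
by apply: eq_bigr => i _; rewrite E X mul1r mulJc.
Qed.

Definition border0 (a : nat -> nat -> R) N : R := (Num.sqrt N%:R)^-1 * a 0%N 0%N.
Definition border (a : nat -> nat -> R) N : 'cV[R]_N :=
  \col_i ((Num.sqrt N%:R)^-1 * a 0%N i.+1).

Lemma mxX_mul0 a N (x : 'cV[R[i]]_N.+1) :
  (complexify (mxX a N) *m x) 0 0 =
  - (border0 a N)%:C * x 0 0 - \sum_i (border a N i 0)%:C * x (lift 0 i) 0.
Proof.
rewrite mxE big_ord_recl complexifyE mxX_entry eqxx mulN1r mulrN rmorphN /=.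
congr (_ + _); rewrite -sumrN; apply: eq_bigr => i _.
by rewrite complexifyE mxX_entry eqxx mulN1r mulrN rmorphN mulNr mxE.
Qed.

Lemma mxX_mulS a N (x : 'cV[R[i]]_N.+1) i : (forall i j, a i j = a j i) ->
  (complexify (mxX a N) *m x) (lift 0 i) 0 =
  (border a N i 0)%:C * x 0 0 +
  (complexify (mxC a N) *m (\col_i x (lift 0 i) 0)) i 0.
Proof.
move=> asym; rewrite mxE big_ord_recl complexifyE mxX_entry /= mul1r.
congr (_ + _); first by rewrite mxE asym.
rewrite [RHS]mxE; apply: eq_bigr => j _.
by rewrite !complexifyE mxX_entry /= mul1r !mxE.
Qed.

Lemma mxC_tr a N : (forall i j, a i j = a j i) -> (mxC a N)^T = mxC a N :> 'M[R]_N.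
Proof. by move=> asym; apply/matrixP => i j; rewrite !mxE asym. Qed.

(** The first coordinate of an eigenvector of nonpositive type cannot vanish,
    the form being positive on the complementary hyperplane, so it can be
    normalized to 1. *)
Lemma nonpositive_typeP (a : nat -> nat -> R) N beta : (forall i j, a i j = a j i) ->
  eigenvalue_of_nonpositive_type (complexify (mxH R N)) (complexify (mxX a N)) beta <->
  exists v, nonpositive_pair (border0 a N) (border a N) (mxC a N) beta v.
Proof.
move=> asym; split.
- move=> [I0 [x [x0 Xx]]]; rewrite indef_formE.
  rewrite -(rmorph0 (real_complex R)) lecR addrC subr_le0 => nx.
  have x00 : x 0 0 != 0.
    apply: contra_neq x0 => x00; apply/matrixP => i j; rewrite ord1 mxE.
    move: nx; rewrite x00 -(rmorph0 (real_complex R)) cnormR normr0 expr0n /= => nx.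
    have s0 : \sum_(i < N) normc (x (lift 0 i) 0) ^+ 2 = 0.
      by apply/eqP; rewrite eq_le nx sumr_ge0// => ? _; exact: sqr_ge0.
    move/eqP: s0; rewrite psumr_eq0 => [/allP s0|? _]; last exact: sqr_ge0.
    case: (unliftP 0 i) => [i' ->|-> //].
    have := s0 i' (mem_index_enum _); rewrite /= sqrf_eq0 normc_eq0 => /eqP -> //.
  pose v : 'cV[R[i]]_N := (x 0 0)^-1 *: \col_i x (lift 0 i) 0.
  exists v; split => //.
  + rewrite /sqn; under eq_bigr do rewrite !mxE cnormM exprMn cnormV.
    by rewrite -mulr_sumr exprVn ler_pdivrMl ?mulr1// exprn_gt0// normc_gt0.
  + have := congr1 (fun A : 'cV_N.+1 => A 0 0) Xx; rewrite mxX_mul0 mxE => e.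
    apply: (mulIf x00); rewrite -e mulrBl; congr (_ - _).
    rewrite mulr_suml; apply: eq_bigr => i _; rewrite !mxE -mulrA; congr (_ * _).
    by rewrite mulrC mulrA divff// mul1r.
  + apply/matrixP => i j; rewrite ord1.
    have := congr1 (fun A : 'cV_N.+1 => A (lift 0 i) 0) Xx; rewrite mxX_mulS// [RHS]mxE => e.
    rewrite /v -scalemxAr mxE; apply: (mulfI x00); rewrite mulrA divff// mul1r.
    have {e} -> : (complexify (mxC a N) *m (\col_i x (lift 0 i) 0)) i 0 =
       beta * x (lift 0 i) 0 - (border a N i 0)%:C * x 0 0 by rewrite -e; ring.
    by rewrite !mxE; move: (_%:C) => q; field.
- move=> [v [I0 nv e1 e2]]; split => //.
  pose x : 'cV[R[i]]_N.+1 := \col_i (if unlift 0 i is Some j then v j 0 else 1).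
  have x0 : x 0 0 = 1 by rewrite mxE unlift_none.
  have xS i : x (lift 0 i) 0 = v i 0 by rewrite mxE liftK.
  exists x; split.
  + apply/eqP => /(congr1 (fun A : 'cV_N.+1 => A 0 0)); rewrite x0 mxE => /eqP.
    by rewrite oner_eq0.
  + apply/matrixP => i j; rewrite ord1 [RHS]mxE; case: (unliftP 0 i) => [i' ->|->].
      rewrite mxX_mulS// x0 mulr1 xS.
      have -> : \col_i x (lift 0 i) 0 = v by apply/matrixP => k l; rewrite ord1 !mxE liftK.
      by rewrite e2 !mxE; ring.
    by rewrite mxX_mul0 x0 !mulr1 -e1; congr (_ - _); apply: eq_bigr => k _; rewrite xS.
  + rewrite indef_formE -(rmorph0 (real_complex R)) lecR addrC x0.
    rewrite -(rmorph1 (real_complex R)) cnormR normr1 expr1n subr_le0.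
    by apply: le_trans nv; apply: ler_sum => i _; rewrite xS.
Qed.
End EigenvectorEquation.

(** * Measurability *)

Section CompactProjection.
Context (d : measure_display) (T : measurableType d) (R : realType).

(** The existential quantifier over the compact cube is replaced by one over
    its rational points: a continuous nonnegative function vanishes somewhere on
    the cube iff its values at these points are arbitrarily small. *)
Lemma measurable_exists_zero (m : nat) (f : T -> 'rV[R]_m -> R) (B : R) :
  0 < B -> (forall q, measurable_fun setT (f^~ q)) ->
  (forall w, continuous (f w)) -> (forall w q, 0 <= f w q) ->
  measurable [set w | exists q : 'rV[R]_m, (forall i, `|q 0 i| <= B) /\ f w q = 0].
Proof.
move=> B0 mf cf f0.
(* Rational points are clipped to the cube, whose bound may be irrational. *)
pose clip (t : R) := Num.max (- B) (Num.min t B).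
have clipB t : `|clip t| <= B.
  rewrite ler_norml /clip le_max lexx /= ge_max ge_min lexx orbT andbT.
  by lra.
have clip_close t u e : `|t| <= B -> `|t - u| < e -> `|t - clip u| < e.
  rewrite !ler_norml !ltr_norml /clip => /andP[t1 t2] /andP[u1 u2].
  case: (leP u B) => h1; first case: (leP (- B) u) => h2;
    last (case: (leP (- B) B) => h3);
    by apply/andP; split; lra.
pose u (r : 'rV[rat]_m) : 'rV[R]_m := \row_i clip (ratr (r 0 i)).
rewrite [X in measurable X](_ : _ =
  \bigcap_(k in [set: nat]) \bigcup_(r in [set: 'rV[rat]_m]) [set w | f w (u r) < k.+1%:R^-1]).
  apply: bigcapT_measurable => k; apply: countable_bigcupT_measurable.
    exact: countableP.
  move=> r; rewrite -[X in measurable X]setTI.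
  exact: (measurable_fun_ltr (mf (u r)) (measurable_cst _)) measurableT _ _.
apply/seteqP; split=> w.
- move=> [q [qB fq]] k _.
  have /(cf w q)/nbhs_ballP[e /= e0 he] : nbhs (f w q) [set y | y < k.+1%:R^-1].
    apply: (open_nbhs_nbhs); split; last by rewrite /= fq invr_gt0.
    exact: open_lt.
  have ex i : exists r : rat, `|q 0 i - ratr r| < e.
    have := @rat_in_itvoo R (q 0 i - e) (q 0 i + e).
    case; first by lra.
    move=> r; rewrite in_itv /= => /andP[r1 r2]; exists r.
    by rewrite ltr_norml; apply/andP; split; lra.
  have [r hr] := choice ex.
  exists (\row_i r i) => //=; apply: he; split=> // i j.
  by rewrite ord1 !mxE; apply: clip_close.
- move=> h; apply: contrapT => nex.
  (* Otherwise the minimum over the compact cube is positive. *)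
  pose K := [set q : 'rV[R]_m | forall i, `[- B, B]%classic (q 0 i)].
  have KE q : K q <-> forall i, `|q 0 i| <= B.
    by split=> hq i; have := hq i; rewrite /= ?in_itv /= ler_norml.
  have cK : compact K.
    exact: (@rV_compact _ m (fun=> `[- B, B]%classic) (fun=> @segment_compact _ _ _)).
  have K0 : K !=set0.
    by exists (u 0); apply/KE => i; rewrite mxE.
  have [c] := compact_EVT_min K0 cK (continuous_subspaceT (cf w)).
  rewrite inE => Kc fmin.
  have fc : 0 < f w c.
    rewrite lt_neqAle f0 andbT; apply/negP => /eqP fc0.
    by apply: nex; exists c; split; [exact/KE|].
  have [k hk] := ltr_add_invr fc.
  have [r _ /= hr] := h k I.
  have : f w c <= f w (u r).
    by apply: fmin; rewrite inE; apply/KE => i; rewrite mxE.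
  by rewrite leNgt => /negP; apply; apply: lt_trans hr _; move: hk; rewrite add0r.
Qed.
End CompactProjection.

Section ComplexMeasurable.
Context (d : measure_display) (T : measurableType d) (R : realType).
Implicit Types f g : T -> R[i].

Definition cmeasurable f :=
  measurable_fun setT (fun w => Re (f w)) /\ measurable_fun setT (fun w => Im (f w)).

Lemma cmeasurable_ext f g : f =1 g -> cmeasurable f -> cmeasurable g.
Proof. by move=> /funext ->. Qed.

Lemma cmeasurable_cst c : cmeasurable (cst c).
Proof. by split; exact: measurable_cst. Qed.

Lemma cmeasurable_real (f : T -> R) : measurable_fun setT f ->
  cmeasurable (fun w => (f w)%:C).
Proof. by move=> mf; split => //=; exact: measurable_cst. Qed.

Lemma cmeasurableD f g : cmeasurable f -> cmeasurable g ->
  cmeasurable (fun w => f w + g w).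
Proof.
move=> [f1 f2] [g1 g2]; split.
  by under eq_fun do rewrite cReD; exact: measurable_funD.
by under eq_fun do rewrite cImD; exact: measurable_funD.
Qed.

Lemma cmeasurableN f : cmeasurable f -> cmeasurable (fun w => - f w).
Proof.
move=> [f1 f2]; split.
  under eq_fun do rewrite cReN; exact: measurableT_comp f1.
under eq_fun do rewrite cImN; exact: measurableT_comp f2.
Qed.

Lemma cmeasurableB f g : cmeasurable f -> cmeasurable g ->
  cmeasurable (fun w => f w - g w).
Proof. by move=> mf mg; apply: cmeasurableD => //; exact: cmeasurableN. Qed.

Lemma cmeasurableM f g : cmeasurable f -> cmeasurable g ->
  cmeasurable (fun w => f w * g w).
Proof.
move=> [f1 f2] [g1 g2]; split.
  by under eq_fun do rewrite cReM; apply: measurable_funB; exact: measurable_funM.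
by under eq_fun do rewrite cImM; apply: measurable_funD; exact: measurable_funM.
Qed.

Lemma cmeasurable_sum I (r : seq I) (Q : pred I) (F : I -> T -> R[i]) :
  (forall i, cmeasurable (F i)) -> cmeasurable (fun w => \sum_(i <- r | Q i) F i w).
Proof.
move=> mF; elim: r => [|i r IH].
  by apply: cmeasurable_ext (cmeasurable_cst 0) => w; rewrite big_nil.
under eq_fun do rewrite big_cons; case: (Q i) => //; exact: cmeasurableD.
Qed.

Lemma cmeasurable_prod I (r : seq I) (Q : pred I) (F : I -> T -> R[i]) :
  (forall i, cmeasurable (F i)) -> cmeasurable (fun w => \prod_(i <- r | Q i) F i w).
Proof.
move=> mF; elim: r => [|i r IH].
  by apply: cmeasurable_ext (cmeasurable_cst 1) => w; rewrite big_nil.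
under eq_fun do rewrite big_cons; case: (Q i) => //; exact: cmeasurableM.
Qed.

Lemma measurable_normc f : cmeasurable f -> measurable_fun setT (fun w => normc (f w)).
Proof.
move=> [f1 f2]; under eq_fun do rewrite cnormE.
apply: measurableT_comp.
  by apply: continuous_measurable_fun; exact: sqrt_continuous.
by apply: measurable_funD; exact: measurable_funX.
Qed.

Lemma cmeasurableV f : cmeasurable f -> cmeasurable (fun w => (f w)^-1).
Proof.
move=> [f1 f2].
have mn : measurable_fun setT (fun w => (Re (f w) ^+ 2 + Im (f w) ^+ 2)^-1).
  under eq_fun do rewrite -powR_inv1 ?addr_ge0 ?sqr_ge0//.
  have m2 : measurable_fun setT (fun w => Re (f w) ^+ 2 + Im (f w) ^+ 2).
    by apply: measurable_funD; exact: measurable_funX.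
  exact: (measurableT_comp (@measurable_powR R (-1)) m2).
split.
  have -> : (fun w => Re (f w)^-1) =
      (fun w => Re (f w) * (Re (f w) ^+ 2 + Im (f w) ^+ 2)^-1).
    by apply/funext => w; case: (f w).
  exact: measurable_funM.
have -> : (fun w => Im (f w)^-1) =
    (fun w => - (Im (f w)) * (Re (f w) ^+ 2 + Im (f w) ^+ 2)^-1).
  by apply/funext => w; case: (f w) => p q /=; rewrite mulNr.
by apply: measurable_funM => //; exact: measurableT_comp f2.
Qed.

Lemma cmeasurable_det n (A : T -> 'M[R[i]]_n) :
  (forall i j, cmeasurable (fun w => A w i j)) -> cmeasurable (fun w => \det (A w)).
Proof.
move=> mA; rewrite /determinant; apply: cmeasurable_sum => s.
by apply: cmeasurableM; [exact: cmeasurable_cst|exact: cmeasurable_prod].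
Qed.

Lemma cmeasurable_invmx n (A : T -> 'M[R[i]]_n) : (forall w, A w \in unitmx) ->
  (forall i j, cmeasurable (fun w => A w i j)) ->
  forall i j, cmeasurable (fun w => invmx (A w) i j).
Proof.
move=> uA mA i j.
apply: (@cmeasurable_ext (fun w => (\det (A w))^-1 * ((-1) ^+ (j + i) * \det (row' j (col' i (A w)))))).
  by move=> w; rewrite /invmx uA !mxE.
apply: cmeasurableM; first exact/cmeasurableV/cmeasurable_det.
apply: cmeasurableM; first exact: cmeasurable_cst.
by apply: cmeasurable_det => k l; under eq_fun do rewrite !mxE; exact: mA.
Qed.

Lemma cmeasurable_resolvent n (M : T -> 'M[R]_n) (eta : R) : 0 < eta ->
  (forall w, (M w)^T = M w) -> (forall i j, measurable_fun setT (fun w => M w i j)) ->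
  forall i j, cmeasurable (fun w => resolvent (M w) (0 +i* eta) i j).
Proof.
move=> eta0 Ms mM; apply: cmeasurable_invmx => [w|i j].
  by apply: shifted_unit => //=; rewrite gt_eqF.
under eq_fun do rewrite !mxE.
by apply: cmeasurableB; [exact: cmeasurable_real|exact: cmeasurable_cst].
Qed.

Lemma measurable_det n (A : T -> 'M[R]_n) :
  (forall i j, measurable_fun setT (fun w => A w i j)) ->
  measurable_fun setT (fun w => \det (A w)).
Proof.
move=> mA; rewrite /determinant; apply: measurable_sum => s.
apply: measurable_funM; first exact: measurable_cst.
by apply: measurable_prod => i _.
Qed.
End ComplexMeasurable.

Section ComplexContinuous.
Context (E : topologicalType) (R : realType).
Implicit Types f g : E -> R[i].

Definition ccontinuous f := continuous (fun q => Re (f q)) /\ continuous (fun q => Im (f q)).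

Lemma ccontinuous_cst c : ccontinuous (fun=> c).
Proof. by split=> q; exact: cvg_cst. Qed.

Lemma ccontinuousD f g : ccontinuous f -> ccontinuous g ->
  ccontinuous (fun q => f q + g q).
Proof.
move=> [f1 f2] [g1 g2]; split=> q.
  under eq_fun do rewrite cReD; exact: cvgD (f1 q) (g1 q).
under eq_fun do rewrite cImD; exact: cvgD (f2 q) (g2 q).
Qed.

Lemma ccontinuousN f : ccontinuous f -> ccontinuous (fun q => - f q).
Proof.
move=> [f1 f2]; split=> q.
  under eq_fun do rewrite cReN; exact: cvgN (f1 q).
under eq_fun do rewrite cImN; exact: cvgN (f2 q).
Qed.

Lemma ccontinuousM f g : ccontinuous f -> ccontinuous g ->
  ccontinuous (fun q => f q * g q).
Proof.
move=> [f1 f2] [g1 g2]; split=> q.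
  under eq_fun do rewrite cReM.
  exact: cvgB (cvgM (f1 q) (g1 q)) (cvgM (f2 q) (g2 q)).
under eq_fun do rewrite cImM.
exact: cvgD (cvgM (f1 q) (g2 q)) (cvgM (f2 q) (g1 q)).
Qed.

Lemma continuous_addf (f g : E -> R) : continuous f -> continuous g ->
  continuous (fun q => f q + g q).
Proof. by move=> cf cg q; exact: cvgD (cf q) (cg q). Qed.

Lemma continuous_oppf (f : E -> R) : continuous f -> continuous (fun q => - f q).
Proof. by move=> cf q; exact: cvgN (cf q). Qed.

Lemma continuous_cstf (c : R) : continuous (fun _ : E => c).
Proof. by move=> q; exact: cvg_cst. Qed.

Lemma continuous_sum_fun I (r : seq I) (F : I -> E -> R) :
  (forall i, continuous (F i)) -> continuous (fun q => \sum_(i <- r) F i q).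
Proof.
move=> cF; elim: r => [|i r IH] q.
  by under eq_fun do rewrite big_nil; exact: cvg_cst.
by under eq_fun do rewrite big_cons; apply: cvgD; [exact: cF|exact: IH].
Qed.

Lemma ccontinuous_sum I (r : seq I) (F : I -> E -> R[i]) :
  (forall i, ccontinuous (F i)) -> ccontinuous (fun q => \sum_(i <- r) F i q).
Proof.
move=> cF; elim: r => [|i r IH].
  have -> : (fun q => \sum_(i <- [::]) F i q) = (fun=> 0 : R[i]).
    by apply/funext => q; rewrite big_nil.
  exact: ccontinuous_cst.
have -> : (fun q => \sum_(j <- i :: r) F j q) = (fun q => F i q + \sum_(j <- r) F j q).
  by apply/funext => q; rewrite big_cons.
exact: ccontinuousD.
Qed.

Lemma continuous_normc f : ccontinuous f -> continuous (fun q => normc (f q)).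
Proof.
move=> [f1 f2] q; under eq_fun do rewrite cnormE.
apply: (@continuous_comp _ _ _ (fun q => Re (f q) ^+ 2 + Im (f q) ^+ 2) Num.sqrt).
  apply: cvgD; [exact: cvgM (f1 q) (f1 q)|exact: cvgM (f2 q) (f2 q)].
exact: sqrt_continuous.
Qed.

Lemma continuous_max0 (g : E -> R) : continuous g -> continuous (fun q => Num.max 0 (g q)).
Proof.
move=> cg q; apply: (@continuous_max _ _ (fun=> 0) g q); first exact: cvg_cst.
exact: cg.
Qed.
End ComplexContinuous.

Section BetaMeasurable.
Context (d : measure_display) (T : measurableType d) (R : realType).
Context (a : nat -> nat -> T -> R) (N : nat) (beta : T -> R[i]).
Hypothesis a_sym : forall i j, a i j = a j i.
Hypothesis ma : forall i j, measurable_fun setT (a i j).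
Hypothesis betaP : forall w, eigenvalue_of_nonpositive_type
  (complexify (mxH R N)) (complexify (mxX (fun i j => a i j w) N)) (beta w).

Let aw w i j := a i j w.
Let aw_sym w i j : aw w i j = aw w j i. Proof. by rewrite /aw a_sym. Qed.

(** [beta] is only characterized by a property, so its measurability has to be
    proved.  By uniqueness, [|beta - z| <= e] holds iff some normalized pair
    [(beta', v)] solves the eigenvector equations with [|beta' - z| <= e]; such
    pairs stay in a fixed cube, and compact projection applies. *)
Lemma measurable_nonpositive_type_dist (z : R[i]) (e : R) : 0 < e ->
  measurable [set w | e < normc (beta w - z)].
Proof.
move=> e0; pose m := (N + N + 2)%N; pose E := 'rV[R]_m.
pose bq (q : E) : R[i] := q 0 (rshift (N + N) 0) +i* q 0 (rshift (N + N) 1).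
pose vq (q : E) : 'cV[R[i]]_N :=
  \col_i (q 0 (lshift 2 (lshift N i)) +i* q 0 (lshift 2 (rshift N i))).
pose eq1 w q := - (border0 (aw w) N)%:C - \sum_i (border (aw w) N i 0)%:C * vq q i 0 - bq q.
pose eq2 w q i := \sum_j (mxC (aw w) N i j)%:C * vq q j 0 - bq q * vq q i 0
  + (border (aw w) N i 0)%:C.
pose f w q := Num.max 0 (- Im (bq q)) + Num.max 0 (sqn (vq q) - 1) + normc (eq1 w q)
  + \sum_i normc (eq2 w q i) + Num.max 0 (normc (bq q - z) - e).
have max0 (r : R) : 0 <= Num.max 0 r by rewrite le_max lexx.
have f0 w q : 0 <= f w q.
  by rewrite /f !addr_ge0 ?normc_ge0// sumr_ge0// => i _; exact: normc_ge0.
have mb0 : measurable_fun setT (fun w => border0 (aw w) N).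
  by apply: measurable_funM => //; exact: ma.
have mb i : measurable_fun setT (fun w => border (aw w) N i 0).
  by under eq_fun do rewrite mxE; apply: measurable_funM => //; exact: ma.
have mC i j : measurable_fun setT (fun w => mxC (aw w) N i j).
  by under eq_fun do rewrite !mxE; apply: measurable_funM => //; exact: ma.
have mf q : measurable_fun setT (f^~ q).
  apply: measurable_funD; last exact: measurable_cst.
  apply: measurable_funD; last first.
    apply: measurable_sum => i; apply: measurable_normc; apply: cmeasurableD; last first.
      exact: cmeasurable_real.
    apply: cmeasurableB; last exact: cmeasurable_cst.
    apply: cmeasurable_sum => j; apply: cmeasurableM; last exact: cmeasurable_cst.
    exact: cmeasurable_real.
  apply: measurable_funD; first exact: measurable_cst.
  apply: measurable_normc; apply: cmeasurableB; last exact: cmeasurable_cst.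
  apply: cmeasurableB; first exact/cmeasurableN/cmeasurable_real.
  apply: cmeasurable_sum => j; apply: cmeasurableM; last exact: cmeasurable_cst.
  exact: cmeasurable_real.
have cc (k : 'I_m) : continuous (fun q : E => q 0 k) by exact: coord_continuous.
have cb : ccontinuous bq by split; exact: cc.
have cv i : ccontinuous (fun q => vq q i 0).
  by split; under eq_fun do rewrite mxE /=; exact: cc.
have cf w : continuous (f w).
  apply: continuous_addf; last first.
    apply: continuous_max0; apply: continuous_addf; last exact: continuous_cstf.
    by apply: continuous_normc; apply: ccontinuousD => //; exact: ccontinuous_cst.
  apply: continuous_addf; last first.
    apply: continuous_sum_fun => i; apply: continuous_normc.
    apply: ccontinuousD; last exact: ccontinuous_cst.
    apply: ccontinuousD; last by apply: ccontinuousN; exact: ccontinuousM.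
    by apply: ccontinuous_sum => j; apply: ccontinuousM => //; exact: ccontinuous_cst.
  apply: continuous_addf; last first.
    apply: continuous_normc; apply: ccontinuousD; last exact: ccontinuousN.
    apply: ccontinuousD; first exact: ccontinuous_cst.
    apply: ccontinuousN; apply: ccontinuous_sum => j; apply: ccontinuousM => //.
    exact: ccontinuous_cst.
  apply: continuous_addf.
    by apply: continuous_max0; apply: continuous_oppf; exact: cc.
  apply: continuous_max0; apply: continuous_addf; last exact: continuous_cstf.
  apply: continuous_sum_fun => i q.
  have cn := continuous_normc (cv i); exact: cvgM (cn q) (cn q).
pose B := 1 + normc z + e.
have B0 : 0 < B by rewrite /B; have := normc_ge0 z; lra.
rewrite [X in measurable X](_ : _ =
  ~` [set w | exists q : E, (forall i, `|q 0 i| <= B) /\ f w q = 0]); last first.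
  apply/seteqP; split=> w /=.
  - move=> ew [q [_ fq]].
    have : [&& Num.max 0 (- Im (bq q)) == 0, Num.max 0 (sqn (vq q) - 1) == 0,
      normc (eq1 w q) == 0, \sum_i normc (eq2 w q i) == 0 &
      Num.max 0 (normc (bq q - z) - e) == 0].
      have s0 : 0 <= \sum_i normc (eq2 w q i) by rewrite sumr_ge0// => i _; exact: normc_ge0.
      have n0 := normc_ge0 (eq1 w q).
      move: fq (max0 (- Im (bq q))) (max0 (sqn (vq q) - 1)) (max0 (normc (bq q - z) - e)).
      rewrite /f => fq h1 h2 h3.
      by apply/and5P; split; apply/eqP; lra.
    move=> /and5P[/eqP h1 /eqP h2 h3 h4 /eqP h5].
    have max0_le (r : R) : Num.max 0 r = 0 -> r <= 0 by move=> <-; rewrite le_max lexx orbT.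
    have bE : beta w = bq q.
      have [v hv] := (nonpositive_typeP N (beta w) (aw_sym w)).1 (betaP w).
      apply: (nonpositive_pair_uniq (mxC_tr N (aw_sym w)) hv (v' := vq q)).
      split.
      + by have := max0_le _ h1; rewrite oppr_le0.
      + by have := max0_le _ h2; rewrite subr_le0.
      + by apply/eqP; rewrite -subr_eq0 -normc_eq0.
      + apply/matrixP => i j; rewrite ord1.
        move: h4; rewrite psumr_eq0 => [/allP h4|k _]; last exact: normc_ge0.
        have := h4 i (mem_index_enum _); rewrite /= normc_eq0 /eq2 => /eqP {}h4; apply/eqP; rewrite -subr_eq0 -h4.
        rewrite !mxE; apply/eqP.
        under eq_bigr do rewrite mxE.
        by ring.
    by have := max0_le _ h5; rewrite -bE subr_le0 leNgt ew.
  - move=> nq; rewrite ltNge; apply/negP => le_e; apply: nq.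
    have [v [I0 nv e1 e2]] := (nonpositive_typeP N (beta w) (aw_sym w)).1 (betaP w).
    pose q : E := \row_k match fintype.split k with
      | inl l => match fintype.split l with inl i => Re (v i 0) | inr i => Im (v i 0) end
      | inr l => if l == 0 then Re (beta w) else Im (beta w) end.
    have bE : bq q = beta w.
      have sr k : fintype.split (rshift (N + N) k : 'I_m) = inr k := unsplitK (inr k).
      by rewrite /bq !mxE !sr /=; case: (beta w).
    have vE : vq q = v.
      have sl k : fintype.split (lshift 2 k : 'I_m) = inl k := unsplitK (inl k).
      have sll k : fintype.split (lshift N k : 'I_(N + N)) = inl k := unsplitK (inl k).
      have slr k : fintype.split (rshift N k : 'I_(N + N)) = inr k := unsplitK (inr k).
      apply/matrixP => i j; rewrite ord1 !mxE !sl sll slr.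
      by case: (v i 0).
    exists q; split.
    + move=> k; rewrite mxE.
      have vB i : normc (v i 0) <= B.
        have : normc (v i 0) ^+ 2 <= 1.
          apply: le_trans nv; rewrite /sqn (bigD1 i)//= lerDl sumr_ge0// => ? _.
          exact: sqr_ge0.
        rewrite -{1}(expr1n _ 2) ler_sqr ?nnegrE ?normc_ge0// => /le_trans; apply.
        by rewrite /B; have := normc_ge0 z; lra.
      have bB : normc (beta w) <= B.
        have -> : beta w = (beta w - z) + z by ring.
        by apply: le_trans (ler_normcD _ _) _; rewrite /B; lra.
      case: (fintype.split k) => l.
        case: (fintype.split l) => i.
          exact: le_trans (ler_Re_normc _) _.
        exact: le_trans (ler_Im_normc _) _.
      case: ifP => _.
        exact: le_trans (ler_Re_normc _) _.
      exact: le_trans (ler_Im_normc _) _.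
    + have max0E (r : R) : r <= 0 -> Num.max 0 r = 0 by move=> r0; apply/max_idPl.
      rewrite /f bE vE !max0E ?subr_le0 ?oppr_le0//.
      have -> : eq1 w q = 0 by rewrite /eq1 bE vE e1 subrr.
      have n0 : normc (0 : R[i]) = 0 by apply/eqP; rewrite normc_eq0.
      rewrite n0 big1 ?addr0// => i _.
      suff -> : eq2 w q i = 0 by [].
      have := congr1 (fun A : 'cV[R[i]]_N => A i 0) e2; rewrite !mxE /eq2 bE vE.
      under eq_bigr do rewrite complexifyE.
      by move=> ->; rewrite mxE; ring.
apply: measurableC.
exact: measurable_exists_zero B0 mf cf f0.
Qed.
End BetaMeasurable.

(** * Quadratic forms with a random matrix *)

Section NatIndex.
Variables (V : zmodType) (n : nat).
(** Extension by zero, to match the indexing of the random variables. *)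
Definition nat_entry (A : 'M[V]_n) (i j : nat) : V :=
  if insub i is Some i' then if insub j is Some j' then A i' j' else 0 else 0.
Lemma nat_entryE (A : 'M[V]_n) (i j : 'I_n) : nat_entry A i j = A i j.
Proof. by rewrite /nat_entry !valK. Qed.
End NatIndex.

Section RandomQuadraticForm.
Context (d : measure_display) (T : measurableType d) (R : realType)
  (P : probability T R) (I : choiceType) (D : set I) (X : I -> {RV P >-> R}).
Hypothesis X_indep : mutually_independent D X.
Context (s K mu : R).
Hypothesis K0 : 0 <= K.
Hypothesis mean0 : forall i, D i -> (\int[P]_w (X i w)%:E = 0)%E.
Hypothesis var : forall i, D i -> (\int[P]_w (X i w ^+ 2)%:E = (s ^+ 2)%:E)%E.
Hypothesis trunc : forall i, D i -> (\int[P]_w (Num.min (X i w ^+ 2) K)%:E = mu%:E)%E.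

Definition deviation_bound (n : nat) (B : R) : R :=
  2 * (s ^+ 2 * B * Num.sqrt n%:R) + K * B * Num.sqrt n%:R
  + 2 * (n%:R * B * (s ^+ 2 - mu)).

(** Conditioning on the matrix: by independence it may be frozen, and the
    bound for a deterministic matrix is uniform. *)
Lemma random_quadratic_form n (p : nat -> I) (A : T -> 'M[R[i]]_n) (B : R) :
  0 <= B -> (forall j, (j < n)%N -> D (p j)) ->
  (forall i j, (i < n)%N -> (j < n)%N -> p i = p j -> i = j) ->
  (forall i j, cmeasurable ((fun w => A w i j) :
     generated_space X (D `\` [set p j | j in [set j | (j < n)%N]]) -> R[i])) ->
  (forall w i j, A w i j = A w j i) ->
  (forall w i, \sum_j normc (A w i j) ^+ 2 <= B ^+ 2) ->
  (\int[P]_w (normc (\sum_i \sum_j A w i j * (X (p i) w)%:C * (X (p j) w)%:C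
     - (s ^+ 2)%:C * \tr (A w)))%:E <= (2 * deviation_bound n B)%:E)%E.
Proof.
move=> B0 pD p_inj mA Asym AB.
set J' := [set p j | j in _] in mA; set J := D `\` J' in mA.
have JD : J `<=` D by move=> ? [].
have JD' : J' `<=` D by move=> _ [j /= jn <-]; exact: pD.
have JJ' : J `&` J' = set0 by rewrite -subset0 => ? [[_ +] ?]; exact.
have mX (i : 'I_n) : measurable_fun [set: generated_space X J'] (X (p i) : generated_space X J' -> R).
  by apply: measurable_coord; exists i => //=; exact: ltn_ord.
pose F (v w : T) : R[i] := \sum_i \sum_j A v i j * (X (p i) w)%:C * (X (p j) w)%:C
     - (s ^+ 2)%:C * \tr (A v).
pose f v w : \bar R := (normc (F v w))%:E.
have mF : cmeasurable ((fun z => F z.1 z.2) : generated_space X J * generated_space X J' -> R[i]).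
  have m1 i j : cmeasurable ((fun z => A z.1 i j) : generated_space X J * generated_space X J' -> R[i]).
    have [h1 h2] := mA i j; split.
      exact: measurableT_comp h1 measurable_fst.
    exact: measurableT_comp h2 measurable_fst.
  have m2 (i : 'I_n) : cmeasurable ((fun z => (X (p i) z.2)%:C) : generated_space X J * generated_space X J' -> R[i]).
    by apply: cmeasurable_real; exact: measurableT_comp (mX i) measurable_snd.
  apply: cmeasurableB.
    apply: cmeasurable_sum => i; apply: cmeasurable_sum => j.
    by apply: cmeasurableM => //; exact: cmeasurableM.
  by apply: cmeasurableM; [exact: cmeasurable_cst|exact: cmeasurable_sum].
have mf : measurable_fun [set: generated_space X J * generated_space X J'] (fun z => f z.1 z.2).
  by apply/measurable_EFinP; exact: measurable_normc.
have f0 v w : (0 <= f v w)%E by rewrite lee_fin normc_ge0.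
have XT i : measurable_fun setT (X i : T -> R) by exact: (measurable_funP (X i)).
have -> : (\int[P]_w f w w = \int[P]_v \int[P]_w f v w)%E.
  exact: (integral_decouple X_indep JD JD' JJ' mf f0).
(* The real bound applies to the real and imaginary parts of the frozen matrix
   separately; [g] stands for either of them. *)
have part v (g : R[i] -> R) (gm : {morph g : x y / x + y}) (g0 : g 0 = 0)
    (gN : {morph g : x / - x}) (gR : forall z (r : R), g (z * r%:C) = g z * r)
    (gle : forall z, g z ^+ 2 <= normc z ^+ 2) :
    (\int[P]_w `|g (F v w)|%:E <= (deviation_bound n B)%:E)%E.
  have gF w : g (F v w) = \sum_(i < n) \sum_(j < n)
      g (nat_entry (A v) i j) * X (p i) w * X (p j) w
      - s ^+ 2 * \sum_(i < n) g (nat_entry (A v) i i).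
    rewrite /F gm gN (big_morph _ gm g0); congr (_ - _).
      apply: eq_bigr => i _; rewrite (big_morph _ gm g0); apply: eq_bigr => j _.
      by rewrite !gR nat_entryE.
    rewrite mulrC gR mulrC /mxtrace (big_morph _ gm g0); congr (_ * _).
    by apply: eq_bigr => i _; rewrite nat_entryE.
  under eq_integral do rewrite gF.
  apply: (quadratic_form_concentration X_indep pD p_inj K0 _ _ _
    (a := fun i j => g (nat_entry (A v) i j))) => //.
  - by move=> j jn; exact/mean0/pD.
  - by move=> j jn; exact/var/pD.
  - by move=> j jn; exact/trunc/pD.
  - move=> i j ilt jlt.
    by rewrite (nat_entryE _ (Ordinal ilt) (Ordinal jlt)) (nat_entryE _ (Ordinal jlt) (Ordinal ilt)) Asym.
  - move=> i ilt; apply: le_trans (AB v (Ordinal ilt)); apply: ler_sum => j _.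
    by rewrite (nat_entryE _ (Ordinal ilt) j).
have inner v : (\int[P]_w f v w <= (2 * deviation_bound n B)%:E)%E.
  have mFv : cmeasurable (F v).
    have [h1 h2] := mF; split.
      have := measurableT_comp h1 (@measurable_pair1 _ _ (generated_space X J) (generated_space X J') v).
      exact: generated_forget.
    have := measurableT_comp h2 (@measurable_pair1 _ _ (generated_space X J) (generated_space X J') v).
    exact: generated_forget.
  have [h1 h2] := mFv.
  apply: (@le_trans _ _ (\int[P]_w (`|Re (F v w)|%:E + `|Im (F v w)|%:E))%E).
    apply: ge0_le_integral => //.
    - by apply/measurable_EFinP; exact: measurable_normc.
    - by apply: emeasurable_funD; apply/measurable_EFinP; exact: measurableT_comp.
    - by move=> w _; rewrite -EFinD lee_fin; exact: ler_normc_ReIm.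
  rewrite ge0_integralD//; last 2 first.
  - by apply/measurable_EFinP; exact: measurableT_comp.
  - by apply/measurable_EFinP; exact: measurableT_comp.
  rewrite mulr_natl mulr2n EFinD; apply: leeD.
    apply: (part v (@complex.Re R)) => //; [exact: cReD|exact: cReN|..].
      by move=> z r; rewrite cReM /= mulr0 subr0.
    by move=> z; rewrite sqr_cnorm lerDl sqr_ge0.
  apply: (part v (@complex.Im R)) => //; [exact: cImD|exact: cImN|..].
    by move=> z r; rewrite cImM /= mulr0 add0r.
  by move=> z; rewrite sqr_cnorm lerDr sqr_ge0.
rewrite -[leRHS](integral_prob_cst P).
apply: ge0_le_integral => //.
- by move=> v _; apply: integral_ge0 => w _.
- have mF' : cmeasurable (fun z : T * T => F z.1 z.2).
    have m1 i j : cmeasurable (fun z : T * T => A z.1 i j).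
      have [h1 h2] := mA i j; split.
        exact: measurableT_comp (generated_forget h1) measurable_fst.
      exact: measurableT_comp (generated_forget h2) measurable_fst.
    have m2 (i : 'I_n) : cmeasurable (fun z : T * T => (X (p i) z.2)%:C).
      by apply: cmeasurable_real; exact: measurableT_comp (XT _) measurable_snd.
    apply: cmeasurableB.
      apply: cmeasurable_sum => i; apply: cmeasurable_sum => j.
      by apply: cmeasurableM => //; exact: cmeasurableM.
    by apply: cmeasurableM; [exact: cmeasurable_cst|exact: cmeasurable_sum].
  have := measurable_fun_fubini_tonelli_F (m2 := P) (fun z : T * T => f z.1 z.2).
  apply=> [|z]; last exact: f0.
  by apply/measurable_EFinP; exact: measurable_normc.
Qed.
End RandomQuadraticForm.

(** * Means and moments of the entries *)

Section MeanBound.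
Context (d : measure_display) (T : measurableType d) (R : realType)
  (P : probability T R).

Implicit Types f g : T -> R.

(** The side conditions of the additivity and monotonicity of the integral are
    bundled with the bound, so that bounds can be combined mechanically. *)
Definition mean_le (f : T -> R) (c : R) : Prop :=
  [/\ measurable_fun setT f, forall w, 0 <= f w & (\int[P]_w (f w)%:E <= c%:E)%E].

Lemma mean_leD f g a b : mean_le f a -> mean_le g b ->
  mean_le (fun w => f w + g w) (a + b).
Proof.
move=> [mf f0 fa] [mg g0 gb]; split; first exact: measurable_funD.
  by move=> w; rewrite addr_ge0.
under eq_integral do rewrite EFinD.
rewrite ge0_integralD; first by rewrite EFinD leeD.
- exact: measurableT.
- by move=> w _; rewrite lee_fin.
- exact/measurable_EFinP.
- by move=> w _; rewrite lee_fin.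
- exact/measurable_EFinP.
Qed.

Lemma mean_leZ c f a : 0 <= c -> mean_le f a -> mean_le (fun w => c * f w) (c * a).
Proof.
move=> c0 [mf f0 fa]; split; first exact: measurable_funM.
  by move=> w; rewrite mulr_ge0.
under eq_integral do rewrite EFinM.
rewrite ge0_integralZl//; last 2 first.
- exact/measurable_EFinP.
- by move=> w _; rewrite lee_fin.
by rewrite EFinM lee_wpmul2l ?lee_fin.
Qed.

Lemma mean_le_cst c : 0 <= c -> mean_le (cst c) c.
Proof. by move=> c0; split => //; rewrite integral_prob_cst. Qed.

Lemma mean_le_sum n (F : 'I_n -> T -> R) a : (forall i, mean_le (F i) a) ->
  mean_le (fun w => \sum_i F i w) (n%:R * a).
Proof.
elim: n F => [F _|n IH F hF].
  rewrite mul0r; have -> : (fun w => \sum_(i < 0) F i w) = cst 0.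
    by apply/funext => w; rewrite big_ord0.
  exact: mean_le_cst.
have -> : (fun w => \sum_i F i w) = (fun w => \sum_i F (widen_ord (leqnSn n) i) w + F ord_max w).
  by apply/funext => w; rewrite big_ord_recr.
rewrite -natr1 mulrDl mul1r; apply: mean_leD; last exact: hF.
exact: (IH (fun i => F (widen_ord (leqnSn n) i)) (fun i => hF _)).
Qed.

Lemma mean_le_mono f g a : measurable_fun setT f -> (forall w, 0 <= f w) ->
  (forall w, f w <= g w) -> mean_le g a -> mean_le f a.
Proof.
move=> mf f0 fg [mg g0 ga]; split=> //; apply: le_trans ga.
apply: ge0_le_integral; [exact: measurableT| |exact/measurable_EFinP|exact/measurable_EFinP|];
  by move=> w _; rewrite lee_fin.
Qed.

Lemma mean_le_weaken f a b : a <= b -> mean_le f a -> mean_le f b.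
Proof. by move=> ab [? ? fa]; split => //; apply: le_trans fa _; rewrite lee_fin. Qed.

Lemma mean_le_markov f a (A : set T) e : 0 < e -> mean_le f a -> measurable A ->
  (forall w, A w -> e <= f w) -> (P A <= (a / e)%:E)%E.
Proof.
move=> e0 [mf f0 fa] mA Af.
have : (e%:E * P A <= a%:E)%E.
  rewrite -integral_cst//; apply: le_trans fa.
  apply: (@le_trans _ _ (\int[P]_(w in A) (f w)%:E)%E).
    apply: ge0_le_integral; [exact: mA| |exact: measurable_cst| |].
    - by move=> w _; rewrite lee_fin ltW.
    - by apply/measurable_EFinP; exact: measurable_funTS.
    - by move=> w Aw; rewrite lee_fin Af.
  apply: ge0_subset_integral; [exact: mA|exact: measurableT| | |].
  - exact/measurable_EFinP.
  - by move=> w _; rewrite lee_fin.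
  - exact: subsetT.
have PE : P A = (fine (P A))%:E by rewrite fineK// fin_num_measure.
by rewrite PE -EFinM !lee_fin mulrC ler_pdivlMr.
Qed.
End MeanBound.

Section Moments.
Context (R : realType) (d : measure_display) (T : measurableType d)
    (P : probability T R) (s : R) (x : nat -> nat -> {RV P >-> R}).
Hypotheses (x_same : forall i j, (i <= j)%N -> same_law (x i j) (x 0%N 0%N))
    (x_mean : forall i j, (i <= j)%N -> ('E_P[x i j] = 0)%E)
    (x_var : forall i j, (i <= j)%N -> 'V_P[x i j] = (s ^+ 2)%:E).

Lemma entry_mean i j : (i <= j)%N -> (\int[P]_w (x i j w)%:E = 0)%E.
Proof. by move=> ij; rewrite -(x_mean ij) unlock. Qed.

Lemma entry_second_moment i j : (i <= j)%N ->
  (\int[P]_w (x i j w ^+ 2)%:E = (s ^+ 2)%:E)%E.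
Proof.
move=> ij; have e0 : fine 'E_P[x i j] = 0 by rewrite x_mean.
rewrite -(x_var ij) /variance covariance.unlock e0 expectation.unlock.
by apply: eq_integral => w _ /=; rewrite mulrfctE /= subr0 expr2.
Qed.

Lemma entry_law_integral i j (h : R -> R) : (i <= j)%N ->
  measurable_fun setT h -> (forall r, 0 <= h r) ->
  (\int[P]_w (h (x i j w))%:E = \int[P]_w (h (x 0%N 0%N w))%:E)%E.
Proof.
move=> ij mh h0.
have mE : measurable_fun setT (fun r => (h r)%:E) by exact/measurable_EFinP.
have hE r : (0 <= (h r)%:E)%E by rewrite lee_fin.
have e1 := ge0_integral_distribution (x i j) mE hE.
have e2 := ge0_integral_distribution (x 0%N 0%N) mE hE.
rewrite -[LHS]/(\int[P]_w ((fun r => (h r)%:E) \o x i j) w)%E -e1.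
rewrite -[RHS]/(\int[P]_w ((fun r => (h r)%:E) \o x 0%N 0%N) w)%E -e2.
apply: eq_measure_integral => A mA _; exact: (x_same ij mA).
Qed.

Definition truncated_moment (K : R) : R :=
  fine (\int[P]_w (Num.min (x 0%N 0%N w ^+ 2) K)%:E)%E.

Let mtr (K : R) : measurable_fun setT (fun r : R => Num.min (r ^+ 2) K).
Proof. by apply: measurable_minr => //; exact: measurable_funX. Qed.

Lemma truncated_momentE i j K : 0 <= K -> (i <= j)%N ->
  (\int[P]_w (Num.min (x i j w ^+ 2) K)%:E = (truncated_moment K)%:E)%E.
Proof.
move=> K0 ij; rewrite (entry_law_integral (h := fun r => Num.min (r ^+ 2) K) ij)//.
  rewrite /truncated_moment fineK// ge0_fin_numE; last first.
    by apply: integral_ge0 => w _; rewrite lee_fin le_min sqr_ge0.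
  apply: (@le_lt_trans _ _ (\int[P]_w K%:E)%E); last by rewrite integral_prob_cst ltry.
  apply: ge0_le_integral => //.
  - by move=> w _; rewrite lee_fin le_min sqr_ge0.
  - by apply/measurable_EFinP; exact: measurableT_comp (mtr K) (measurable_funPT _).
  - by move=> w _; rewrite lee_fin ge_min lexx orbT.
by move=> r; rewrite le_min sqr_ge0.
Qed.

(** Monotone convergence; this is where a finite second moment suffices. *)
Lemma truncated_moment_cvg e : 0 < e -> exists2 K : R, 0 <= K & s ^+ 2 - truncated_moment K <= e.
Proof.
move=> e0.
pose g (n : nat) (w : T) : \bar R := (Num.min (x 0%N 0%N w ^+ 2) n%:R)%:E.
have mx : measurable_fun setT (x 0%N 0%N : T -> R) by exact: measurable_funPT.
have mg n : measurable_fun setT (g n).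
  by apply/measurable_EFinP; exact: measurableT_comp (mtr _) mx.
have g0 n w : setT w -> (0 <= g n w)%E by move=> _; rewrite lee_fin le_min sqr_ge0 ler0n.
have gnd w : setT w -> nondecreasing_seq (g^~ w).
  move=> _ n m nm; rewrite lee_fin le_min ge_min lexx /= ge_min; apply/orP; right.
  by rewrite ler_nat.
have := cvg_monotone_convergence measurableT mg g0 gnd => /(_ P).
have -> : (\int[P]_w (limn (g^~ w)) = (s ^+ 2)%:E)%E.
  rewrite -(entry_second_moment (leqnn 0)); apply: eq_integral => w _.
  apply/cvg_lim => //; apply: (@cvg_near_cst _ _ _ _ _ _) => //.
  near=> n; rewrite /g; congr (_%:E); apply/min_idPl.
  near: n; exact: nbhs_infty_ger.
have gE n : (\int[P]_w g n w = (truncated_moment n%:R)%:E)%E.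
  by apply: truncated_momentE.
under eq_fun do rewrite gE.
move=> /fine_cvgP[_] /cvgrPdist_le /(_ e e0)[n _ /(_ n (leqnn n))] /= h.
by exists n%:R => //; apply: le_trans h; exact: ler_norm.
Unshelve. all: by end_near. Qed.

Lemma entry_abs_mean i j : 0 <= s -> (i <= j)%N -> mean_le P (fun w => `|x i j w|) s.
Proof.
move=> s0 ij; split => //.
  by apply: measurableT_comp => //; exact: measurable_funPT.
by apply: integral_norm_le => //; rewrite entry_second_moment.
Qed.

Lemma entry_sqr_mean i j : (i <= j)%N -> mean_le P (fun w => x i j w ^+ 2) (s ^+ 2).
Proof.
move=> ij; split => [|w|].
- by apply: measurable_funX; exact: measurable_funPT.
- exact: sqr_ge0.
- by rewrite entry_second_moment.
Qed.
End Moments.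

(** * The defect of the approximate eigenvector *)

Section DefectMean.
Context (R : realType) (d : measure_display) (T : measurableType d)
    (P : probability T R) (s : R) (x : nat -> nat -> {RV P >-> R}).
Hypotheses (s_ge0 : 0 <= s)
    (x_sym : forall i j, (i < j)%N -> x j i = x i j)
    (x_indep : mutually_independent [set p : nat * nat | (p.1 <= p.2)%N]
                 (fun p => x p.1 p.2))
    (x_same : forall i j, (i <= j)%N -> same_law (x i j) (x 0%N 0%N))
    (x_mean : forall i j, (i <= j)%N -> ('E_P[x i j] = 0)%E)
    (x_var : forall i j, (i <= j)%N -> 'V_P[x i j] = (s ^+ 2)%:E).

Definition entries (w : T) (i j : nat) : R := x i j w.

Lemma entries_symmetric w i j : entries w i j = entries w j i.
Proof. by rewrite /entries; case: (ltngtP i j) => [/x_sym ->|/x_sym ->|->]. Qed.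

Let X (p : nat * nat) := x p.1 p.2.
Let D := [set p : nat * nat | (p.1 <= p.2)%N].

Let XE i j w : X (minn i j, maxn i j) w = x i j w.
Proof. by rewrite /X /=; case: (leqP i j) => // ji; rewrite -(x_sym ji). Qed.

Let DE i j : D (minn i j, maxn i j).
Proof. by rewrite /D /=; lia. Qed.

Lemma measurable_entry i j : measurable_fun setT (x i j : T -> R).
Proof. exact: measurable_funPT. Qed.

Lemma measurable_entry_generated J i j : J (minn i j, maxn i j) ->
  measurable_fun [set: generated_space X J] (x i j : generated_space X J -> R).
Proof.
move=> Jij; have := @measurable_coord _ _ _ P _ X J _ Jij.
by apply: eq_measurable_fun => w _; rewrite XE.
Qed.

Context (N : nat) (eta K : R).
Hypotheses (N0 : (0 < N)%N) (eta0 : 0 < eta) (K0 : 0 <= K).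
Hypothesis s_eta : s ^+ 2 = 2 * eta ^+ 2.
Let z : R[i] := 0 +i* eta.
Let k0 : R := (Num.sqrt N%:R)^-1.
Let bound := N%:R^-1 * (2 * deviation_bound s K (truncated_moment x K) N eta^-1).

Let NR : 0 < N%:R :> R. Proof. by rewrite ltr0n. Qed.
Let k02 : k0 ^+ 2 = N%:R^-1.
Proof. by rewrite /k0 exprVn sqr_sqrtr// ltW. Qed.

Let C w := mxC (entries w) N.
Let Cs w : (C w)^T = C w. Proof. exact/mxC_tr/entries_symmetric. Qed.

(** The resolvent of a matrix that does not involve the variables of the
    quadratic form: its rows have square norm at most [eta^-2] by the Ward
    identity, so [random_quadratic_form] applies; the factor [k0 ^+ 2] of the
    normalized entries turns the trace into the normalized trace. *)
Let form_mean (p : nat -> nat * nat) (M : T -> 'M[R]_N) :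
  (forall j, D (p j)) -> injective p ->
  (forall i j, measurable_fun [set: generated_space X (D `\` [set p j | j in [set j | (j < N)%N]])]
    ((fun w => M w i j) : generated_space X (D `\` [set p j | j in [set j | (j < N)%N]]) -> R)) ->
  (forall w, (M w)^T = M w) ->
  mean_le P (fun w => normc (\sum_i \sum_j resolvent (M w) z i j
      * (k0 * X (p i) w)%:C * (k0 * X (p j) w)%:C
      - (s ^+ 2 / N%:R)%:C * \tr (resolvent (M w) z))) bound.
Proof.
move=> pD p_inj mM Ms.
pose A w := resolvent (M w) z.
set J := D `\` _ in mM.
have mA i j : cmeasurable ((fun w => A w i j) : generated_space X J -> R[i]).
  by apply: cmeasurable_resolvent.
have mA' i j : cmeasurable (fun w : T => A w i j).
  by have [h1 h2] := mA i j; split; [exact: (generated_forget h1)|exact: (generated_forget h2)].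
have mx i : measurable_fun setT (X (p i) : T -> R) by exact: measurable_entry.
have -> : (fun w => normc (\sum_i \sum_j resolvent (M w) z i j
      * (k0 * X (p i) w)%:C * (k0 * X (p j) w)%:C
      - (s ^+ 2 / N%:R)%:C * \tr (resolvent (M w) z))) =
  (fun w => N%:R^-1 * normc (\sum_i \sum_j A w i j * (X (p i) w)%:C * (X (p j) w)%:C
     - (s ^+ 2)%:C * \tr (A w))).
  apply/funext => w; rewrite -[N%:R^-1 in RHS]ger0_norm ?invr_ge0 ?(ltW NR)//.
  rewrite -cnormR -cnormM; congr (normc _).
  rewrite [s ^+ 2 / _]mulrC rmorphM -mulrA mulrBr; congr (_ - _).
  rewrite mulr_sumr; apply: eq_bigr => i _; rewrite mulr_sumr; apply: eq_bigr => j _.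
  by rewrite -k02 expr2 !rmorphM /A -/z; ring.
apply: mean_leZ; first by rewrite invr_ge0 ltW.
split.
- apply: measurable_normc; apply: cmeasurableB.
    apply: cmeasurable_sum => i; apply: cmeasurable_sum => j.
    by apply: cmeasurableM; [apply: cmeasurableM => //|]; exact: cmeasurable_real.
  by apply: cmeasurableM; [exact: cmeasurable_cst|exact: cmeasurable_sum].
- by move=> w; exact: normc_ge0.
- apply: (random_quadratic_form (D := D) x_indep (s := s) K0) => //.
  + by move=> i Di; exact: entry_mean.
  + by move=> i Di; exact: entry_second_moment.
  + by move=> i Di; exact: truncated_momentE.
  + by rewrite invr_ge0 ltW.
  + by move=> i j _ _ /p_inj.
  + by move=> w i j; exact: resolvent_sym.
  + by move=> w i; exact: resolvent_row_le.
Qed.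

(* Column [k] of the symmetric matrix is read off from the independent variables
   with increasing indices, and they do not occur in the decoupled matrix. *)
Let column_mean (k : 'I_N) :
  mean_le P (fun w => normc (column_deviation (C w) eta s k)) bound.
Proof.
pose p (j : nat) := (minn j.+1 k.+1, maxn j.+1 k.+1).
have p_inj : injective p by move=> i j []; lia.
have := form_mean (p := p) (M := fun w => decoupled (C w) k) (fun j => DE _ _) p_inj.
have -> : (fun w => normc (\sum_i \sum_j resolvent (decoupled (C w) k) z i j
      * (k0 * X (p i) w)%:C * (k0 * X (p j) w)%:C
      - (s ^+ 2 / N%:R)%:C * \tr (resolvent (decoupled (C w) k) z))) =
  (fun w => normc (column_deviation (C w) eta s k)).
  apply/funext => w; rewrite /column_deviation; congr (normc (_ - _)).
  apply: eq_bigr => i _; apply: eq_bigr => j _.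
  by rewrite /p !XE /C /mxC !mxE.
apply=> [i j|w]; last by exact: decoupled_tr.
have -> : (fun w => decoupled (C w) k i j) =
    (fun w => if (i == k) || (j == k) then 0 else k0 * x i.+1 j.+1 w).
  by apply/funext => w; rewrite !mxE.
case: (boolP ((i == k) || (j == k))) => [_|/norP[ik jk]]; first exact: measurable_cst.
apply: measurable_funM; first exact: measurable_cst.
apply: measurable_entry_generated; split; first exact: DE.
by move=> [l /= _]; rewrite /p => -[]; move: ik jk; rewrite -!val_eqE /=; lia.
Qed.

Let border_mean : mean_le P (fun w => normc (\sum_i \sum_j resolvent (C w) z i j
      * (border (entries w) N i 0)%:C * (border (entries w) N j 0)%:C
      - (s ^+ 2 / N%:R)%:C * \tr (resolvent (C w) z))) bound.
Proof.
pose p (j : nat) := (0%N, j.+1).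
have p_inj : injective p by move=> i j [].
have := form_mean (p := p) (M := C) (fun j => leq0n _) p_inj.
have -> : (fun w => normc (\sum_i \sum_j resolvent (C w) z i j
      * (k0 * X (p i) w)%:C * (k0 * X (p j) w)%:C
      - (s ^+ 2 / N%:R)%:C * \tr (resolvent (C w) z))) =
  (fun w => normc (\sum_i \sum_j resolvent (C w) z i j
      * (border (entries w) N i 0)%:C * (border (entries w) N j 0)%:C
      - (s ^+ 2 / N%:R)%:C * \tr (resolvent (C w) z))).
  apply/funext => w; congr (normc (_ - _)).
  by apply: eq_bigr => i _; apply: eq_bigr => j _; rewrite /border !mxE.
apply=> [i j|w]; last exact: Cs.
have -> : (fun w => C w i j) = (fun w => k0 * x i.+1 j.+1 w).
  by apply/funext => w; rewrite !mxE.
apply: measurable_funM; first exact: measurable_cst.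
apply: measurable_entry_generated; split; first exact: DE.
by move=> [l /= _]; rewrite /p => -[]; lia.
Qed.

(** With [h] the pole vector, [(1, - h)] solves all the eigenvector equations of
    [X_N] at [z] but the first one, whose defect is the pole defect. *)
Definition pole_vector w : 'cV[R[i]]_N :=
  resolvent (C w) z *m cvec (border (entries w) N).

Lemma pole_vectorE w : complexify (C w) *m pole_vector w =
  z *: pole_vector w + cvec (border (entries w) N).
Proof.
apply: shifted_mul; rewrite /pole_vector mulmxA mulmx_resolvent ?mul1mx//.
Qed.

Definition pole_defect w : R[i] := - (border0 (entries w) N)%:C +
  \sum_i (border (entries w) N i 0)%:C * pole_vector w i 0 - z.

(** The three groups of terms come from the corner entry, from the quadratic form
    in the border and from the normalized trace. *)
Definition defect_rate : R :=
  k0 * s + bound + N%:R^-1 * (N%:R * (k0 * s + bound + N%:R^-1 * s ^+ 2 / eta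
    + s ^+ 2 / N%:R * (2 / eta))).

(** The quadratic form in the border is close to the normalized trace, which is
    close to the fixed point [z]. *)
Lemma pole_defect_mean : mean_le P (fun w => normc (pole_defect w)) defect_rate.
Proof.
have k00 : 0 <= k0 by rewrite invr_ge0 sqrtr_ge0.
have mC i j : measurable_fun setT (fun w => C w i j).
  by under eq_fun do rewrite !mxE; apply: measurable_funM => //; exact: measurable_entry.
have mb i : measurable_fun setT (fun w => border (entries w) N i 0).
  by under eq_fun do rewrite !mxE; apply: measurable_funM => //; exact: measurable_entry.
have mb0 : measurable_fun setT (fun w => border0 (entries w) N).
  by apply: measurable_funM => //; exact: measurable_entry.
have mG := @cmeasurable_resolvent _ _ _ N C eta eta0 Cs mC.
pose def w k := `|C w k k| + normc (column_deviation (C w) eta s k) + C w k k ^+ 2 / eta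
  + s ^+ 2 / N%:R * (2 / eta).
pose dev w := normc (\sum_i \sum_j resolvent (C w) z i j
      * (border (entries w) N i 0)%:C * (border (entries w) N j 0)%:C
      - (s ^+ 2 / N%:R)%:C * \tr (resolvent (C w) z)).
have abs_mean i j : (i <= j)%N -> mean_le P (fun w => `|k0 * x i j w|) (k0 * s).
  move=> ij; under eq_fun do rewrite normrM (ger0_norm k00).
  by apply: mean_leZ => //; exact: entry_abs_mean.
apply: (@mean_le_mono _ _ _ _ _ (fun w => `|border0 (entries w) N| + dev w
    + N%:R^-1 * \sum_k def w k)).
- apply: measurable_normc; apply: cmeasurableB; last exact: cmeasurable_cst.
  apply: cmeasurableD; first exact/cmeasurableN/cmeasurable_real.
  apply: cmeasurable_sum => i; apply: cmeasurableM; first exact: cmeasurable_real.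
  under eq_fun do rewrite mxE; apply: cmeasurable_sum => j.
  apply: cmeasurableM; first exact: mG.
  by under eq_fun do rewrite mxE; exact: cmeasurable_real.
- by move=> w; exact: normc_ge0.
- move=> w; rewrite /pole_defect.
  set S := \sum_i _.
  have -> : S = \sum_i \sum_j resolvent (C w) z i j
      * (border (entries w) N i 0)%:C * (border (entries w) N j 0)%:C.
    apply: eq_bigr => i _; rewrite /pole_vector [X in _ * X]mxE mulr_sumr; apply: eq_bigr => j _.
    by rewrite [cvec _ _ _]mxE mulrCA mulrA.
  set S' := \sum_i _; set t := (s ^+ 2 / N%:R)%:C * \tr (resolvent (C w) z).
  have -> : - (border0 (entries w) N)%:C + S' - z =
    - (border0 (entries w) N)%:C + (S' - t) + (t - z) by ring.
  apply: le_trans (ler_normcD _ _) _; apply: lerD; last first.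
    exact: trace_near_fixed_point.
  apply: le_trans (ler_normcD _ _) _; apply: lerD => //.
  by rewrite cnormN cnormR.
- apply: mean_leD; first apply: mean_leD.
  + exact: abs_mean.
  + exact: border_mean.
  + apply: mean_leZ; first by rewrite invr_ge0 ltW.
    apply: mean_le_sum => k; apply: mean_leD; first apply: mean_leD; first apply: mean_leD.
    * have -> : (fun w => `|C w k k|) = (fun w => `|k0 * x k.+1 k.+1 w|).
        by apply/funext => w; rewrite !mxE.
      exact: abs_mean.
    * exact: column_mean.
    * have -> : (fun w => C w k k ^+ 2 / eta) = (fun w => (N%:R^-1 / eta) * x k.+1 k.+1 w ^+ 2).
        by apply/funext => w; rewrite !mxE exprMn -/k0 k02 /entries; ring.
      have -> : N%:R^-1 * s ^+ 2 / eta = N%:R^-1 / eta * s ^+ 2 by ring.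
      apply: mean_leZ; first by apply: divr_ge0; rewrite ?invr_ge0; exact: ltW.
      exact: entry_sqr_mean.
    * by apply: mean_le_cst; rewrite mulr_ge0 ?divr_ge0 ?sqr_ge0 ?(ltW NR) ?(ltW eta0).
Qed.
End DefectMean.

(** * Convergence of the eigenvalue of nonpositive type *)

Section BetaConvergence.
Context (R : realType) (d : measure_display) (T : measurableType d)
    (P : probability T R) (s : R) (x : nat -> nat -> {RV P >-> R})
    (beta : nat -> T -> R[i]).
Hypotheses (s_ge0 : 0 <= s)
    (x_sym : forall i j, (i < j)%N -> x j i = x i j)
    (x_indep : mutually_independent [set p : nat * nat | (p.1 <= p.2)%N]
                 (fun p => x p.1 p.2))
    (x_same : forall i j, (i <= j)%N -> same_law (x i j) (x 0%N 0%N))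
    (x_mean : forall i j, (i <= j)%N -> ('E_P[x i j] = 0)%E)
    (x_var : forall i j, (i <= j)%N -> 'V_P[x i j] = (s ^+ 2)%:E)
    (betaP : forall N w,
       eigenvalue_of_nonpositive_type (complexify (mxH R N))
         (complexify (mxX (fun i j => x i j w) N)) (beta N w)).

(** The truncation level [K] is fixed first, to make the tail of the second
    moment small; all other terms are then of order [N^(-1/2)]. *)
Lemma defect_rate_small (eta e : R) : 0 < eta -> 0 < e ->
  exists K : R, 0 <= K /\ exists N0 : nat, forall N, (N0 <= N)%N -> (0 < N)%N ->
  defect_rate s x N eta K <= e.
Proof.
move=> eta0 e0.
have e16 : 0 < e * eta / 16 by rewrite divr_gt0 ?mulr_gt0.
have [K K0 Ke] := truncated_moment_cvg x_same x_mean x_var e16.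
exists K; split => //.
set tau := s ^+ 2 - _ in Ke.
pose L : R := 2 * s + 8 * s ^+ 2 / eta + 4 * K / eta + 3 * s ^+ 2 / eta.
have L0 : 0 <= L.
  by rewrite /L !addr_ge0 ?mulr_ge0 ?invr_ge0 ?sqr_ge0 ?(ltW eta0).
exists (Num.bound ((2 * L / e) ^+ 2)) => N hN N0.
have NR : 0 < N%:R :> R by rewrite ltr0n.
set k := (Num.sqrt (N%:R : R))^-1.
have k2 : k ^+ 2 = N%:R^-1 by rewrite /k exprVn sqr_sqrtr// ltW.
have k0 : 0 < k by rewrite invr_gt0 sqrtr_gt0.
have k1 : k <= 1.
  rewrite invf_le1 ?sqrtr_gt0//.
  by rewrite -[leLHS]sqrtr1 ler_sqrt ?ler1n// ltW.
have sN : Num.sqrt (N%:R : R) = N%:R * k.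
  have sp : Num.sqrt (N%:R : R) != 0 by rewrite gt_eqF// sqrtr_gt0.
  rewrite /k; apply: (mulIf sp); rewrite mulfVK//.
  by rewrite -expr2 sqr_sqrtr// ltW.
have Lk : L * k <= e / 2.
  rewrite /k ler_pdivrMr ?sqrtr_gt0//.
  have : 2 * L / e <= Num.sqrt (N%:R : R).
    rewrite -[leLHS]ger0_norm; last by rewrite !mulr_ge0 ?invr_ge0// ltW.
    rewrite -sqrtr_sqr ler_sqrt ?(ltW NR)//.
    apply: (le_trans (ltW (archi_boundP (sqr_ge0 _)))).
    by rewrite ler_nat.
  by rewrite ler_pdivrMr// => h; lra.
rewrite /defect_rate /deviation_bound -/tau -/k sN.
have -> : k * s + N%:R^-1 * (2 * (2 * (s ^+ 2 * eta^-1 * (N%:R * k)) +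
    K * eta^-1 * (N%:R * k) + 2 * (N%:R * eta^-1 * tau))) +
   N%:R^-1 * (N%:R * (k * s + N%:R^-1 * (2 * (2 * (s ^+ 2 * eta^-1 * (N%:R * k)) +
    K * eta^-1 * (N%:R * k) + 2 * (N%:R * eta^-1 * tau))) +
    N%:R^-1 * s ^+ 2 / eta + s ^+ 2 / N%:R * (2 / eta))) =
   (2 * s + 8 * s ^+ 2 / eta + 4 * K / eta) * k + 8 * tau / eta
   + 3 * s ^+ 2 / eta * N%:R^-1.
  by field; rewrite !gt_eqF.
have h1 : 8 * tau / eta <= e / 2.
  by rewrite ler_pdivrMr//; lra.
have h2 : 3 * s ^+ 2 / eta * N%:R^-1 <= 3 * s ^+ 2 / eta * k.
  rewrite -k2 expr2; apply: ler_wpM2l.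
    by rewrite !mulr_ge0 ?invr_ge0 ?sqr_ge0 ?(ltW eta0).
  by rewrite -[leRHS]mulr1 ler_wpM2l// ltW.
move: Lk; rewrite /L => Lk; lra.
Qed.

Let asym i j : x i j = x j i.
Proof. by case: (ltngtP i j) => [/x_sym ->|/x_sym ->|->]. Qed.

Let aw_sym w i j : entries x w i j = entries x w j i.
Proof. exact: entries_symmetric. Qed.

Let border_sum_mean N : (0 < N)%N ->
  mean_le P (fun w => \sum_i border (entries x w) N i 0 ^+ 2) (s ^+ 2).
Proof.
move=> N0; have NR : 0 < N%:R :> R by rewrite ltr0n.
have -> : s ^+ 2 = N%:R * (N%:R^-1 * s ^+ 2) by rewrite mulrA divff ?mul1r// gt_eqF.
apply: mean_le_sum => i.
have -> : (fun w => border (entries x w) N i 0 ^+ 2) =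
    (fun w => N%:R^-1 * x 0%N i.+1 w ^+ 2).
  by apply/funext => w; rewrite mxE exprMn exprVn sqr_sqrtr// ltW.
by apply: mean_leZ; [rewrite invr_ge0 ltW|exact: entry_sqr_mean].
Qed.

Lemma measurable_beta_dist N (z : R[i]) (e : R) : 0 < e ->
  measurable [set w | e < normc (beta N w - z)].
Proof.
move=> e0; apply: (@measurable_nonpositive_type_dist _ _ _ (fun i j => x i j)) => //.
by move=> i j; rewrite asym.
Qed.

Lemma cvg_probability0 (A : nat -> set T) : (forall N, measurable (A N)) ->
  (forall e : R, 0 < e -> exists N0, forall N, (N0 <= N)%N -> (P (A N) <= e%:E)%E) ->
  (P (A N) @[N --> \oo] --> 0%:E)%E.
Proof.
move=> mA h.
have PE N : P (A N) = (fine (P (A N)))%:E by rewrite fineK// fin_num_measure.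
apply/fine_cvgP; split; first by apply: nearW => N; rewrite fin_num_measure.
apply/cvgrPdist_le => e e0; have [N0 hN0] := h e e0.
near=> N; rewrite /= sub0r normrN ger0_norm ?fine_ge0//.
rewrite -lee_fin -PE; apply: hN0; near: N; exact: nbhs_infty_ge.
Unshelve. all: by end_near. Qed.

(** By Markov's inequality it suffices that a bound of [|beta - z|] has a small
    mean, and [nonpositive_pair_dist] provides one, with [t] fixed before [N]. *)
Lemma beta_cvg : cvg_in_probability P beta (0 +i* (Num.sqrt 2 / 2 * s)).
Proof.
move=> e e0; split; first by move=> N; exact: measurable_beta_dist.
apply: cvg_probability0 => [N|del del0]; first exact: measurable_beta_dist.
pose eta : R := Num.sqrt 2 / 2 * s.
have s_eta : s ^+ 2 = 2 * eta ^+ 2.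
  by rewrite /eta 2!exprMn sqr_sqrtr//; field.
have bP N w := (nonpositive_typeP N (beta N w) (aw_sym w)).1 (betaP N w).
have := s_ge0; rewrite le_eqVlt => /orP[/eqP s0|s0].
  (* Zero variance: all entries vanish almost surely. *)
  pose t := (4 * (del * e))^-1.
  have t0 : 0 < t by rewrite invr_gt0; apply: mulr_gt0 => //; exact: mulr_gt0.
  exists 1%N => N N0.
  have m : mean_le P (fun w => `|border0 (entries x w) N|
      + t * \sum_i border (entries x w) N i 0 ^+ 2 + (4 * t)^-1) (del * e).
    have -> : del * e = 0 + t * s ^+ 2 + (4 * t)^-1.
      by rewrite -s0 /t; field; rewrite !gt_eqF.
    apply: mean_leD; last by apply: mean_le_cst; rewrite invr_ge0 mulr_ge0 // ltW.
    apply: mean_leD; last by apply: mean_leZ; [exact: ltW|exact: border_sum_mean].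
    have -> : (fun w => `|border0 (entries x w) N|) =
        (fun w => (Num.sqrt N%:R)^-1 * `|x 0%N 0%N w|).
      by apply/funext => w; rewrite /border0 normrM ger0_norm ?invr_ge0 ?sqrtr_ge0.
    rewrite (_ : 0 = (Num.sqrt N%:R)^-1 * s); last by rewrite -s0 mulr0.
    apply: mean_leZ; first by rewrite invr_ge0 sqrtr_ge0.
    by apply: entry_abs_mean => //; rewrite -s0.
  have := mean_le_markov e0 m (measurable_beta_dist N (0 +i* (Num.sqrt 2 / 2 * s)) e0).
  rewrite mulfK ?gt_eqF//; apply => w /= ew; apply: le_trans (ltW ew) _.
  have [v hv] := bP N w; rewrite -s0 mulr0.
  have -> : beta N w - (0 +i* 0) = beta N w by rewrite -[RHS]subr0.
  exact: nonpositive_pair_norm hv.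
have eta0 : 0 < eta by rewrite /eta !mulr_gt0 ?sqrtr_gt0 ?invr_gt0.
pose t := del * e / 2 / s ^+ 2.
have s20 : 0 < s ^+ 2 by rewrite exprn_gt0.
have t0 : 0 < t by rewrite /t !mulr_gt0 ?invr_gt0.
pose c := 1 + 3 / (4 * t * eta).
have c0 : 0 < c.
  by apply: addr_gt0 => //; apply: divr_gt0 => //; apply: mulr_gt0 => //; exact: mulr_gt0.
have [|K [K0 [N0 rate]]] := @defect_rate_small eta (del * e / 2 / c) eta0.
  by rewrite !mulr_gt0 ?invr_gt0.
exists (maxn N0 1) => N; rewrite geq_max => /andP[N0N Npos].
have m : mean_le P (fun w => normc (pole_defect x N eta w) * c
      + t * \sum_i border (entries x w) N i 0 ^+ 2) (del * e).
  have -> : del * e = c * (del * e / 2 / c) + t * s ^+ 2.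
    by rewrite /t; field; rewrite !gt_eqF.
  apply: mean_leD; last by apply: mean_leZ; [exact: ltW|exact: border_sum_mean].
  under eq_fun do rewrite mulrC.
  apply: mean_leZ; first exact: ltW.
  apply: mean_le_weaken (rate _ N0N Npos) _.
  exact: pole_defect_mean.
have := mean_le_markov e0 m (measurable_beta_dist N (0 +i* eta) e0).
rewrite mulfK ?gt_eqF//; apply => w /= ew; apply: le_trans (ltW ew) _.
have [v hv] := bP N w.
exact: (nonpositive_pair_dist (mxC_tr N (aw_sym w)) eta0 (pole_vectorE x_sym N eta0 w) t0 hv).
Qed.
End BetaConvergence.

(** * Characteristic polynomials of bordered matrices *)

Section Bordered.
Variable S : comNzRingType.

(** The numerator of [b^T (t - A)^-1 b] over the characteristic polynomial. *)
Definition border_poly n (A : 'M[S]_n) (b : 'cV[S]_n) : {poly S} :=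
  ((map_mx polyC b)^T *m (\adj (char_poly_mx A) *m map_mx polyC b)) 0 0.

(** Invertible iff [b] is a cyclic vector of [A]. *)
Definition krylov n (A : 'M[S]_n) (b : 'cV[S]_n) : 'M[S]_n :=
  \matrix_(i, j) (iter j (mulmx A) b) i 0.
End Bordered.

Section BorderedField.
Variable F : fieldType.

(** Multiplying on the right by a block matrix of determinant [char_poly A]
    clears the lower left block; the superfluous factor is then cancelled. *)
Lemma char_poly_bordered n (a0 : F) (A : 'M[F]_n) (b : 'cV[F]_n) :
  char_poly (block_mx (- a0%:M) (- b^T) b A : 'M[F]_(1 + n)) =
  ('X + a0%:P) * char_poly A + border_poly A b.
Proof.
set B := block_mx _ _ _ _; pose Pb := map_mx polyC b.
pose M := char_poly_mx A; pose chi := char_poly A.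
have BE : char_poly_mx B = block_mx ('X + a0%:P)%:M Pb^T (- Pb) M.
  rewrite /char_poly_mx /B map_block_mx scalar_mx_block opp_block_mx add_block_mx.
  rewrite !map_mxN opprK map_scalar_mx opprK map_trmx sub0r /M /char_poly_mx; congr block_mx.
  - by rewrite raddfD.
  - by rewrite add0r.
pose L := block_mx chi%:M 0 (\adj M *m Pb) 1%:M : 'M[{poly F}]_(1 + n).
have BL : char_poly_mx B *m L = block_mx (('X + a0%:P) * chi + border_poly A b)%:M Pb^T 0 M.
  rewrite BE /L mulmx_block !mulmx1 !mulmx0 !add0r; congr block_mx.
  - rewrite -scalar_mxM raddfD; congr (_ + _).
    by apply/matrixP => i j; rewrite !ord1 [RHS]mxE mulr1n.
  - by rewrite mulmxA mul_mx_adj mul_mx_scalar mul_scalar_mx scalerN addNr.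
have chi0 : chi != 0 by rewrite monic_neq0 ?char_poly_monic.
apply: (mulIf chi0).
have := congr1 determinant BL; rewrite det_mulmx /L det_lblock det_ublock det1 mulr1.
by rewrite !det_scalar1.
Qed.

(** A left eigenvector orthogonal to [b] is orthogonal to all [A^j b]. *)
Lemma krylov_eigenvector n (A : 'M[F]_n) (b : 'cV[F]_n) (l : F) (u : 'rV[F]_n) :
  \det (krylov A b) != 0 -> u != 0 -> u *m A = l *: u -> u *m b != 0.
Proof.
move=> D0 u0 uA; apply: contra_neq D0 => ub; apply/eqP/det0P; exists u => //.
have H j : u *m iter j (mulmx A) b = 0.
  elim: j => [//|j IH] /=.
  by rewrite mulmxA uA -scalemxAl IH scaler0.
apply/matrixP => i j; have := congr1 (fun B : 'M[F]_1 => B i 0) (H j).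
by rewrite !mxE => h; rewrite -[RHS]h; apply: eq_bigr => k _; rewrite !mxE.
Qed.

(** If the minors of a singular symmetric matrix all vanish its kernel has
    dimension at least 2 and meets the hyperplane orthogonal to [b]. *)
Lemma sym_adj_kernel n (B : 'M[F]_n) (b : 'cV[F]_n) : B^T = B -> \det B = 0 ->
  \adj B *m b = 0 -> exists u : 'rV[F]_n, [/\ u != 0, u *m B = 0 & u *m b = 0].
Proof.
move=> Bs B0 ab; have [aB0|] := eqVneq (\adj B) 0; last first.
  move=> aB0; have [i hi] : exists i, row i (\adj B) != 0.
    apply: contrapT => h; move/eqP: aB0; apply; apply/row_matrixP => i; rewrite row0.
    by apply: contrapT => hi; apply: h; exists i; apply/eqP.
  exists (row i (\adj B)); split => //; rewrite -row_mul.
    by rewrite mul_adj_mx B0 raddf0 row0.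
  by rewrite ab row0.
have /eqP/det0P[u u0 uB] := B0.
have [i ui] : exists i, u 0 i != 0.
  apply: contrapT => h; move/eqP: u0; apply; apply/rowP => i; rewrite mxE.
  by apply: contrapT => hi; apply: h; exists i; apply/eqP.
case: n B b Bs B0 ab aB0 u u0 uB i ui => [|n] B b Bs B0 ab aB0 u u0 uB i ui; first by case: i ui.
(* The minor obtained by deleting index [i] is singular as well; its kernel
   vector, extended by 0 at [i], is a second kernel vector of [B]. *)
have /eqP/det0P[v' v'0 v'B] : \det (row' i (col' i B)) = 0.
  have := congr1 (fun C : 'M[F]_n.+1 => C i i) aB0; rewrite !mxE /cofactor => /eqP.
  by rewrite mulf_eq0 signr_eq0 => /eqP.
pose v : 'rV[F]_n.+1 := \row_j (if unlift i j is Some k then v' 0 k else 0).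
have vi : v 0 i = 0 by rewrite mxE unlift_none.
have vl k : v 0 (lift i k) = v' 0 k by rewrite mxE liftK.
have v0 : v != 0.
  apply: contra_neq v'0 => v0; apply/rowP => k; by rewrite -vl v0 !mxE.
have vBl k : (v *m B) 0 (lift i k) = 0.
  have := congr1 (fun C : 'rV[F]_n => C 0 k) v'B; rewrite mxE [RHS]mxE => h.
  rewrite mxE (bigD1_ord i)//= vi mul0r add0r -[RHS]h; apply: eq_bigr => j _.
  by rewrite vl !mxE.
have vB : v *m B = 0.
  apply/rowP => j; rewrite [RHS]mxE; case: (unliftP i j) => [k ->|->]; first exact: vBl.
  have : (v *m B *m u^T) 0 0 = 0.
    by rewrite -mulmxA -{1}Bs -trmx_mul uB trmx0 mulmx0 mxE.
  rewrite mxE (bigD1_ord i)//= big1 ?addr0 => [|k _]; last by rewrite vBl mul0r.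
  by rewrite [u^T _ _]mxE => /eqP; rewrite mulf_eq0 (negPf ui) orbF => /eqP.
have [vb|vb] := eqVneq (v *m b) 0; first by exists v.
pose p := (v *m b) 0 0; pose q := (u *m b) 0 0.
have p0 : p != 0.
  by apply: contra_neq vb => h; apply/matrixP => x y; rewrite !ord1 -/p h mxE.
exists (p *: u - q *: v); split.
- have ci : (p *: u - q *: v) 0 i = p * u 0 i.
    by rewrite 4!mxE vi mulr0 subr0.
  apply/eqP => h; move/eqP: ci; rewrite h mxE eq_sym mulf_eq0 (negPf ui).
  by rewrite (negPf p0).
- by rewrite mulmxBl -!scalemxAl uB vB !scaler0 subr0.
- rewrite mulmxBl -!scalemxAl; apply/matrixP => x y; rewrite !ord1 [RHS]mxE.
  by rewrite mxE [X in X + _]mxE [X in _ + X]mxE [X in _ - X]mxE -/p -/q mulrC subrr.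
Qed.

Lemma krylov_adj n (A : 'M[F]_n) (b : 'cV[F]_n) (l : F) : A^T = A ->
  \det (krylov A b) != 0 -> root (char_poly A) l -> \adj (l%:M - A) *m b != 0.
Proof.
move=> As D0; rewrite -eigenvalue_root_char => /eigenvalueP[v vA v0].
have Bs : (l%:M - A)^T = l%:M - A by rewrite linearB /= tr_scalar_mx As.
have B0 : \det (l%:M - A) = 0.
  apply/eqP/det0P; exists v => //.
  by rewrite mulmxBr vA mul_mx_scalar subrr.
apply/eqP => /(sym_adj_kernel Bs B0)[u [u0 uB ub]].
have uA : u *m A = l *: u.
  by apply/esym/eqP; rewrite -subr_eq0 -mul_mx_scalar -mulmxBr uB.
by have := krylov_eigenvector D0 u0 uA; rewrite ub eqxx.
Qed.
End BorderedField.

Section Residue.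
Variable R : realType.

(** The residue of [b^T (t - A)^-1 b] at an eigenvalue has a sign: the quantity
    below is the square norm of [adj (l - A) b], which is an eigenvector. *)
Lemma border_poly_residue n (A : 'M[R]_n) (b : 'cV[R]_n) (l : R) (q : {poly R}) :
  A^T = A -> char_poly A = ('X - l%:P) * q -> \adj (l%:M - A) *m b != 0 ->
  0 < q.[l] * (border_poly A b).[l].
Proof.
move=> As chiE adj0.
pose M := char_poly_mx A; pose Pb := map_mx polyC b.
pose w := \adj M *m Pb.
pose ev (p : {poly R}) := p.[l].
pose wl : 'cV[R]_n := map_mx (horner_eval l) w.
have Mw : M *m w = (char_poly A) *: Pb by rewrite mulmxA mul_mx_adj mul_scalar_mx.
have Ms : M^T = M.
  by apply/matrixP => i j; rewrite /M !mxE eq_sym -{1}As mxE.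
have Ml : map_mx (horner_eval l) M = l%:M - A.
  by apply/matrixP => i j; rewrite !mxE /horner_eval !hornerE hornerMn hornerX.
have wlE : wl = \adj (l%:M - A) *m b.
  rewrite /wl /w map_mxM map_mx_adj Ml; congr (_ *m _).
  by apply/matrixP => i j; rewrite 2!mxE /= /horner_eval hornerC.
have Alw : A *m wl = l *: wl.
  have := congr1 (map_mx (horner_eval l)) Mw; rewrite map_mxM Ml mulmxBl mul_scalar_mx.
  rewrite map_mxZ /= /horner_eval chiE hornerM !hornerE subrr mul0r scale0r => /eqP.
  by rewrite subr_eq0 => /eqP <-.
pose Pw : 'cV[{poly R}]_n := map_mx polyC wl.
have PwM : Pw^T *m M = ('X - l%:P) *: Pw^T.
  rewrite -[LHS]trmxK trmx_mul Ms trmxK -[RHS]trmxK linearZ /= trmxK; congr trmx.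
  rewrite /M /char_poly_mx mulmxBl mul_scalar_mx /Pw -map_mxM Alw map_mxZ /=.
  by rewrite scalerBl.
have fE : (border_poly A b).[l] = (wl^T *m b) 0 0.
  rewrite /border_poly -/M -/Pb -/w mxE horner_sum [RHS]mxE.
  by apply: eq_bigr => i _; rewrite !mxE hornerM hornerC mulrC.
pose s : {poly R} := (Pw^T *m w) 0 0.
have sE : ('X - l%:P) * s = char_poly A * ((border_poly A b).[l])%:P.
  have := congr1 (fun B : 'cV[{poly R}]_n => (Pw^T *m B) 0 0) Mw.
  rewrite mulmxA PwM -scalemxAl mxE -/s => ->.
  rewrite -scalemxAr mxE fE; congr (_ * _).
  by rewrite /Pw /Pb map_trmx -map_mxM mxE.
have {}sE : s = q * ((border_poly A b).[l])%:P.
  apply: (@mulfI _ ('X - l%:P)); first by rewrite polyXsubC_eq0.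
  by rewrite sE chiE mulrA.
have sl : s.[l] = \sum_i wl i 0 ^+ 2.
  rewrite /s mxE horner_sum; apply: eq_bigr => i _.
  by rewrite !mxE hornerM hornerC expr2.
have <- : s.[l] = q.[l] * (border_poly A b).[l] by rewrite sE hornerM hornerC.
rewrite sl lt_neqAle sumr_ge0 ?andbT => [|i _]; last exact: sqr_ge0.
apply/negP => /eqP/esym/eqP; rewrite psumr_eq0 => [/allP z|i _]; last exact: sqr_ge0.
move/eqP: adj0; apply; rewrite -wlE; apply/matrixP => i j; rewrite ord1 [RHS]mxE.
by have := z i (mem_index_enum _); rewrite /= sqrf_eq0 => /eqP.
Qed.
End Residue.

(** * Interlacing *)

Section Interlacing.
Variable R : realType.

(** The cofactor [q] takes at [a] the value of the derivative of the product.  It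
    is nonzero, so the roots are simple, and it has opposite signs at consecutive
    roots; hence [p] changes sign between them. *)
Lemma interlaced_roots (l : seq R) (p : {poly R}) :
  sorted <=%R l ->
  (forall a q, \prod_(c <- l) ('X - c%:P) = ('X - a%:P) * q -> 0 < q.[a] * p.[a]) ->
  forall i, (i.+1 < size l)%N ->
  l`_i < l`_i.+1 /\ exists x, l`_i < x < l`_i.+1 /\ root p x.
Proof.
move=> sl hq i il.
pose s := take i l ++ drop i.+2 l.
pose r := \prod_(c <- s) ('X - c%:P).
set u := l`_i; set v := l`_i.+1.
have lE : l = take i l ++ u :: v :: drop i.+2 l.
  by rewrite -{1}(cat_take_drop i l) (drop_nth 0 (ltnW il)) (drop_nth 0 il).
have prodE : \prod_(c <- l) ('X - c%:P) = ('X - u%:P) * (('X - v%:P) * r).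
  rewrite lE big_cat /= !big_cons /r /s big_cat /=.
  by rewrite mulrCA; congr (_ * _); rewrite mulrCA.
have hu := hq _ _ prodE.
have hv : 0 < (('X - u%:P) * r).[v] * p.[v] by apply: hq; rewrite prodE mulrCA.
rewrite !hornerM !hornerXsubC in hu hv.
have uv_le : u <= v.
  by apply: (sorted_leq_nth le_trans lexx 0 sl); rewrite ?inE// ltnW.
have uv : u < v.
  rewrite lt_neqAle uv_le andbT; apply/negP => /eqP uv.
  by move: hu; rewrite uv subrr !mul0r ltxx.
have rr : 0 <= r.[u] * r.[v].
  rewrite /r !horner_prod -big_split /= big_seq; apply: prodr_ge0 => c.
  rewrite !hornerXsubC /s mem_cat => /orP[].
    move=> /(nthP 0)[j]; rewrite size_take (ltnW il) => ji <-; rewrite nth_take//.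
    have cu : l`_j <= u.
      by apply: (sorted_leq_nth le_trans lexx 0 sl); rewrite ?inE ?(ltn_trans ji (ltnW il)) ?(ltnW il)// ltnW.
    by apply: mulr_ge0; rewrite subr_ge0// (le_trans cu).
  move=> /(nthP 0)[j]; rewrite size_drop => ji <-; rewrite nth_drop.
  have jl : (i.+2 + j < size l)%N by rewrite -ltn_subRL.
  have cv : v <= l`_(i.+2 + j).
    by apply: (sorted_leq_nth le_trans lexx 0 sl); rewrite ?inE//; lia.
  by apply: mulr_le0; rewrite subr_le0// (le_trans uv_le).
split=> //.
have sgn : p.[u] * p.[v] < 0.
  have : 0 < ((v - u) ^+ 2 * (r.[u] * r.[v])) * - (p.[u] * p.[v]).
    have -> : ((v - u) ^+ 2 * (r.[u] * r.[v])) * - (p.[u] * p.[v]) =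
      ((u - v) * r.[u] * p.[u]) * ((v - u) * r.[v] * p.[v]) by ring.
    exact: mulr_gt0.
  have c0 : 0 <= (v - u) ^+ 2 * (r.[u] * r.[v]) by rewrite mulr_ge0 ?sqr_ge0.
  rewrite -oppr_gt0 => h; rewrite ltNge; apply/negP => h'.
  by move: h; rewrite ltNge mulr_ge0_le0.
have pu0 : p.[u] != 0 by apply/eqP => e; move: sgn; rewrite e mul0r ltxx.
have pv0 : p.[v] != 0 by apply/eqP => e; move: sgn; rewrite e mulr0 ltxx.
have ivt (q : {poly R}) : q.[u] <= 0 <= q.[v] -> (forall y, root q y = root p y) ->
    exists x, u < x < v /\ root p x.
  move=> hq' rq; have [y /andP[uy yv] ry] := poly_ivt uv_le hq'; rewrite rq in ry.
  exists y; split=> //; rewrite !lt_neqAle uy yv !andbT; apply/andP; split.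
    by apply/eqP => e; move: ry; rewrite -e rootE (negPf pu0).
  by apply/eqP => e; move: ry; rewrite e rootE (negPf pv0).
case: (lerP p.[u] 0) => pu.
  apply: (ivt p) => //; rewrite pu /=.
  move: sgn; rewrite nmulr_rlt0 ?lt_neqAle ?pu0// => /andP[_] //.
apply: (ivt (- p)); last by move=> y; rewrite rootN.
rewrite !hornerN oppr_le0 (ltW pu) /= oppr_ge0.
by move: sgn; rewrite pmulr_rlt0// => /ltW.
Qed.

Lemma mxX_block (a : nat -> nat -> R) N : (forall i j, a i j = a j i) ->
  mxX a N = block_mx (- (border0 a N)%:M) (- (border a N)^T) (border a N) (mxC a N)
    :> 'M[R]_(1 + N).
Proof.
move=> asym; apply/matrixP => i j; rewrite mxX_entry.
rewrite -(splitK i) -(splitK j).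
case: (fintype.split i) => i'; case: (fintype.split j) => j' /=.
- rewrite block_mxEul !mxE !ord1 eqxx mulr1n /= mulN1r mulrN //.
- by rewrite block_mxEur !mxE !ord1 /= mulN1r mulrN.
- by rewrite block_mxEdl !mxE [j']ord1 /= mul1r asym.
- by rewrite block_mxEdr !mxE /= mul1r.
Qed.

Lemma nonpositive_type_root N (a : nat -> nat -> R) (b : R[i]) :
  eigenvalue_of_nonpositive_type (complexify (mxH R N)) (complexify (mxX a N)) b ->
  root (map_poly (real_complex R) (char_poly (mxX a N))) b.
Proof.
move=> [_ [x [x0 Xx _]]]; rewrite map_char_poly -/(complexify _).
have : root (char_poly (complexify (mxX a N))^T) b.
  rewrite -eigenvalue_root_char; apply/eigenvalueP; exists x^T.
    by rewrite -trmx_mul Xx linearZ.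
  by apply: contra_neq x0 => /(congr1 trmx); rewrite trmxK trmx0.
suff -> : char_poly (complexify (mxX a N))^T = char_poly (complexify (mxX a N)) by [].
rewrite /char_poly -[in RHS]det_tr; congr (\det _).
by apply/matrixP => i j; rewrite !mxE eq_sym.
Qed.

Lemma eigenvalue_complexify n (A : 'M[R]_n) (t : R) :
  eigenvalue (complexify A) t%:C = root (char_poly A) t.
Proof. by rewrite eigenvalue_root_char -map_char_poly fmorph_root. Qed.

(** At the eigenvalues of [C] the characteristic polynomial of [X] equals
    [border_poly], whose signs alternate strictly, so there is a root in each of
    the [n] gaps.  With the nonreal [beta] and its conjugate this makes [n + 2]
    roots, as many as the degree. *)
Lemma interlacing_of_coupled n (a : nat -> nat -> R) (l : seq R) (beta : R[i]) :
  (forall i j, a i j = a j i) -> ordered_spectrum (mxC a n.+1) l ->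
  \det (krylov (mxC a n.+1) (border a n.+1)) != 0 ->
  eigenvalue_of_nonpositive_type (complexify (mxH R n.+1)) (complexify (mxX a n.+1)) beta ->
  Im beta != 0 -> interlacing_real_spectrum (mxX a n.+1) l.
Proof.
move=> asym [sl chiE] D0 /nonpositive_type_root rb Ib.
set p := char_poly (mxX a n.+1) in rb.
have pE : p = ('X + (border0 a n.+1)%:P) * char_poly (mxC a n.+1)
    + border_poly (mxC a n.+1) (border a n.+1).
  by rewrite /p mxX_block// char_poly_bordered.
have szl : size l = n.+1.
  by have := size_char_poly (mxC a n.+1); rewrite chiE size_prod_XsubC => -[].
have hq c q : \prod_(c <- l) ('X - c%:P) = ('X - c%:P) * q -> 0 < q.[c] * p.[c].
  move=> cq; have rc : root (char_poly (mxC a n.+1)) c.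
    by rewrite chiE cq rootM root_XsubC eqxx.
  have -> : p.[c] = (border_poly (mxC a n.+1) (border a n.+1)).[c].
    by rewrite pE hornerD hornerM (rootP rc) mulr0 add0r.
  apply: border_poly_residue; first exact: mxC_tr.
    by rewrite chiE.
  by apply: krylov_adj => //; exact: mxC_tr.
have [z hz] : exists z : nat -> R, forall i, (i < n)%N -> l`_i < z i < l`_i.+1 /\ root p (z i).
  have : forall i, exists x, (i < n)%N -> l`_i < x < l`_i.+1 /\ root p x.
    move=> i; case: (ltnP i n) => il; last by exists 0.
    by have [|_ [x hx]] := interlaced_roots sl hq (i := i); [rewrite szl|exists x].
  by move=> /choice[z hz]; exists z.
pose zeta := mkseq z n.
have lz i j : (i < j)%N -> (j < n)%N -> z i < z j.
  move=> ij jn; have [/andP[_ h1] _] := hz i (ltn_trans ij jn).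
  have [/andP[h2 _] _] := hz j jn.
  apply: (lt_le_trans h1); apply: (le_trans _ (ltW h2)).
  by apply: (sorted_leq_nth le_trans lexx 0 sl); rewrite ?inE ?szl//; lia.
have szeta : sorted <%R zeta.
  apply/(sortedP 0) => i; rewrite size_mkseq => il.
  by rewrite !nth_mkseq//; [exact: lz|exact: ltnW].
have rz y : y \in zeta -> root p y.
  by rewrite /zeta /mkseq => /mapP[k]; rewrite mem_iota /= add0n => kl ->; have [] := hz k kl.
exists zeta; split => //.
- by rewrite size_mkseq.
- move=> y; rewrite eigenvalue_complexify -/p; apply/idP/idP; last exact: rz.
  move=> ry; apply: contraT => ny.
  pose rs := [seq real_complex R t | t <- y :: zeta] ++ [:: beta; conjc beta].
  have pc0 : map_poly (real_complex R) p != 0.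
    by rewrite map_poly_eq0 monic_neq0// char_poly_monic.
  have ur : uniq rs.
    have nr t : real_complex R t != beta /\ real_complex R t != conjc beta.
      split; apply: contra_neq Ib; case: (beta) => u v [_ /= e]; first by rewrite -e.
      by rewrite -[v]opprK -e oppr0.
    have bb : beta != conjc beta.
      apply: contra_neq Ib; case: (beta) => u v [] /= /eqP.
      by rewrite -addr_eq0 -mulr2n mulrn_eq0 /= => /eqP.
    rewrite cat_uniq; apply/and3P; split.
    - rewrite map_inj_uniq; last exact: complexI.
      by rewrite /= ny (sorted_uniq lt_trans ltxx).
    - apply/hasPn => t; rewrite in_cons mem_seq1 => /orP[] /eqP -> {t}.
        by apply/mapP => -[t _ e]; have [/eqP h _] := nr t; exact: h.
      by apply/mapP => -[t _ e]; have [_ /eqP h] := nr t; exact: h.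
    - by rewrite /= inE bb.
  have ar : all (root (map_poly (real_complex R) p)) rs.
    rewrite all_cat; apply/andP; split.
      apply/allP => _ /mapP[t tz ->]; rewrite fmorph_root.
      by move: tz; rewrite inE => /orP[/eqP ->|/rz].
    rewrite /= rb /= andbT.
    have := rmorph_root (@conjc R) rb.
    rewrite -map_poly_comp (eq_map_poly (g := real_complex R)) // => t /=.
    by rewrite oppr0.
  have := max_poly_roots pc0 ar ur.
  by rewrite size_map_poly size_char_poly size_cat size_map /= size_mkseq; lia.
- by move=> i il; rewrite nth_mkseq//; have [] := hz i il.
Qed.
End Interlacing.

(** * Polynomials in independent variables with continuous laws *)

Section AlmostSure.
Context (d : measure_display) (T : measurableType d) (R : realType)
  (P : probability T R) (I : choiceType) (D : set I) (X : I -> {RV P >-> R}).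
Hypothesis X_indep : mutually_independent D X.

Lemma countable_roots (q : {poly R}) : q != 0 -> countable [set t | root q t].
Proof.
move=> q0.
have [rs rsE] := closed_field_poly_normal (map_poly (real_complex R) q).
apply: (@sub_countable _ _ _ [set` map (@complex.Re R) rs]); last first.
  exact/finite_set_countable/finite_seq.
apply: subset_card_le => t /= rt.
have : root (map_poly (real_complex R) q) t%:C by rewrite fmorph_root.
rewrite rsE rootZ ?lead_coef_eq0 ?map_poly_eq0// root_prod_XsubC => h.
by apply/mapP; exists t%:C.
Qed.

Lemma continuous_law_root (Y : {RV P >-> R}) (q : {poly R}) : continuous_law Y ->
  q != 0 -> P [set w | root q (Y w)] = 0%E.
Proof.
move=> cY q0; have cq := countable_roots q0.
have mq : measurable [set t | root q t] by exact: countable_measurable.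
have nq : (@lebesgue_measure R).-null_set [set t | root q t].
  move=> A mA Aq; apply: countable_lebesgue_measure0; apply: sub_countable cq.
  exact: subset_card_le.
exact: (cY _ nq _ mq (@subset_refl _ _)).
Qed.

(** Freezing the coordinates one at a time: if the polynomial function does not
    vanish after the first coordinates have been randomized, then as a
    polynomial in the next coordinate it is nonzero, and an independent
    variable with a continuous law avoids its finitely many roots. *)
Lemma polynomial_ae_neq0 (F : (I -> R) -> R) (c : I -> R) (s : seq I) :
  (forall y i, exists q : {poly R}, forall t, F (fun j => if j == i then t else y j) = q.[t]) ->
  (forall d' (T' : measurableType d') (Y : I -> T' -> R),
     (forall i, measurable_fun setT (Y i)) -> measurable_fun setT (fun w => F (Y^~ w))) ->
  (forall i, i \in s -> continuous_law (X i)) ->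
  uniq s -> [set` s] `<=` D -> F c != 0 ->
  P [set w | F (fun i => if i \in s then X i w else c i) = 0] = 0%E.
Proof.
move=> pF mF.
have meas0 d' (T' : measurableType d') (Y : I -> T' -> R) :
    (forall i, measurable_fun setT (Y i)) -> measurable [set w | F (Y^~ w) = 0].
  move=> mY; rewrite -[X in measurable X]setTI.
  exact: (mF _ _ _ mY) measurableT _ (measurable_set1 0).
have mX i : measurable_fun setT (X i : T -> R) by exact: measurable_funPT.
have mif (r : seq I) i : measurable_fun setT (fun w => if i \in r then X i w else c i).
  by case: (i \in r); [exact: mX|exact: measurable_cst].
elim: s => [|k s IH] cX us sD c0.
  rewrite [X in P X](_ : _ = set0) ?measure0//.
  by apply/seteqP; split=> // w /= /eqP h; move: c0; rewrite h.
have {us} /andP[ks us] : (k \notin s) && uniq s by [].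
have {}IH : P [set w | F (fun i => if i \in s then X i w else c i) = 0] = 0%E.
  apply: IH => //; first by move=> i si; apply: cX; rewrite inE si orbT.
  by move=> i si; apply: sD; rewrite /= inE (si : i \in s) orbT.
have Dk : D k by apply: sD; rewrite /= inE eqxx.
pose y v w i := if i == k then X k w else if i \in s then X i v else c i.
pose G v w : \bar R := (\1_[set u | F u = 0] (y v w))%:E.
have sD' : [set` s] `<=` D by move=> i si; apply: sD; rewrite /= inE (si : i \in s) orbT.
have kD : [set k] `<=` D by move=> _ ->.
have dis : [set` s] `&` [set k] = set0.
  by rewrite -subset0 => i [/= + ik]; rewrite ik (negPf ks).
have mG : measurable_fun [set: generated_space X [set` s] * generated_space X [set k]]
    (fun z => G z.1 z.2).
  apply/measurable_EFinP.
  have -> : (fun z : generated_space X [set` s] * generated_space X [set k] =>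
      \1_[set u | F u = 0] (y z.1 z.2)) = \1_[set z | F (y z.1 z.2) = 0] :> (_ -> R).
    by apply/funext => z; rewrite !indicE.
  apply: measurable_indic.
  apply: (meas0 _ (generated_space X [set` s] * generated_space X [set k])%type
    (fun i z => y z.1 z.2 i)) => i.
  rewrite /y; case: eqVneq => [_|_].
    by apply: (measurableT_comp (f := X k : generated_space X [set k] -> R));
      [exact: measurable_coord|exact: measurable_snd].
  case: (boolP (i \in s)) => [si|_]; last exact: measurable_cst.
  by apply: (measurableT_comp (f := X i : generated_space X [set` s] -> R));
    [exact: measurable_coord|exact: measurable_fst].
have G0 v w : (0 <= G v w)%E by rewrite lee_fin.
have dec := integral_decouple X_indep sD' kD dis mG G0.
have -> : P [set w | F (fun i => if i \in k :: s then X i w else c i) = 0] =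
    (\int[P]_w G w w)%E.
  have -> : (\int[P]_w G w w = \int[P]_w (\1_[set w | F (y w w) = 0] w)%:E)%E.
    by apply: eq_integral => w _; rewrite /G !indicE.
  rewrite integral_indic ?setIT//; last first.
    apply: (meas0 _ _ (fun i w => y w w i)) => i; rewrite /y.
    by case: (i == k); [exact: mX|exact: mif].
  congr (P _); apply/funext => w /=; congr (F _ = 0); apply/funext => i.
  by rewrite /y inE; case: eqVneq => [->|].
rewrite dec; apply/eqP; rewrite eq_le; apply/andP; split; last first.
  by apply: integral_ge0 => v _; apply: integral_ge0.
have mS : measurable [set w | F (fun i => if i \in s then X i w else c i) = 0].
  by apply: (meas0 _ _ (fun i w => if i \in s then X i w else c i)) => i; exact: mif.
rewrite -IH -(setIT [set w | _]) -integral_indic//.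
apply: ge0_le_integral => //.
- by move=> v _; apply: integral_ge0.
- have := measurable_fun_fubini_tonelli_F (m2 := P) (fun z : T * T => G z.1 z.2).
  apply=> [|z]; last exact: G0.
  apply/measurable_EFinP.
  have -> : (fun z : T * T => \1_[set u | F u = 0] (y z.1 z.2)) =
      \1_[set z | F (y z.1 z.2) = 0] :> (_ -> R).
    by apply/funext => z; rewrite !indicE.
  apply: measurable_indic; apply: (meas0 _ _ (fun i z => y z.1 z.2 i)) => i.
  rewrite /y; case: (i == k); first exact: (measurableT_comp (mX k) measurable_snd).
  exact: (measurableT_comp (mif s i) measurable_fst).
- by apply/measurable_EFinP/measurable_indic.
move=> v _; pose u i := if i \in s then X i v else c i.
have [Fu|Fu] := eqVneq (F u) 0.
  rewrite indicE mem_set//.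
  apply: (@le_trans _ _ (\int[P]_w (1 : R)%:E)%E); last by rewrite integral_prob_cst.
  apply: ge0_le_integral => //.
  + apply/measurable_EFinP.
    have -> : (fun w : T => \1_[set u | F u = 0] (y v w)) =
      \1_[set w | F (y v w) = 0] :> (_ -> R).
      by apply/funext => z; rewrite !indicE.
    apply: measurable_indic; apply: (meas0 _ _ (fun i w => y v w i)) => i.
    by rewrite /y; case: (i == k); [exact: mX|exact: measurable_cst].
  + by move=> w _; rewrite lee_fin indicE; case: (_ \in _).
have [q qE] := pF u k.
have q0 : q != 0.
  apply: contra_neq Fu => q0; have := qE (u k); rewrite q0 horner0 => <-.
  by congr F; apply/funext => i; case: eqVneq => [->|].
rewrite [leLHS](_ : _ = 0%E) ?lee_fin//.
have -> : (\int[P]_w G v w = \int[P]_w (\1_[set w | root q (X k w)] w)%:E)%E.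
  apply: eq_integral => w _; rewrite /G !indicE; congr ((_ : bool)%:R%:E).
  have yE : F (y v w) = q.[X k w] by rewrite -qE.
  by apply/idP/idP; rewrite !inE /= yE => /rootP.
have mq : measurable [set w | root q (X k w)].
  rewrite -[X in measurable X]setTI.
  have mr : measurable [set t | root q t].
    by apply: countable_measurable => //; exact: countable_roots.
  exact: mX k measurableT _ mr.
rewrite integral_indic ?setIT//.
by apply: continuous_law_root => //; apply: cX; rewrite inE eqxx.
Qed.
End AlmostSure.

(** * The Krylov determinant *)

Section KrylovDeterminant.
Variable S : comNzRingType.

(** Over an arbitrary ring, so that one entry can be made a polynomial variable. *)
Definition krylov_det (k : S) (a : nat -> nat -> S) N : S :=
  \det (krylov (\matrix_(i < N, j < N) (k * a i.+1 j.+1))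
               (\col_(i < N) (k * a 0%N i.+1))).

Lemma eq_krylov_det (k : S) (a a' : nat -> nat -> S) N :
  (forall i j, (i <= N)%N -> (j <= N)%N -> a i j = a' i j) ->
  krylov_det k a N = krylov_det k a' N.
Proof.
move=> aa'; congr (\det (krylov _ _)); apply/matrixP => i j; rewrite !mxE aa'//.
Qed.
End KrylovDeterminant.

Lemma rmorph_krylov_det (S S' : comNzRingType) (f : {rmorphism S -> S'})
    (k : S) (a : nat -> nat -> S) N :
  f (krylov_det k a N) = krylov_det (f k) (fun i j => f (a i j)) N.
Proof.
rewrite /krylov_det -det_map_mx; congr (\det _); apply/matrixP => i j; rewrite !mxE.
set A := \matrix_(i, j) (k * _); set A' := \matrix_(i, j) (f k * _).
set b := \col_i (k * _); set b' := \col_i (f k * _).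
have -> : A' = map_mx f A by apply/matrixP => p q; rewrite !mxE rmorphM.
have -> : b' = map_mx f b by apply/matrixP => p q; rewrite !mxE rmorphM.
have -> : iter j (mulmx (map_mx f A)) (map_mx f b) = map_mx f (iter j (mulmx A) b).
  by elim: (j : nat) => //= m ->; rewrite map_mxM.
by rewrite mxE.
Qed.

Section KrylovReal.
Variable R : realType.

(** Powers of a diagonal matrix with distinct entries, applied to the vector of
    ones, form a Vandermonde matrix. *)
Lemma krylov_det_diag_neq0 (k : R) N : k != 0 ->
  krylov_det k (fun i j => k^-1 * (if i == j then i%:R else (minn i j == 0%N)%:R)) N != 0.
Proof.
move=> k0; rewrite /krylov_det -det_tr.
set A := \matrix_(i, j) (k * _); set b := \col_i (k * _).
have AE : A = diag_mx (\row_(i < N) i.+1%:R).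
  apply/matrixP => i j; rewrite !mxE mulVKf// eqSS minnSS.
  by have [->|ij] := eqVneq i j; rewrite ?eqxx ?mulr1n ?mulr0n// (negPf (ij : i != j :> nat)).
have bE j i : iter j (mulmx A) b i 0 = i.+1%:R ^+ j.
  elim: j i => [|j IH] i; first by rewrite /= mxE mulVKf.
  by rewrite /= {1}AE mul_diag_mx !mxE IH exprS.
have -> : (krylov A b)^T = Vandermonde N (\row_(i < N) i.+1%:R).
  by apply/matrixP => i j; rewrite !mxE bE.
rewrite det_Vandermonde; apply/prodf_neq0 => i _; apply/prodf_neq0 => j ij.
by rewrite !mxE subr_eq0 eqr_nat eqSS gtn_eqF.
Qed.

Lemma measurable_krylov_det (d : measure_display) (T : measurableType d) (k : R)
    (a : nat -> nat -> T -> R) N : (forall i j, measurable_fun setT (a i j)) ->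
  measurable_fun setT (fun w => krylov_det k (fun i j => a i j w) N).
Proof.
move=> ma; apply: measurable_det => i j; under eq_fun do rewrite mxE.
elim: (j : nat) i => [|m IH] i /=.
  by under eq_fun do rewrite mxE; apply: measurable_funM => //; exact: measurable_cst.
under eq_fun do rewrite mxE; apply: measurable_sum => l.
apply: measurable_funM; last exact: IH.
under eq_fun do rewrite mxE.
by apply: measurable_funM => //; exact: measurable_cst.
Qed.

Lemma krylov_detE (a : nat -> nat -> R) N :
  krylov_det (Num.sqrt N%:R)^-1 a N = \det (krylov (mxC a N) (border a N)).
Proof. by congr (\det (krylov _ _)); apply/matrixP => i j; rewrite !mxE. Qed.

Context (d : measure_display) (T : measurableType d) (P : probability T R)
    (x : nat -> nat -> {RV P >-> R}).
Hypotheses (x_sym : forall i j, (i < j)%N -> x j i = x i j)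
    (x_indep : mutually_independent [set p : nat * nat | (p.1 <= p.2)%N]
                 (fun p => x p.1 p.2))
    (x_cont : forall i j, (i <= j)%N -> continuous_law (x i j)).

(** The determinant is a polynomial in the entries, and it is nonzero for the
    matrix with diagonal entries [1, ..., N] and border [(1, ..., 1)]. *)
Lemma krylov_ae_neq0 N : (0 < N)%N ->
  P [set w | \det (krylov (mxC (entries x w) N) (border (entries x w) N)) = 0] = 0%E.
Proof.
move=> N0; set k : R := (Num.sqrt N%:R)^-1.
have k0 : k != 0 by rewrite invr_eq0 gt_eqF// sqrtr_gt0 ltr0n.
pose F (y : nat * nat -> R) := krylov_det k (fun i j => y (minn i j, maxn i j)) N.
pose c (p : nat * nat) : R := k^-1 * (if p.1 == p.2 then p.1%:R else (p.1 == 0%N)%:R).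
pose s := [seq p <- [seq (i, j) | i <- iota 0 N.+1, j <- iota 0 N.+1] | (p.1 <= p.2)%N].
have sE p : p \in s = (p.1 <= p.2 <= N)%N.
  rewrite mem_filter; apply/andP/andP => -[p12 p2]; split=> //.
    by move/allpairsP: p2 => [[i j] [_ jN ->]]; move: jN; rewrite mem_iota.
  apply/allpairsP; exists p; rewrite !mem_iota !add0n !ltnS p2 (leq_trans p12 p2).
  by case: (p).
have := @polynomial_ae_neq0 _ _ _ P _ _ (fun p => x p.1 p.2) x_indep F c s.
have -> : [set w | F (fun p => if p \in s then x p.1 p.2 w else c p) = 0] =
   [set w | \det (krylov (mxC (entries x w) N) (border (entries x w) N)) = 0].
  apply/funext => w /=; rewrite -krylov_detE -/k; congr (_ = 0).
  apply: eq_krylov_det => i j iN jN; rewrite sE /= geq_max iN jN.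
  rewrite (leq_trans (geq_minl i j) (leq_maxl i j))/= /entries.
  by case: (ltngtP i j) => [//|/x_sym ->|->].
apply.
- move=> y i.
  exists (krylov_det k%:P (fun a b => if (minn a b, maxn a b) == i then 'X
            else (y (minn a b, maxn a b))%:P) N) => t.
  rewrite -[RHS]/(horner_eval t _) rmorph_krylov_det /= /horner_eval hornerC.
  apply: eq_krylov_det => a b _ _.
  by case: ifP => _; rewrite ?hornerX ?hornerC.
- by move=> d' T' Y mY; exact: measurable_krylov_det.
- by move=> p; rewrite sE => /andP[p12 _]; exact: x_cont.
- by apply/filter_uniq/allpairs_uniq; rewrite ?iota_uniq// => -[? ?] [? ?].
- by move=> p /=; rewrite sE => /andP[].
have := krylov_det_diag_neq0 N k0; rewrite /F; congr (_ != 0).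
by apply: eq_krylov_det => i j _ _; rewrite /c /= [i == j]eq_sym; case: (ltngtP i j) => [ij|ij|->];
  rewrite ?eqxx ?(ltn_eqF ij)// ?(gtn_eqF ij).
Qed.
End KrylovReal.

(** * Measurability of the interlacing event *)

Section RealRoots.
Context (d : measure_display) (T : measurableType d) (R : realType).

Lemma horner_char_poly n (A : 'M[R]_n) (t : R) : (char_poly A).[t] = \det (t%:M - A).
Proof.
rewrite -/(horner_eval t _) -det_map_mx; congr (\det _); apply/matrixP => i j.
by rewrite !mxE /= /horner_eval hornerD hornerN hornerC hornerMn hornerX.
Qed.

Lemma measurable_char_poly n (A : T -> 'M[R]_n) (t : R) :
  (forall i j, measurable_fun setT (fun w => A w i j)) ->
  measurable_fun setT (fun w => (char_poly (A w)).[t]).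
Proof.
move=> mA; under eq_fun do rewrite horner_char_poly.
apply: measurable_det => i j; under eq_fun do rewrite !mxE.
by apply: measurable_funB => //; exact: measurable_cst.
Qed.

(** For each [k], the sequences with entries at most [k + 1] and gaps at least
    [1 / (k + 1)] form a compact set, and their conditions are the vanishing of
    one continuous function. *)
Lemma measurable_increasing_roots m (h : T -> nat -> {poly R}) :
  (forall i t, measurable_fun setT (fun w => (h w i).[t])) ->
  measurable [set w | exists u : nat -> R, (forall i, (i < m)%N -> u i < u i.+1) /\
    forall i, (i <= m)%N -> root (h w i) (u i)].
Proof.
move=> mh; pose E := 'rV[R]_m.+1.
pose f k w (q : E) := \sum_(i < m.+1) `|(h w i).[q 0 i]| +
  \sum_(i < m) Num.max 0 (q 0 (inord i) + k.+1%:R^-1 - q 0 (inord i.+1)).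
have s1_ge0 w (q : E) : 0 <= \sum_(i < m.+1) `|(h w i).[q 0 i]| by exact: sumr_ge0.
have max0 (r : R) : 0 <= Num.max 0 r by rewrite le_max lexx.
have s2_ge0 k (q : E) :
    0 <= \sum_(i < m) Num.max 0 (q 0 (inord i) + k.+1%:R^-1 - q 0 (inord i.+1)).
  by apply: sumr_ge0 => i _; exact: max0.
have mk k : measurable [set w | exists q : E, (forall i, `|q 0 i| <= k.+1%:R) /\ f k w q = 0].
  apply: measurable_exists_zero; first by rewrite ltr0n.
  - move=> q; apply: measurable_funD; last exact: measurable_cst.
    by apply: measurable_sum => i; apply: measurableT_comp => //; exact: mh.
  - move=> w; have cc (i : 'I_m.+1) : continuous (fun q : E => q 0 i).
      exact: coord_continuous.
    apply: continuous_addf.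
      apply: continuous_sum_fun => i q.
      apply: (@continuous_comp _ _ _ (fun q : E => (h w i).[q 0 i]) Num.norm).
        apply: (@continuous_comp _ _ _ (fun q : E => q 0 i) (horner (h w i))).
          exact: cc.
        exact: continuous_horner.
      exact: norm_continuous.
    apply: continuous_sum_fun => i; apply: continuous_max0.
    apply: continuous_addf; last exact: continuous_oppf.
    by apply: continuous_addf => //; exact: continuous_cstf.
  - by move=> w q; exact: addr_ge0.
rewrite [X in measurable X](_ : _ = \bigcup_k
    [set w | exists q : E, (forall i, `|q 0 i| <= k.+1%:R) /\ f k w q = 0]); last first.
  apply/seteqP; split=> w /=.
  - move=> [u [ui ur]].
    pose M := \sum_(i < m.+1) `|u i| + \sum_(i < m) (u i.+1 - u i)^-1.
    have gap0 (i : 'I_m) : 0 < u i.+1 - u i by rewrite subr_gt0 ui.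
    have M1 : 0 <= \sum_(i < m.+1) `|u i| by exact: sumr_ge0.
    have M2 : 0 <= \sum_(i < m) (u i.+1 - u i)^-1.
      by apply: sumr_ge0 => i _; rewrite invr_ge0 ltW.
    have M0 : 0 <= M by exact: addr_ge0.
    pose k := Num.bound M.
    have Mk : M <= k.+1%:R.
      by apply: (le_trans (ltW (archi_boundP M0))); rewrite ler_nat.
    exists k => //; exists (\row_i u i); split.
      move=> i; rewrite mxE; apply: le_trans Mk; rewrite /M (bigD1 i)//= -addrA lerDl.
      by apply: addr_ge0 => //; exact: sumr_ge0.
    rewrite /f !big1 ?addr0// => i _; last by rewrite mxE (rootP (ur i _)) ?normr0// -ltnS.
    rewrite !mxE !inordK ?ltnS//; last exact: ltnW.
    apply/eqP; rewrite eq_le max0 andbT ge_max lexx /= subr_le0 -lerBrDl.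
    rewrite invf_ple ?posrE ?ltr0n//; apply: le_trans Mk.
    rewrite /M (bigD1 i)//= addrCA lerDl; apply: addr_ge0 => //.
    by apply: sumr_ge0 => j _; rewrite invr_ge0 ltW.
  - move=> [k _ [q [_ /eqP fq]]]; move: fq; rewrite /f paddr_eq0// => /andP[q1 q2].
    exists (fun i => q 0 (inord i)); split=> i im.
      move: q2; rewrite psumr_eq0 => [/allP q2|j _]; last exact: max0.
      have /eqP := q2 (Ordinal im) (mem_index_enum _); rewrite /=.
      move=> q20; have : q 0 (inord i) + k.+1%:R^-1 - q 0 (inord i.+1) <= 0.
        by rewrite -q20 le_max lexx orbT.
      have : 0 < k.+1%:R^-1 :> R by rewrite invr_gt0 ltr0n.
      by move=> h1; rewrite subr_le0; apply: lt_le_trans; rewrite ltrDl.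
    move: q1; rewrite psumr_eq0// => /allP q1.
    by have := q1 (inord i) (mem_index_enum _); rewrite /= normr_eq0 inordK.
exact: bigcup_measurable.
Qed.

(** A strictly increasing sequence of [2n + 1] numbers, alternately eigenvalues
    of [C] and of [X], expresses the interlacing for some of the real eigenvalues
    of [X]; that these are all of them is the failure of a second condition of
    the same kind.  Both conditions avoid [l], which depends on the matrix. *)
Lemma interlacing_real_spectrumP n (X : 'M[R]_n.+2) (C : 'M[R]_n.+1) (l : seq R) :
  ordered_spectrum C l -> interlacing_real_spectrum X l <->
  (exists u : nat -> R, (forall i, (i < n.*2)%N -> u i < u i.+1) /\
     forall i, (i <= n.*2)%N -> root (if odd i then char_poly X else char_poly C) (u i)) /\
  ~ (exists u : nat -> R, (forall i, (i < n)%N -> u i < u i.+1) /\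
     forall i, (i <= n)%N -> root (char_poly X) (u i)).
Proof.
move=> [sl lE]; have szl : size l = n.+1.
  by have := size_char_poly C; rewrite lE size_prod_XsubC => -[].
have mono m (u : nat -> R) : (forall i, (i < m)%N -> u i < u i.+1) ->
    forall i j, (i < j)%N -> (j <= m)%N -> u i < u j.
  move=> ui i; elim=> [//|j IH] ij jm.
  move: ij; rewrite ltnS leq_eqVlt => /orP[/eqP ->|ij]; first exact: ui.
  by apply: lt_trans (ui _ jm); apply: IH => //; exact: ltnW.
split.
- move=> [z [sz zs ze zl]]; split.
    exists (fun i => if odd i then z`_i./2 else l`_i./2); split=> i im.
      have i2 : (i./2 < n.+2.-2)%N by rewrite /=; lia.
      have /andP[h1 h2] := zl _ i2.
      rewrite /= uphalf_half; case: (boolP (odd i)) => /= oi; first by rewrite add1n.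
      by rewrite add0n.
    case: (boolP (odd i)) => oi.
      rewrite -eigenvalue_complexify ze; apply: mem_nth; rewrite sz /=; lia.
    rewrite lE root_prod_XsubC; apply: mem_nth; rewrite szl; lia.
  move=> [u [ui ur]]; have mu := mono _ _ ui.
  have us : uniq (mkseq u n.+1).
    apply: (sorted_uniq lt_trans ltxx); apply/(sortedP 0) => i; rewrite size_mkseq => im.
    by rewrite !nth_mkseq//; [apply: ui|exact: ltnW].
  have sub : {subset mkseq u n.+1 <= z}.
    move=> y /(nthP 0)[i ]; rewrite size_mkseq => im <-.
    by rewrite nth_mkseq// -ze eigenvalue_complexify ur.
  by have := uniq_leq_size us sub; rewrite size_mkseq sz /= ltnn.
- move=> [[u [ui ur]] nv]; have mu := mono _ _ ui.
  pose l' := mkseq (fun i => u i.*2) n.+1; pose z := mkseq (fun i => u i.*2.+1) n.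
  have sl' : sorted <%R l'.
    apply/(sortedP 0) => i; rewrite size_mkseq => im.
    by rewrite !nth_mkseq//; [apply: mu; lia|exact: ltnW].
  have ll' : l = l'.
    apply: (sorted_eq le_trans le_anti sl); first exact: (sub_sorted (fun _ _ => @ltW _ _ _ _) sl').
    have ul' := sorted_uniq lt_trans ltxx sl'.
    have sub : {subset l' <= l}.
      move=> y /(nthP 0)[i ]; rewrite size_mkseq => im <-; rewrite nth_mkseq//.
      have := ur i.*2; rewrite odd_double /= leq_double lE root_prod_XsubC; apply; lia.
    have le : (size l <= size l')%N by rewrite szl size_mkseq.
    have [_ e] := uniq_min_size ul' sub le.
    by apply: uniq_perm => //; exact: leq_size_uniq ul' sub le.
  have sz : sorted <%R z.
    apply/(sortedP 0) => i; rewrite size_mkseq => im.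
    by rewrite !nth_mkseq//; [apply: mu; lia|exact: ltnW].
  exists z; split=> //; first by rewrite size_mkseq.
    move=> y; rewrite eigenvalue_complexify; apply/idP/idP; last first.
      move=> /(nthP 0)[i ]; rewrite size_mkseq => im <-; rewrite nth_mkseq//.
      have := ur i.*2.+1; rewrite /= odd_double /=; apply; lia.
    move=> ry; apply: contraT => yz; exfalso; apply: nv.
    pose s := sort <=%R (y :: z).
    have ss : size s = n.+1 by rewrite size_sort /= size_mkseq.
    exists (nth 0 s); split=> i im.
      apply: (sorted_ltn_nth lt_trans); rewrite ?inE ?ss//; last exact: ltnW.
      rewrite lt_sorted_uniq_le sort_uniq /= yz (sorted_uniq lt_trans ltxx sz) /=.
      exact: sort_sorted le_total _.
    have : s`_i \in s by apply: mem_nth; rewrite ss.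
    rewrite mem_sort inE => /orP[/eqP ->//|/(nthP 0)[j]].
    rewrite size_mkseq => jm <-; rewrite nth_mkseq//.
    have := ur j.*2.+1; rewrite /= odd_double /=; apply; lia.
  move=> i im; rewrite ll' !nth_mkseq//; try lia.
  by apply/andP; split; apply: mu; rewrite ?doubleS; lia.
Qed.
End RealRoots.

(** * Convergence of the probability of interlacing *)

Section InterlacingConvergence.
Context (R : realType) (d : measure_display) (T : measurableType d)
    (P : probability T R) (s : R) (x : nat -> nat -> {RV P >-> R})
    (beta : nat -> T -> R[i]) (lambda : nat -> T -> seq R).
Hypotheses (s_ge0 : 0 <= s)
    (x_sym : forall i j, (i < j)%N -> x j i = x i j)
    (x_indep : mutually_independent [set p : nat * nat | (p.1 <= p.2)%N]
                 (fun p => x p.1 p.2))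
    (x_same : forall i j, (i <= j)%N -> same_law (x i j) (x 0%N 0%N))
    (x_mean : forall i j, (i <= j)%N -> ('E_P[x i j] = 0)%E)
    (x_var : forall i j, (i <= j)%N -> 'V_P[x i j] = (s ^+ 2)%:E)
    (betaP : forall N w,
       eigenvalue_of_nonpositive_type (complexify (mxH R N))
         (complexify (mxX (fun i j => x i j w) N)) (beta N w))
    (lambdaP : forall N w,
       ordered_spectrum (mxC (fun i j => x i j w) N) (lambda N w))
    (x_cont_off : forall i j, (i < j)%N -> continuous_law (x i j)).

Lemma entry_continuous i j : (i <= j)%N -> continuous_law (x i j).
Proof.
move=> ij N hN A mA AN.
rewrite (x_same ij mA) -(x_same (leq0n 1) mA).
exact: (x_cont_off (ltn0Sn 0) hN mA AN).
Qed.

(** A variable of zero variance is constant, and a continuous law has no atoms. *)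
Lemma deviation_gt0 : 0 < s.
Proof.
rewrite lt_neqAle s_ge0 andbT; apply/eqP => s0.
have x2 : (\int[P]_w (x 0%N 1%N w ^+ 2)%:E = 0)%E.
  by rewrite (entry_second_moment x_mean x_var)// -s0 expr0n.
have mx : measurable_fun setT (x 0%N 1%N : T -> R) by exact: measurable_entry.
have mx2 : measurable_fun setT (fun w => (x 0%N 1%N w ^+ 2)%:E).
  by apply/measurable_EFinP; exact: measurable_funX.
have m0 : measurable [set w | x 0%N 1%N w = 0].
  by rewrite -[X in measurable X]setTI; exact: mx measurableT _ (measurable_set1 0).
have p0 : P [set w | x 0%N 1%N w = 0] = 0%E.
  rewrite -[RHS](continuous_law_root (x_cont_off (ltn0Sn 0)) (negbT (polyX_eq0 R))).
  by congr (P _); apply/funext => w /=; rewrite rootE hornerX; apply/propext; split => /eqP.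
have ae0 : ae_eq P setT (fun w => (x 0%N 1%N w ^+ 2)%:E) (cst 0%E).
  apply/(ae_eq_integral_abs P measurableT mx2); rewrite -[RHS]x2.
  by apply: eq_integral => w _; rewrite gee0_abs// lee_fin sqr_ge0.
have p1 : P (~` [set w | x 0%N 1%N w = 0]) = 0%E.
  apply: measure_negligible; first exact: measurableC.
  apply: negligibleS ae0 => w /= xw h; apply: xw.
  by have /eqP := h I; rewrite eqe sqrf_eq0 => /eqP.
by move: p1; rewrite probability_setC// p0 sube0 => /eqP; rewrite onee_eq0.
Qed.

Let event N := [set w | interlacing_real_spectrum
  (mxX (fun i j => x i j w) N) (lambda N w)].

Lemma measurable_interlacing N : measurable (event N).
Proof.
have mX i j : measurable_fun setT (fun w => mxX (entries x w) N i j).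
  under eq_fun do rewrite mxX_entry; apply: measurable_funM; first exact: measurable_cst.
  by apply: measurable_funM; [exact: measurable_cst|exact: measurable_entry].
have mC i j : measurable_fun setT (fun w => mxC (entries x w) N i j).
  under eq_fun do rewrite !mxE; apply: measurable_funM; first exact: measurable_cst.
  exact: measurable_entry.
have pX t := measurable_char_poly t mX; have pC t := measurable_char_poly t mC.
case: N => [|n] in mX mC pX pC *.
  (* A one by one matrix has a real eigenvalue. *)
  rewrite [event 0](_ : _ = set0)//; apply/seteqP; split=> // w [z [/size0nil -> _ ze _]].
  have := ze (mxX (fun i j => x i j w) 0 0 0); rewrite eigenvalue_complexify in_nil.
  by move=> /negbT /negP; apply; rewrite rootE horner_char_poly det_mx11 !mxE subrr.
rewrite /event [X in measurable X](_ : _ =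
    [set w | exists u : nat -> R, (forall i, (i < n.*2)%N -> u i < u i.+1) /\
      forall i, (i <= n.*2)%N -> root (if odd i then char_poly (mxX (entries x w) n.+1)
                                  else char_poly (mxC (entries x w) n.+1)) (u i)] `\`
    [set w | exists u : nat -> R, (forall i, (i < n)%N -> u i < u i.+1) /\
      forall i, (i <= n)%N -> root (char_poly (mxX (entries x w) n.+1)) (u i)]).
  by apply: measurableD; apply: measurable_increasing_roots => i t //; case: (odd i).
by apply/funext => w; apply/propext; exact: interlacing_real_spectrumP (lambdaP _ _).
Qed.

(** Outside a null event the interlacing can fail only if [beta] is real, that is,
    at distance at least [s / sqrt 2] from its limit. *)
Lemma interlacing_cvg : probability_cvg P event 1.
Proof.
split; first exact: measurable_interlacing.
set z : R[i] := 0 +i* (Num.sqrt 2 / 2 * s); pose eta := Im z.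
have eta0 : 0 < eta by rewrite /eta /z /= mulr_gt0 ?deviation_gt0 ?divr_gt0 ?sqrtr_gt0.
have eta2 : 0 < eta / 2 by rewrite divr_gt0.
pose far N := [set w | eta / 2 < normc (beta N w - z)].
have [mfar far_cvg] := beta_cvg s_ge0 x_sym x_indep x_same x_mean x_var betaP eta2.
have mE := measurable_interlacing.
have compl N : (0 < N)%N -> (P (~` event N) <= P (far N))%E.
  case: N => // n _; pose D := [set w | \det (krylov (mxC (entries x w) n.+1) (border (entries x w) n.+1)) = 0].
  have D0 : P D = 0%E by exact: (krylov_ae_neq0 x_sym x_indep entry_continuous (ltn0Sn n)).
  have mD : measurable D.
    rewrite /D; under eq_fun do rewrite -krylov_detE.
    rewrite -[X in measurable X]setTI.
    have md : measurable_fun setT (fun w => krylov_det (Num.sqrt n.+1%:R)^-1 (entries x w) n.+1).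
      by apply: measurable_krylov_det => i j; exact: measurable_entry.
    exact: md measurableT _ (measurable_set1 0).
  have sub : ~` event n.+1 `<=` D `|` far n.+1.
    move=> w nE; have [Dw|Dw] := eqVneq (\det (krylov (mxC (entries x w) n.+1)
      (border (entries x w) n.+1))) 0; first by left.
    right; rewrite /far /= ltNge; apply/negP => close; apply: nE.
    apply: (interlacing_of_coupled (entries_symmetric x_sym w) (lambdaP _ w) Dw (betaP _ w)).
    apply/eqP => Ib; move: close; apply/negP; rewrite -ltNge.
    apply: lt_le_trans (ler_Im_normc _); rewrite cImD cImN Ib sub0r normrN.
    by rewrite -/eta gtr0_norm//; lra.
  have m1 : measurable (~` event n.+1) by exact: measurableC.
  have m2 : measurable (D `|` far n.+1) by exact: measurableU mD (mfar _).
  apply: (le_trans (le_measure P (mem_set m1) (mem_set m2) sub)).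
  by apply: (le_trans (measureU2 P mD (mfar _))); rewrite -[leRHS]add0e -{1}D0.
have compl_cvg : (P (~` event N) @[N --> \oo] --> 0%:E)%E.
  apply: (@squeeze_cvge _ _ _ _ (fun=> 0%E) _ (fun N => P (far N))) => //.
  - by near=> N; rewrite measure_ge0 compl//; near: N; exists 1%N.
  - exact: cvg_cst.
have -> : (fun N => P (event N)) = (fun N => 1%E - P (~` event N))%E.
  by apply/funext => N; rewrite probability_setC// oppeB// ?addeA ?subee ?add0e.
have def : ((1%:E : \bar R) +? - 0%:E)%E by [].
have := cvgeB def (@cvg_cst _ _ _ (\oo) _) compl_cvg.
by rewrite sube0; apply.
Unshelve. all: by end_near.
Qed.
End InterlacingConvergence.

Theorem theorem8 (R : realType) (d : measure_display) (T : measurableType d)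
    (P : probability T R) (s : R) (x : nat -> nat -> {RV P >-> R})
    (beta : nat -> T -> R[i]) (lambda : nat -> T -> seq R)
    (s_ge0 : 0 <= s)
    (x_sym : forall i j, (i < j)%N -> x j i = x i j)
    (x_indep : mutually_independent [set p : nat * nat | (p.1 <= p.2)%N]
                 (fun p => x p.1 p.2))
    (x_same : forall i j, (i <= j)%N -> same_law (x i j) (x 0%N 0%N))
    (x_mean : forall i j, (i <= j)%N -> ('E_P[x i j] = 0)%E)
    (x_var : forall i j, (i <= j)%N -> 'V_P[x i j] = (s ^+ 2)%:E)
    (betaP : forall N w,
       eigenvalue_of_nonpositive_type (complexify (mxH R N))
         (complexify (mxX (fun i j => x i j w) N)) (beta N w))
    (lambdaP : forall N w,
       ordered_spectrum (mxC (fun i j => x i j w) N) (lambda N w)) :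
  cvg_in_probability P beta (0 +i* (Num.sqrt 2 / 2 * s)) /\
  ((forall i j, (i < j)%N -> continuous_law (x i j)) ->
   probability_cvg P
     (fun N => [set w | interlacing_real_spectrum
                          (mxX (fun i j => x i j w) N) (lambda N w)]) 1).
Proof.
split; first exact: (beta_cvg s_ge0 x_sym x_indep x_same x_mean x_var betaP).
move=> x_cont.
exact: (interlacing_cvg s_ge0 x_sym x_indep x_same x_mean x_var betaP lambdaP x_cont).
Qed.
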